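(* Let $(a_k)_{k\in\mathbb{N}}$ be a sequence with $a_k>0$ for all $k\in\mathbb{N}$, let $\mu=\sum_{k\in\mathbb{N}}a_k\delta_k$, and let $\check{\mathcal{E}}$ be the trace of the Bessel Dirichlet form $\mathcal{E}$ (case $n=3$) with respect to $\mu$. 1. Assume that $\mu$ is finite, i.e. $\mu(\mathbb{N})<\infty$. Then $\check{\mathcal{E}}$ is not conservative. 2. Assume that $\mu$ is infinite, i.e. $\mu(\mathbb{N})=\infty$. Then $\check{\mathcal{E}}$ is conservative if and only if $$\sum_{k=1}^\infty\frac{a_k}{k}=\infty .$$
   Context: $\mathbb{N}=\{1,2,\dots\}$ and $I=(0,\infty)$; $AC(I)$ denotes the (locally) absolutely continuous functions on $I$. Let $dm=2x^2\,dx$ on $I$. The Bessel Dirichlet form (case $n=3$) is the form in $L^2(I,m)$ with $$\mathcal{D}=\{u\in AC(I)\cap L^2(I,m):\ \int_0^\infty (u')^2x^2\,dx<\infty\},\qquad \mathcal{E}[u]=\int_0^\infty (u'(x))^2x^2\,dx .$$ For $\lambda>0$, $\mathcal{E}_\lambda[u]=\mathcal{E}[u]+\lambda\int_I u^2\,dm$. Trace with respect to $\mu=\sum_{k\in\mathbb{N}}a_k\delta_k$: $\ell^2(\mathbb{N},\mu)=L^2(\mathbb{N},\mu)$ is the space of real sequences with $\sum_k a_ku_k^2<\infty$. Let $D(J)=\{u\in\mathcal{D}:\sum_{k}a_ku(k)^2<\infty\}$ and $J:D(J)\to\ell^2(\mathbb{N},\mu)$, $Ju=u|_{\mathbb{N}}$.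 For $\lambda>0$ let $P_\lambda$ be the orthogonal projection in $(\mathcal{D},\mathcal{E}_\lambda)$ onto the $\mathcal{E}_\lambda$-orthogonal complement of $\ker J=\{u\in\mathcal{D}:u(k)=0\ \forall k\in\mathbb{N}\}$, and set $\check{\mathcal{E}}_\lambda[Ju]:=\mathcal{E}_\lambda[P_\lambda u]$ for $u\in D(J)$. Each $\check{\mathcal{E}}_\lambda$ is a closed form in $\ell^2(\mathbb{N},\mu)$ with domain $\operatorname{ran}J$, and the family is monotone increasing in $\lambda$. The trace form $\check{\mathcal{E}}$ is by definition the Mosco limit of $\check{\mathcal{E}}_\lambda$ as $\lambda\downarrow0$; it is a Dirichlet form in $\ell^2(\mathbb{N},\mu)$. A Dirichlet form is conservative (stochastically complete) if its semigroup $\check T_t$, extended to $L^\infty$, satisfies $\check T_t1=1$ for some (hence every) $t>0$. *)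

(* Defs.v *)
From HB Require Import structures.
From mathcomp Require Import all_boot all_order all_algebra.
From mathcomp Require Import all_classical all_reals all_analysis.

Set Implicit Arguments.
Unset Strict Implicit.
Unset Printing Implicit Defensive.

Import Order.TTheory GRing.Theory Num.Theory.
Import numFieldNormedType.Exports.

Local Open Scope classical_set_scope.
Local Open Scope ring_scope.

Section BesselForm.
Context {R : realType}.
Implicit Types (u v w : R -> R) (lam : R).

Definition half_line : set R := `]0, +oo[.

Local Notation leb := (@lebesgue_measure R).

Definition abs_continuous_on (c d : R) u : Prop :=
  forall e : R, 0 < e -> exists2 del : R, 0 < del &
  forall (n : nat) (s t : 'I_n -> R),
    (forall i, c <= s i /\ s i <= t i /\ t i <= d) ->
    trivIset [set: 'I_n] (fun i => `]s i, t i[%classic) ->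
    \sum_(i < n) (t i - s i) < del ->
    \sum_(i < n) `|u (t i) - u (s i)| < e.

(* AC(I), I = (0, oo).  Elements are functions R -> R of which only the
   restriction to I matters. *)
Definition loc_abs_continuous u : Prop :=
  forall c d : R, 0 < c -> c < d -> abs_continuous_on c d u.

(* L^2(I, m) with dm = 2 x^2 dx *)
Definition L2_half_line u : Prop :=
  measurable_fun half_line u /\
  (\int[leb]_(x in half_line) (u x ^+ 2 * (2 * x ^+ 2))%:E < +oo)%E.

(* [derive1 u] is total: for u in AC(I) it is the usual derivative off a null set,
   and it is 0 at the exceptional points. *)
Definition bessel_dom u : Prop :=
  [/\ loc_abs_continuous u, L2_half_line u &
      (\int[leb]_(x in half_line) (derive1 u x ^+ 2 * x ^+ 2)%:E < +oo)%E].

Definition bessel_form u v : R :=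
  \int[leb]_(x in half_line) (derive1 u x * derive1 v x * x ^+ 2).

Definition bessel_form_lam lam u v : R :=
  bessel_form u v +
  lam * \int[leb]_(x in half_line) (u x * v x * (2 * x ^+ 2)).

(* Sequences indexed by {1, 2, ...} are functions nat -> R whose value at n is
   the term of index n.+1; likewise the weight of the point n.+1 is [a n]. *)
Definition restrN u : nat -> R := fun n => u n.+1%:R.

Definition kerJ u : Prop := bessel_dom u /\ (forall n, restrN u n = 0).

Definition kerJ_orth lam w : Prop :=
  bessel_dom w /\ (forall v, kerJ v -> bessel_form_lam lam w v = 0).

(* P_lam; uniquely determined on (0, oo) *)
Definition projJ lam u : R -> R :=
  xget (fun=> 0) [set w | kerJ_orth lam w /\
    forall v, kerJ_orth lam v -> bessel_form_lam lam (u - w) v = 0].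

End BesselForm.

Section WeightedSequences.
Context {R : realType} (a : nat -> R).
Implicit Types f g v : nat -> R.

(* mu = sum_k a_k delta_k *)
Definition pt_measure (A : set nat) : \bar R :=
  (\sum_(0 <= n <oo) (a n)%:E * \d_n A)%E.

Definition l2 f : Prop :=
  (\sum_(0 <= n <oo) (a n * f n ^+ 2)%:E < +oo)%E.

Definition l2_inner f g : R := limn (series (fun n => a n * f n * g n)).

Definition l2_norm f : R := Num.sqrt (l2_inner f f).

Definition l2_strong_cvg (F : nat -> nat -> R) f : Prop :=
  l2_norm (F j - f) @[j --> \oo] --> (0 : R).

Definition l2_weak_cvg (F : nat -> nat -> R) f : Prop :=
  forall g, l2 g -> l2_inner (F j) g @[j --> \oo] --> l2_inner f g.

(* A quadratic form in l^2 is a map q to the extended reals with the value +oo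
   off its domain. *)
Implicit Type q : (nat -> R) -> \bar R.

Definition mosco_cvg (Q : nat -> (nat -> R) -> \bar R) q : Prop :=
  (forall F f, (forall j, l2 (F j)) -> l2 f -> l2_weak_cvg F f ->
     (q f <= limn_einf (fun j => Q j (F j)))%E) /\
  (forall f, l2 f -> exists F, [/\ forall j, l2 (F j), l2_strong_cvg F f &
     (limn_esup (fun j => Q j (F j)) <= q f)%E]).

Definition mosco_cvg_at0 (Q : R -> (nat -> R) -> \bar R) q : Prop :=
  forall lam : nat -> R, (forall j, 0 < lam j) -> lam j @[j --> \oo] --> (0 : R) ->
  mosco_cvg (fun j => Q (lam j)) q.

(* D(J) *)
Definition domJ (u : R -> R) : Prop := bessel_dom u /\ l2 (restrN u).

(* The number E_lam[P_lam u] depends only on J u, so for f in ran J this is the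
   infimum of a singleton; for f not in ran J it is inf of the empty set, +oo. *)
Definition trace_form_lam (lam : R) f : \bar R :=
  ereal_inf [set (bessel_form_lam lam (projJ lam u) (projJ lam u))%:E
            | u in [set u | domJ u /\ restrN u = f]].

(* The Mosco limit, unique as a map that is +oo off l^2. *)
Definition trace_form : (nat -> R) -> \bar R :=
  xget (fun=> +oo%E) [set q | (forall f, ~ l2 f -> q f = +oo%E) /\
                              mosco_cvg_at0 trace_form_lam q].

Definition form_dom q f : Prop := l2 f /\ (q f < +oo)%E.

Definition form_polar q f g : R := (fine (q (f + g)) - fine (q (f - g))) / 4.

(* graph of the self-adjoint operator A associated with q:
   f is in dom A and A f = g *)
Definition form_operator q f g : Prop :=
  [/\ form_dom q f, l2 g &
      forall v, form_dom q v -> form_polar q f v = l2_inner g v].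

(* T is the strongly continuous semigroup of symmetric contractions of l^2 with
   generator -A *)
Definition form_semigroup q (T : R -> (nat -> R) -> nat -> R) : Prop :=
  [/\ [/\ forall (t : R) f, 0 <= t -> l2 f -> l2 (T t f),
          forall (t c : R) f g, 0 <= t -> l2 f -> l2 g ->
            T t (c *: f + g) = c *: T t f + T t g,
          forall (t : R) f, 0 <= t -> l2 f -> l2_norm (T t f) <= l2_norm f &
          forall (t : R) f g, 0 <= t -> l2 f -> l2 g ->
            l2_inner (T t f) g = l2_inner f (T t g)],
      forall f, l2 f -> T 0 f = f,
      forall (s t : R) f, 0 <= s -> 0 <= t -> l2 f -> T (s + t) f = T s (T t f),
      forall f, l2 f -> l2_norm (T t f - f) @[t --> 0^'+] --> (0 : R) &
      forall f g, l2 f -> l2 g ->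
        (l2_norm (t^-1 *: (T t f - f) + g) @[t --> 0^'+] --> (0 : R) <->
         form_operator q f g)].

(* Extension of a Markov semigroup to bounded functions, along the exhaustion
   by the finite sets {0, ..., N - 1} of indices. *)
Definition Linf_ext (T : R -> (nat -> R) -> nat -> R) (t : R) f : nat -> R :=
  fun n => limn (fun N => T t (fun k => if (k < N)%N then f k else 0) n).

(* The semigroup of a closed, densely defined q exists and is unique on l^2. *)
Definition conservative q : Prop :=
  exists T, form_semigroup q T /\
  exists t : R, 0 < t /\ Linf_ext T t (fun=> 1) = (fun=> 1).

End WeightedSequences.

(* Main.v *)
Require Import Defs.
From HB Require Import structures.
From mathcomp Require Import all_boot all_order all_algebra.
From mathcomp Require Import all_classical all_reals all_analysis.
From mathcomp Require Import ring lra.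
From mathcomp Require Import measurable_realfun.

(** The trace form is explicit: it is the energy of a birth-death chain, and
    conservativeness is decided by one comparison function of that chain.

    The trace. The Bessel form is a form in one dimension with scale function
    [-1/x], so the segment between the points [n + 1] and [n + 2] has resistance
    [1/(n + 1) - 1/(n + 2)], hence [conductance] [b_n = (n + 1)(n + 2)]. A function
    of finite energy has at least the energy [sum_n b_n (f_(n+1) - f_n)^2] of its
    values at the integers, with equality when it is harmonic between consecutive
    integers and constant near 0; if it is square-integrable besides, its values
    tend to 0. Accordingly, [trace_formE] says that the trace form is that sum on
    the square-summable sequences that tend to 0 ([trace_dom]), and infinite
    elsewhere. The lower bound in the Mosco limit is [trace_form_lam_ge] together
    with semicontinuity, [trace_dom_fatou]; vanishing at infinity survives because
    [f_n ^ 2] is at most the energy divided by [n + 1]. The recovery sequences are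
    truncations. Both bounds need the projection in the definition of the
    approximating forms to exist, which [orthogonal_interpolant] shows by solving
    the Euler-Lagrange equation between the integers. Behind all this is the
    fundamental theorem of calculus for absolutely continuous functions,
    [loc_ac_FTC], obtained from [ac_density].

    The chain. The operator of the form is
    [gen f n = (b_(n-1) (f_n - f_(n-1)) + b_n (f_n - f_(n+1))) / a_n], with a
    Dirichlet condition at infinity. The sequence [potential]
    [V_N = sum_(k < N) a_k (1/(k + 1) - 1/(N + 1))] satisfies [gen V = -1], and it is
    bounded exactly when [sum_k a_k/(k + 1)] is finite.

    If [V] is unbounded, [1 - e (V + t)] solves the heat equation and is negative
    far out. By the maximum principle it stays below the semigroup started from the
    indicator of a large finite set, so the semigroup extends to preserve 1.

    If [V] is bounded, then [v = lim V - V] is nonnegative, tends to 0, and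
    [gen v = 1]. Let [f] be the indicator of a finite set. As the semigroup [T]
    preserves the bound 1, [t T_t f] is a subsolution of the heat equation with
    source 1, of which [v] is a stationary solution; so [t T_t f <= v], whatever the
    finite set. At points where [v] is smaller than [t] the semigroup cannot
    preserve 1. A finite measure is in this case, as [a_k/(k + 1) <= a_k].

    The semigroup. Its existence, and its positivity properties, come from the
    resolvent [J_h], the inverse of [1 + h gen]: the semigroup is the limit of the
    powers of order [2^k] of [J_(t/2^k)] ([euler]). The maximum principle passes from
    the resolvent to these powers. They converge because the defect
    [J_(s+t) - J_s J_t] is of second order ([resolvent_add]) and commuting contractions
    drift apart at most linearly ([iter_dist]). The same telescoping compares them
    with any other semigroup of the form ([semigroup_unique]), so that the comparison
    in the bounded case applies to whichever semigroup witnesses conservativeness. *)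

Set Implicit Arguments.
Unset Strict Implicit.
Unset Printing Implicit Defensive.

Import Order.TTheory GRing.Theory Num.Theory.
Import numFieldNormedType.Exports.
Local Open Scope classical_set_scope.
Local Open Scope ring_scope.

(** * Absolute continuity and variation *)

Section AbsoluteContinuity.
Context {R : realType}.
Implicit Types (u f g : R -> R) (c d e : R) (p q : R * R) (L : seq (R * R)).

(** A family of intervals is a list of pairs (right end, left end), so that a
    subdivision of one interval is such a list as well. *)
Definition in_range c d p := [&& c <= p.2, p.2 <= p.1 & p.1 <= d].

(** Disjointness of the open intervals; the last two cases are empty intervals. *)
Definition apart p q :=
  [|| p.1 <= q.2, q.1 <= p.2, p.1 <= p.2 | q.1 <= q.2].

Definition small_family c d del L :=
  [/\ all (in_range c d) L, pairwise apart L &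
      \sum_(p <- L) (p.1 - p.2) < del].

Definition list_ac c d u := forall e, 0 < e -> exists2 del, 0 < del &
  forall L, small_family c d del L -> \sum_(p <- L) `|u p.1 - u p.2| <= e.

Lemma abs_continuous_list c d u : abs_continuous_on c d u -> list_ac c d u.
Proof.
move=> acu e e0; have [del del0 H] := acu _ e0; exists del => // L [wL dL sL].
pose s (i : 'I_(size L)) := (nth (0, 0) L i).2.
pose t (i : 'I_(size L)) := (nth (0, 0) L i).1.
have := H _ s t; rewrite /s /t => {}H.
rewrite (big_nth (0, 0)) big_mkord ltW//; apply: H.
- by move=> i; have /and3P[] := all_nthP (0, 0) wL i (ltn_ord i).
- move/(pairwiseP (0, 0)): dL => dL.
  have key (i j : 'I_(size L)) : (i < j)%N ->
      `](nth (0, 0) L i).2, (nth (0, 0) L i).1[ `&`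
      `](nth (0, 0) L j).2, (nth (0, 0) L j).1[ = set0 :> set R.
    move=> ij; rewrite -subset0 => x [/=]; rewrite !in_itv/= => /andP[a1 a2] /andP[b1 b2].
    by have /or4P[] := dL i j (ltn_ord i) (ltn_ord j) ij; lra.
  apply/trivIsetP => i j _ _ ij.
  have [/key//|ji|/val_inj ijE] := ltngtP i j; last by rewrite ijE eqxx in ij.
  by rewrite setIC key.
- by move: sL; rewrite (big_nth (0, 0)) big_mkord.
Qed.

Lemma list_acB c d u v : list_ac c d u -> list_ac c d v ->
  list_ac c d (u \- v).
Proof.
move=> au av e e0; have e20 : 0 < e / 2 by rewrite divr_gt0.
have [d1 d10 h1] := au _ e20; have [d2 d20 h2] := av _ e20.
exists (Num.min d1 d2); first by rewrite lt_min d10.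
move=> L [wL dL]; rewrite lt_min => /andP[s1 s2].
have -> : e = e / 2 + e / 2 by field.
apply: le_trans (lerD (h1 L (And3 wL dL s1)) (h2 L (And3 wL dL s2))).
rewrite -big_split/=; apply: ler_sum => p _.
rewrite /= (_ : u p.1 - v p.1 - (u p.2 - v p.2) =
  u p.1 - u p.2 - (v p.1 - v p.2)); last by ring.
exact: ler_normB.
Qed.

Lemma path_le_last (a : R) s : path <%R a s -> a <= last a s.
Proof.
elim: s a => //= x s IH a /andP[ax /IH]; exact/le_trans/ltW.
Qed.

(** The consecutive pairs of a subdivision form a family of total length equal
    to that of the subdivided interval, so refining one member of a small
    family keeps it small. *)
Lemma itv_partition_pairs a b s : itv_partition a b s ->
  [/\ all (in_range a b) (zip s (a :: s)), pairwise apart (zip s (a :: s)) &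
      \sum_(p <- zip s (a :: s)) (p.1 - p.2) = b - a].
Proof.
elim: s a => [|x s IH] a /=.
  by case=> _ /eqP /= ->; rewrite big_nil subrr.
move=> /[dup] /itv_partition_cons /IH [h1 h2 h3] pa.
have ax : a <= x by case: pa => /= /andP[/ltW].
have xb : x <= b.
  by case: pa => /= /andP[_ ps] /eqP <-; apply: path_le_last.
split.
- apply/andP; split; first by rewrite /in_range /= lexx ax xb.
  by apply: sub_all h1 => p /and3P[h h' hb]; rewrite /in_range hb h' (le_trans ax h).
- rewrite h2 andbT; apply: sub_all h1 => p /and3P[h _ _].
  by rewrite /apart /= h.
- by rewrite big_cons /= h3; ring.
Qed.

(** The members of the family are replaced, one at a time, by nearly optimal
    subdivisions: the family stays small, and the increments approach the
    variation. *)
Lemma list_ac_total_variation c d u e del :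
  (forall L, small_family c d del L -> \sum_(p <- L) `|u p.1 - u p.2| <= e) ->
  forall L, small_family c d del L ->
  (\sum_(p <- L) total_variation p.2 p.1 u <= e%:E)%E.
Proof.
move=> H L sL.
suff: forall L1 L2, small_family c d del (L1 ++ L2) ->
    (\sum_(p <- L1) total_variation p.2 p.1 u +
     (\sum_(p <- L2) `|u p.1 - u p.2|)%:E <= e%:E)%E.
  by move=> /(_ L nil); rewrite cats0 big_nil adde0; apply.
elim=> [|p L1 IH] L2 sL2; first by rewrite big_nil add0e lee_fin H.
have pw : in_range c d p by case: sL2 => /= /andP[].
have [/= /andP[_ aL] /andP[pL dL] lL] := sL2.
have pge : p.2 <= p.1 by case/and3P: pw.
rewrite big_cons -addeA.
set X := (X in (_ + X)%E).
have Xge : (0 <= X)%E.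
  rewrite /X adde_ge0// ?lee_fin ?sumr_ge0//.
  rewrite big_seq sume_ge0// => q qL; apply: total_variation_ge0.
  by move: aL; rewrite all_cat => /andP[/allP /(_ _ qL) /and3P[]].
have Xle : (X <= e%:E)%E.
  apply: IH; split=> //; apply: le_lt_trans lL.
  by rewrite big_cons ler_wpDl// subr_ge0.
have Xfin : X \is a fin_num by rewrite ge0_fin_numE// (le_lt_trans Xle) ?ltry.
rewrite -(fineK Xfin) -leeBrDr// -EFinB.
apply: ge_ereal_sup => _ [_ [s ps <-] <-]; rewrite variation_zip//.
have [z1 z2 z3] := itv_partition_pairs ps.
rewrite lee_fin lerBrDr -lee_fin EFinD fineK// /X.
rewrite addeCA -EFinD -big_cat/=; apply: IH; split.
- move: aL; rewrite !all_cat => /andP[-> ->]; rewrite andbT/=.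
  apply: sub_all z1 => q /and3P[q1 q2 q3]; case/and3P: pw => h1 h2 h3.
  by rewrite /in_range (le_trans h1 q1) q2 (le_trans q3 h3).
- move: dL pL; rewrite !pairwise_cat all_cat !allrel_catr => /and3P[d1 d2 d3] /andP[p1 p2].
  have sub q r : q \in zip s (p.2 :: s) -> apart p r -> apart q r.
    move/(allP z1) => /and3P[q1 q2 q3] /or4P[] h; apply/or4P.
    - by apply: Or41; apply: le_trans h.
    - by apply: Or42; apply: le_trans q1.
    - by apply: Or43; apply: le_trans q3 (le_trans h q1).
    - exact: Or44.
  rewrite d1 d2 d3 z2 /= !andbT; apply/andP; split.
    have apartC q r : apart q r = apart r q.
      by rewrite /apart orbCA; do 2 congr (_ || _); rewrite orbC.
    by apply/allrelP => q r qL /sub h; rewrite apartC h//; apply: (allP p1).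
  by apply/allrelP => q r /sub h /(allP p2) /h.
- move: lL; rewrite big_cons !big_cat/= z3; lra.
Qed.

End AbsoluteContinuity.

(** * Densities of absolutely continuous functions *)

Section Density.
Context {R : realType}.
Implicit Types (u f g G : R -> R) (c d e : R) (p q : R * R) (L : seq (R * R)).
Local Notation leb := (@lebesgue_measure R).

(** Each piece of a subdivision that is finer than the modulus at 1 contributes
    at most 1 to the variation. *)
Lemma list_ac_bounded_variation c d u : c <= d -> list_ac c d u ->
  total_variation c d u \is a fin_num.
Proof.
move=> cd acu; have [del del0 /list_ac_total_variation H] := acu 1 ltr01.
pose n := (Num.bound ((d - c) / del)).+1.
have n0 : (0 : R) < n%:R by rewrite ltr0n.
pose h := (d - c) / n%:R.
have h0 : 0 <= h by rewrite divr_ge0 ?subr_ge0// ltW.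
have hdel : h < del.
  rewrite ltr_pdivrMr// mulrC -ltr_pdivrMr//.
  apply: (lt_trans (archi_boundP _)); last by rewrite ltr_nat.
  by rewrite divr_ge0 ?subr_ge0// ltW.
have hn : c + n%:R * h = d by rewrite /h; field; apply: lt0r_neq0.
suff K i : (i <= n)%N -> (total_variation c (c + i%:R * h) u <= i%:R%:E)%E.
  rewrite ge0_fin_numE; last exact: total_variation_ge0.
  by rewrite -hn; apply: le_lt_trans (K _ (leqnn _)) _; rewrite ltry.
elim: i => [|i IH] lein; first by rewrite mul0r addr0 total_variationxx.
have ih0 : 0 <= i%:R * h by rewrite mulr_ge0.
have step : c + i%:R * h <= c + i.+1%:R * h by rewrite lerD2l ler_wpM2r// ler_nat.
rewrite (total_variationD _ _ step) ?lerDl// (_ : i.+1%:R%:E = i%:R%:E + 1)%E; last first.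
  by rewrite -EFinD natr1.
rewrite leeD ?IH ?(ltnW lein)//.
have := H [:: (c + i.+1%:R * h, c + i%:R * h)]; rewrite !big_seq1/=; apply.
split=> //.
  rewrite /= /in_range/= lerDl ih0 step/= andbT -hn lerD2l.
  by rewrite ler_wpM2r// ler_nat.
rewrite big_seq1 /=; suff -> : c + i.+1%:R * h - (c + i%:R * h) = h by [].
by rewrite -natr1; ring.
Qed.

(** Composition with it extends a function on [c, d] to the whole line by
    constants, where a Stieltjes measure lives. *)
Definition clamp c d (x : R) := Num.max c (Num.min d x).

Lemma clamp_range c d x : c <= d -> c <= clamp c d x <= d.
Proof. by move=> cd; rewrite /clamp le_max lexx/= ge_max cd ge_min lexx. Qed.

Lemma clamp_id c d x : c <= x <= d -> clamp c d x = x.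
Proof.
by move=> /andP[cx xd]; rewrite /clamp (min_idPr xd) (max_idPr cx).
Qed.

Lemma clamp_le c d x y : x <= y -> clamp c d x <= clamp c d y.
Proof.
move=> xy; rewrite /clamp ge_max le_max lexx/= le_max.
by apply/orP; right; rewrite le_min !ge_min lexx xy orbT.
Qed.

Lemma clamp_dist c d x y : x <= y -> clamp c d y - clamp c d x <= y - x.
Proof.
by move=> xy; rewrite /clamp /Num.max /Num.min; repeat case: ifPn; rewrite -?leNgt; lra.
Qed.

Lemma clamp_family c d del L : c <= d -> all (fun p => p.2 <= p.1) L ->
  pairwise apart L -> \sum_(p <- L) (p.1 - p.2) < del ->
  small_family c d del [seq (clamp c d p.1, clamp c d p.2) | p <- L].
Proof.
move=> cd oL aL sL; split.
- rewrite all_map; apply: sub_all oL => p pp; rewrite /= /in_range/=.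
  have /andP[-> _] := clamp_range p.2 cd; have /andP[_ ->] := clamp_range p.1 cd.
  by rewrite clamp_le.
- rewrite pairwise_map; apply: sub_pairwise aL => p q /or4P[] h;
  by rewrite /apart/= (clamp_le c d h) ?orbT.
- apply: le_lt_trans sL; rewrite big_map big_seq [leRHS]big_seq.
  apply: ler_sum => p /(allP oL); exact: clamp_dist.
Qed.

Lemma list_ac_clamp c d G : c <= d -> (forall x, G x = G (clamp c d x)) ->
  list_ac c d G -> forall e, 0 < e -> exists2 del, 0 < del &
  forall L, all (fun p => p.2 <= p.1) L -> pairwise apart L ->
    \sum_(p <- L) (p.1 - p.2) < del -> \sum_(p <- L) (G p.1 - G p.2) <= e.
Proof.
move=> cd GE acG e e0; have [del del0 H] := acG _ e0.
exists del => // L oL aL sL.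
have := H _ (clamp_family cd oL aL sL); rewrite big_map; apply: le_trans.
by apply: ler_sum => p _; rewrite /= -!GE ler_norm.
Qed.

(** The components of an open set are given as sets; a list of intervals needs
    their ends. *)
Lemma open_interval_ends (A : set R) : open A -> is_interval A ->
  (leb A < +oo)%E -> exists s t, [/\ s <= t, A `<=` `]s, t],
    `]s, t[ `<=` A & leb A = (t - s)%:E].
Proof.
move=> oA /is_intervalP AE; have [A0|/set0P A0] := eqVneq A set0.
  exists 0, 0; rewrite A0 measure0 subrr; split=> // x /=.
  by rewrite in_itv/= => /andP[h1 h2]; have := lt_trans h1 h2; rewrite ltxx.
move: (oA) (A0); rewrite AE; case: (Rhull A) => a b oI [z zI].
have left x : x \in Interval a b -> exists2 y, y \in Interval a b & y < x.
  move=> xI; move: (oI x xI) => /nbhs_ballP[e /= e0] /(_ (x - e / 2)).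
  rewrite /ball/= opprB addrC subrK => h; exists (x - e / 2); last by lra.
  by apply: h; rewrite gtr0_norm ?divr_gt0//; lra.
have [y0 y0I y0z] := left _ zI.
rewrite lebesgue_measure_itv/=; case: ifPn => [ab|]; last first.
  move: zI y0I => /=; rewrite /in_mem/= => /andP[za zb] /andP[ya yb] /negP[].
  by case: a b za zb ya yb {oI left} => [[] x|[]] [[] y|[]]//=;
    rewrite ?bnd_simp ?lte_fin ?ltry ?ltNyr//; lra.
case: a b ab left {oI zI y0I} => [l s|[]] [r t|[]]//= st left _.
rewrite lte_fin in st.
exists s, t; split=> //; first exact: ltW.
- move=> x xI; have := xI; rewrite /= !in_itv/= => sxt.
  have xt : x <= t by move: sxt; case: (r); case: (l) => /= /andP[]; lra.
  rewrite xt andbT lt_neqAle; apply/andP; split; last first.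
    by move: sxt; case: (r); case: (l) => /= /andP[]; lra.
  apply/eqP => sx; have [y] := left x xI.
  by rewrite in_itv/= -sx; case: (l) => /= /andP[]; lra.
- move=> x /=; rewrite !in_itv/= => /andP[h1 h2].
  by case: (l); case: (r); rewrite /= ?h1 ?h2 ?(ltW h1) ?(ltW h2).
Qed.



Lemma list_ac_continuous c d G : c <= d -> (forall x, G x = G (clamp c d x)) ->
  {homo G : x y / x <= y} -> list_ac c d G -> continuous G.
Proof.
move=> cd GE ndG acG x; apply/cvgrPdist_le => e e0.
have [del del0 H] := list_ac_clamp cd GE acG e0.
near=> y.
have : `|x - y| < del by near: y; exact: (@cvgr_dist_lt _ _ _ _ _ id).
have [xy|yx] := leP x y; rewrite distrC => h.
  rewrite distrC ger0_norm ?subr_ge0 ?ndG//.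
  have := H [:: (y, x)]; rewrite !big_seq1/= xy => /(_ isT isT); apply.
  by apply: le_lt_trans h; rewrite ler_norm.
rewrite ger0_norm; last by rewrite subr_ge0 ndG// ltW.
have := H [:: (x, y)]; rewrite !big_seq1/= (ltW yx) => /(_ isT isT); apply.
by apply: le_lt_trans h; rewrite distrC ler_norm.
Unshelve. all: by end_near. Qed.

(** A monotone absolutely continuous function has a density: its Stieltjes
    measure gives small mass to any finite disjoint union of short intervals,
    hence none to a null set, and the Radon-Nikodym theorem applies. *)
Lemma nondecreasing_ac_density c d G : c <= d ->
  (forall x, G x = G (clamp c d x)) -> {homo G : x y / x <= y} ->
  list_ac c d G ->
  exists g : R -> R, leb.-integrable setT (EFin \o g) /\
    forall x y, c <= x -> x <= y -> y <= d ->
      (\int[leb]_(t in `]x, y]) (g t)%:E = (G y - G x)%:E)%E.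
Proof.
move=> cd GE ndG acG.
have cG := list_ac_continuous cd GE ndG acG.
have [F FE] : exists F : cumulative R R, (F : R -> R) = G.
  pose C := isCumulative.Build R _ R G ndG (right_continuousW cG).
  by exists (HB.pack_for (cumulative R R) G C).
pose nu : {measure set (measurableTypeR R) -> \bar R} := lebesgue_stieltjes_measure F.
have nuE x y : x <= y -> nu `]x, y]%classic = (G y - G x)%:E.
  move=> xy; change (lebesgue_stieltjes_measure F `]x, y]%classic = (G y - G x)%:E).
  rewrite /lebesgue_stieltjes_measure /measure_extension/= -FE.
  by rewrite measurable_mu_extE/= ?wlength_itv_bnd//; exact: is_ocitv.
have nu0 A : measurable A -> leb A = 0%E -> nu A = 0%E.
  move=> mA A0; apply/eqP; rewrite eq_le measure_ge0 andbT.
  apply/lee_addgt0Pr => e e0; rewrite add0e.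
  have [del del0 H] := list_ac_clamp cd GE acG e0.
  have Aoo : (leb A < +oo)%E by rewrite A0.
  have [U [oU AU UA]] := lebesgue_regularity_outer mA Aoo del0.
  have mU : measurable U by exact: measurable_realfun.open_measurable.
  have lU : (leb U < del%:E)%E.
    rewrite (_ : U = A `|` (U `\` A)); last by rewrite setDUK.
    apply: le_lt_trans (measureU2 _ _ _) _ => //; first exact: measurableD.
    by rewrite [X in (X + _)%E]A0 add0e.
  apply: (@le_trans _ _ (nu U)); first by apply: le_measure; rewrite ?inE.
  have UE := open_disjoint_itv_bigcup oU.
  pose I := open_disjoint_itv oU.
  have oI k : open (I k) by exact: open_disjoint_itv_open.
  have mI k : measurable (I k) by apply: measurable_realfun.open_measurable.
  have IU k : I k `<=` U by rewrite UE; exact: bigcup_sup.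
  have /choice[ab abP] k : exists p : R * R, [/\ p.2 <= p.1, I k `<=` `]p.2, p.1],
      `]p.2, p.1[ `<=` I k & leb (I k) = (p.1 - p.2)%:E].
    have [|s [t [h1 h2 h3 h4]]] := open_interval_ends (oI k) (@open_disjoint_itv_is_interval _ _ oU k).
      apply: (@le_lt_trans _ _ (leb U)); first by apply: le_measure; rewrite ?inE//; exact: mI.
      by apply: lt_trans lU _; exact: ltry.
    by exists (t, s).
  rewrite [in leLHS]UE measure_bigcup//; [|by move=> k _; exact: mI|exact: open_disjoint_itv_trivIset].
  apply: lime_le; first by apply: is_cvg_nneseries => *; exact: measure_ge0.
  near=> n; rewrite big_mkcond/= big_mkord.
  have -> : (\sum_(i < n) (if (i : nat) \in [set: nat] then nu (I i) else 0) =
      \sum_(i < n) nu (I i))%E by apply: eq_bigr => i _; rewrite ifT// in_setE.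
  apply: (@le_trans _ _ (\sum_(p <- [seq ab i | i <- iota 0 n]) (G p.1 - G p.2))%:E).
    rewrite big_map -sumEFin -[X in iota 0 X]subn0 -/(index_iota 0 n) big_mkord lee_sum// => i _.
    have [h1 h2 _ _] := abP i.
    by rewrite -nuE//; apply: le_measure; rewrite ?inE//; exact: mI.
  rewrite lee_fin; apply: H.
  - by apply/allP => _ /mapP[i _ ->]; have [] := abP i.
  - apply/(pairwiseP (0, 0)) => i j; rewrite !inE size_map size_iota => iltn jltn ij.
    rewrite !(nth_map 0%N) ?size_iota// !nth_iota// !add0n.
    have [i1 _ i3 _] := abP i; have [j1 _ j3 _] := abP j.
    have := @open_disjoint_itv_trivIset _ _ oU => /trivIsetP /(_ i j Logic.I Logic.I).
    rewrite neq_ltn ij => /(_ isT); rewrite -subset0 => h.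
    rewrite /apart; apply: contrapT => /negP; rewrite !negb_or -!ltNge => /and4P[k1 k2 i21 j21].
    pose m := (Num.max (ab i).2 (ab j).2 + Num.min (ab i).1 (ab j).1) / 2.
    apply: (h m); split; [apply: i3|apply: j3]; rewrite /= in_itv/= /m;
      rewrite /Num.max /Num.min; do 2 case: ifPn; rewrite -?leNgt; lra.
  - rewrite big_map -lte_fin; apply: le_lt_trans lU.
    rewrite -sumEFin UE measure_bigcup//; [|by move=> k _; exact: mI|exact: open_disjoint_itv_trivIset].
    have -> : (\sum_(j <- iota 0 n) ((ab j).1 - (ab j).2)%:E =
       \sum_(0 <= j < n | j \in [set: nat]) leb (I j))%E.
      rewrite /index_iota subn0 [RHS]big_mkcond; apply: eq_bigr => i _.
      by rewrite ifT ?in_setE//; have [_ _ _ ->] := abP i.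
    by apply: nneseries_lim_ge => *; exact: measure_ge0.
have nuD : (nu `]c, d]%classic < +oo)%E by rewrite nuE// ltry.
have mD : measurable (`]c, d]%classic : set (measurableTypeR R)) by [].
have nuleb : mfrestr mD nuD `<< leb.
  move=> N N0 B mB BN; apply: nu0; first exact: measurableI.
  apply: N0; first exact: measurableI.
  by apply: subset_trans BN; exact: subIsetl.
have [g [g0 gfin ig gE]] := @radon_nikodym_sigma_finite _ _ R leb (mfrestr mD nuD) nuleb.
have gfE : EFin \o (fine \o g) = g by apply/funext => x /=; rewrite fineK.
exists (fine \o g); rewrite gfE; split=> // x y cx xy yd.
rewrite -nuE//; transitivity (mfrestr mD nuD `]x, y]%classic).
  by rewrite gE//; apply: eq_integral => t _; rewrite -[in RHS]gfE.
change (nu (`]x, y]%classic `&` `]c, d]%classic) = nu `]x, y]%classic).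
rewrite setIidl// => t /=; rewrite !in_itv/= => /andP[xt ty].
by rewrite (le_lt_trans cx xt) (le_trans ty yd).
Unshelve. all: by end_near. Qed.

(** Absolutely continuous functions are differences of monotone ones: the
    variation function dominates the increments of [u] and inherits its
    modulus of absolute continuity. *)
Theorem ac_density c d u : c <= d -> abs_continuous_on c d u ->
  exists g : R -> R, leb.-integrable setT (EFin \o g) /\
    forall x y, c <= x -> x <= y -> y <= d ->
      (\int[leb]_(t in `]x, y]) (g t)%:E = (u y - u x)%:E)%E.
Proof.
move=> cd /abs_continuous_list acu.
pose uc x := u (clamp c d x).
pose V x := fine (total_variation c (clamp c d x) u).
have tvfin x : total_variation c (clamp c d x) u \is a fin_num.
  have /andP[cx xd] := clamp_range x cd.
  apply/bounded_variationP => //; apply: (bounded_variationl cx xd).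
  by apply/bounded_variationP => //; apply: list_ac_bounded_variation.
have VB x y : x <= y ->
    (V y - V x)%:E = total_variation (clamp c d x) (clamp c d y) u.
  move=> xy; have /andP[cx xd] := clamp_range x cd.
  rewrite EFinB !fineK// (total_variationD _ cx (clamp_le _ _ xy)).
  by rewrite addeAC subee// add0e.
have clampK x : clamp c d (clamp c d x) = clamp c d x.
  by rewrite clamp_id// clamp_range.
have VC x : V x = V (clamp c d x) by rewrite /V clampK.
have ucC x : uc x = uc (clamp c d x) by rewrite /uc clampK.
have Vu x y : x <= y -> `|uc y - uc x| <= V y - V x.
  by move=> xy; rewrite -lee_fin VB//; apply: total_variation_ge; exact: clamp_le.
have inr L p : all (in_range c d) L -> p \in L -> [/\ p.2 <= p.1, clamp c d p.1 = p.1 & clamp c d p.2 = p.2].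
  move=> /allP h /h /and3P[h1 h2 h3]; split=> //; apply: clamp_id.
    by rewrite h3 (le_trans h1 h2).
  by rewrite h1 (le_trans h2 h3).
have acV : list_ac c d V.
  move=> e e0; have [del del0 /list_ac_total_variation H] := acu _ e0.
  exists del => // L sL; have := H _ sL; rewrite -lee_fin; apply: le_trans.
  rewrite -sumEFin big_seq [leRHS]big_seq; apply: lee_sum => p pL.
  have [p21 p1 p2] : [/\ p.2 <= p.1, clamp c d p.1 = p.1 & clamp c d p.2 = p.2].
    by case: sL => aL _ _; exact: inr pL.
  rewrite ger0_norm; first by rewrite VB// p1 p2.
  by apply: le_trans (Vu _ _ p21); exact: normr_ge0.
have acuc : list_ac c d uc.
  move=> e e0; have [del del0 H] := acu _ e0; exists del => // L sL.
  apply: le_trans (H _ sL); rewrite big_seq [leRHS]big_seq.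
  apply: ler_sum => p pL; have [aL _ _] := sL.
  by have [_ p1 p2] := inr _ _ aL pL; rewrite /uc p1 p2.
have ndV : {homo V : x y / x <= y}.
  by move=> x y xy; rewrite -subr_ge0; apply: le_trans (Vu _ _ xy).
pose W := V \- uc.
have ndW : {homo W : x y / x <= y}.
  move=> x y xy; rewrite -subr_ge0 /W/=; have := Vu _ _ xy.
  by rewrite ler_norml => /andP[]; lra.
have WC x : W x = W (clamp c d x) by rewrite /W/= -VC -ucC.
have [gV [iV gVE]] := nondecreasing_ac_density cd VC ndV acV.
have [gW [iW gWE]] := nondecreasing_ac_density cd WC ndW (list_acB acV acuc).
exists (gV \- gW); split.
  exact: (integrableB measurableT iV iW).
move=> x y cx xy yd.
transitivity (\int[leb]_(t in `]x, y]) ((gV t)%:E - (gW t)%:E))%E.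
  by apply: eq_integral => t _.
rewrite integralB//=.
- rewrite gVE// gWE// -EFinB /W/= /uc !clamp_id ?cx ?yd ?(le_trans xy yd) ?(le_trans cx xy)//.
  by congr EFin; ring.
- exact: (integrableS measurableT _ _ iV).
- exact: (integrableS measurableT _ _ iW).
Qed.

End Density.

(** * Measurability of the pointwise derivative *)

Section DerivativeMeasurability.
Context {R : realType}.
Implicit Types (u f g : R -> R) (c d e : R).
Local Notation leb := (@lebesgue_measure R).

Definition diff_quot u (x h : R) : R := h^-1 *: (u (h + x) - u x).

Lemma ler_dist_half (l a b e : R) :
  `|l - a| <= e / 2 -> `|l - b| <= e / 2 -> `|a - b| <= e.
Proof. rewrite !ler_norml => /andP[? ?] /andP[? ?]; apply/andP; split; lra. Qed.

Lemma exists_inv_succ_lt (e : R) : 0 < e -> exists n : nat, n.+1%:R^-1 < e.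
Proof.
move=> e0; exists (Num.bound e^-1).
by rewrite invf_plt ?posrE// (lt_trans (archi_boundP _)) ?ltr_nat// invr_ge0 ltW.
Qed.

Lemma derivable_diff_quot u x : derivable u x 1 <-> cvg (diff_quot u x h @[h --> 0^']).
Proof.
rewrite /derivable; suff -> : (fun h => h^-1 *: ((u \o shift x) (h *: 1) - u x)) = diff_quot u x by [].
by apply/funext => h; rewrite /diff_quot/= [h *: 1]mulr1.
Qed.

Lemma rat_near (x : R) (P : set R) : nbhs x P -> exists q : rat, P (ratr q).
Proof.
move=> /nbhs_ballP[e /= e0 eP].
have [|q] := @rat_in_itvoo R x (x + e); first by rewrite ltrDl.
rewrite in_itv/= => /andP[xq qe]; exists q; apply: eP.
by rewrite /ball/= distrC gtr0_norm ?subr_gt0// ltrBlDl.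
Qed.

(** Oscillation at most [e] of the difference quotients at [x] for the rational
    increments smaller than [del]. Only countably many increments occur, which
    is what makes the set of points of differentiability measurable. *)
Definition small_osc u e del : set R :=
  [set x | del < x /\ forall q r : rat, ratr q != 0 :> R -> ratr r != 0 :> R ->
     `|ratr q| < del -> `|ratr r| < del ->
     `|diff_quot u x (ratr q) - diff_quot u x (ratr r)| <= e].

Lemma diff_quot_continuous u x h : {in half_line, continuous u} -> h != 0 -> 0 < x ->
  `|h| < x -> {for h, continuous (diff_quot u x)}.
Proof.
move=> cu h0 x0 hx; apply: (@continuousM _ _ _ (fun h => u (h + x) - u x)).
  exact: inv_continuous.
apply: continuousB; last exact: cst_continuous.
apply: (@continuous_comp _ _ _ (fun h => h + x) u).
  by apply: continuousD; [exact: id|exact: cst_continuous].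
apply: cu; rewrite inE /half_line /= in_itv/= andbT.
by move: hx; rewrite ltr_norml => /andP[]; lra.
Qed.

Lemma small_oscP u e del x : {in half_line, continuous u} -> 0 < del ->
  small_osc u e del x ->
  forall h k, h != 0 -> k != 0 -> `|h| < del -> `|k| < del ->
    `|diff_quot u x h - diff_quot u x k| <= e.
Proof.
move=> cu del0 [dx osc] h k h0 k0 hd kd.
have x0 : 0 < x by apply: lt_trans dx.
have app l : l != 0 -> `|l| < del -> forall eta, 0 < eta ->
    exists q : rat, [/\ ratr q != 0 :> R, `|ratr q : R| < del &
      `|diff_quot u x l - diff_quot u x (ratr q)| < eta].
  move=> l0 ld eta eta0.
  pose P y := [/\ y != 0, `|y| < del & `|diff_quot u x l - diff_quot u x y| < eta].
  apply: (@rat_near l P).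
  have /cvgrPdist_lt /(_ _ eta0) := diff_quot_continuous cu l0 x0 (lt_trans ld dx).
  move=> near1; near=> y; split => //.
  - by near: y; exact: (cvgr_neq0 l (@cvg_id _ _)).
  - by near: y; exact: (cvgr_norm_lt _ (@cvg_id _ _)).
  - by near: y.
apply/ler_addgt0Pr => eta eta0.
have eta20 : 0 < eta / 2 by rewrite divr_gt0.
have [q [q0 qd qh]] := app h h0 hd _ eta20.
have [r [r0 rd rk]] := app k k0 kd _ eta20.
have := osc q r q0 r0 qd rd.
move: qh rk; rewrite !ltr_norml !ler_norml => /andP[? ?] /andP[? ?] /andP[? ?].
by apply/andP; split; lra.
Unshelve. all: by end_near. Qed.

(** Cauchy's criterion for the difference quotients. *)
Lemma derivable_small_osc u x : {in half_line, continuous u} -> 0 < x ->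
  derivable u x 1 <-> (forall k : nat, exists n : nat, small_osc u k.+1%:R^-1 n.+1%:R^-1 x).
Proof.
move=> cu x0; rewrite derivable_diff_quot; split.
- move=> qcvg k.
  have [l ql] : exists l : R, diff_quot u x h @[h --> 0^'] --> l.
    by case/cvg_ex: qcvg => l; exists l.
  have k0 : 0 < (k.+1%:R^-1 / 2 : R) by rewrite divr_gt0.
  have /cvgrPdist_le /(_ _ k0) := ql.
  rewrite near_withinE => /nbhs_ballP[r /= r0 H].
  have [n nr] : exists n : nat, n.+1%:R^-1 < Num.min r x.
    have rx : 0 < Num.min r x by rewrite lt_min r0.
    exact: exists_inv_succ_lt.
  move: nr; rewrite lt_min => /andP[nr nx].
  exists n; split=> // q q' q0 q'0 qn q'n.
  have h1 := H (ratr q); have h2 := H (ratr q').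
  rewrite /ball/= sub0r normrN in h1; rewrite /ball/= sub0r normrN in h2.
  exact: ler_dist_half (h1 (lt_trans qn nr) q0) (h2 (lt_trans q'n nr) q'0).
- move=> H; apply: cauchy_cvg; apply/cauchy_ballP => e e0.
  have [k ke] := exists_inv_succ_lt e0.
  have [n /small_oscP Hn] := H k.
  have n0 : (0 : R) < n.+1%:R^-1 by rewrite invr_gt0.
  pose A := [set h : R | h != 0 /\ `|h| < n.+1%:R^-1].
  have FA : diff_quot u x h @[h --> 0^'] (diff_quot u x @` A).
    suff : (0 : R)^' A by apply: filterS => h hA; exists h.
    rewrite /A; near=> h; split; first by near: h; exact: nbhs_dnbhs_neq.
    by near: h; apply: dnbhs0_lt.
  exists (diff_quot u x @` A, diff_quot u x @` A) => //= -[_ _]/= [[h [h0 hn] <-] [h' [h'0 h'n] <-]].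
  by rewrite /ball/=; apply: le_lt_trans ke; apply: Hn.
Unshelve. all: by end_near. Qed.

Lemma measurable_continuous_half_line u : {in half_line, continuous u} ->
  measurable_fun (half_line : set R) u.
Proof.
move=> cu; apply: open_continuous_measurable_fun; first exact: interval_open.
by move=> x xI; apply: cu.
Qed.

Lemma measurable_diff_quot u e q : {in half_line, continuous u} -> 0 <= e -> - q <= e ->
  measurable_fun `]e, +oo[ (fun x => diff_quot u x q).
Proof.
move=> cu e0 qe; apply: measurable_funM; first exact: measurable_cst.
have sub : `]e, +oo[ `<=` half_line.
  by apply: subset_itvr; rewrite bnd_simp.
apply: measurable_funB; last first.
  apply: (@measurable_funS _ _ _ _ half_line) => //; [exact: measurable_itv|exact: measurable_continuous_half_line].
apply: open_continuous_measurable_fun; first exact: interval_open.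
move=> x; rewrite inE/= in_itv/= andbT => ex.
apply: continuous_comp; first by apply: continuousD; [exact: cst_continuous|exact: id].
apply: cu; rewrite inE /half_line/= in_itv/= andbT.
by move: qe ex; lra.
Qed.

Lemma measurable_small_osc u e del : {in half_line, continuous u} -> 0 < del ->
  measurable (small_osc u e del).
Proof.
move=> cu del0.
pose rt n : rat := odflt 0 (unpickle n).
pose cond n m := [&& ratr (rt n) != 0 :> R, ratr (rt m) != 0 :> R,
  `|ratr (rt n) : R| < del & `|ratr (rt m) : R| < del].
have -> : small_osc u e del = \bigcap_n \bigcap_m
   (`]del, +oo[ `&` [set x | cond n m -> `|diff_quot u x (ratr (rt n)) - diff_quot u x (ratr (rt m))| <= e]).
  apply/seteqP; split => [x [dx osc] n _ m _|x H].
    split; first by rewrite /= in_itv/= dx.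
    by move=> /and4P[? ? ? ?]; exact: osc.
  split; first by have [] := H 0%N I 0%N I; rewrite /= in_itv/= andbT.
  move=> q r q0 r0 qd rd; have [_] := H (pickle q) I (pickle r) I.
  by rewrite /cond /rt /= !pickleK/= q0 r0 qd rd; apply.
apply: bigcapT_measurable => n; apply: bigcapT_measurable => m.
have [/and4P[q0 r0 qd rd]|_] := boolP (cond n m); last first.
  rewrite (_ : _ `&` _ = `]del, +oo[%classic)//.
  by apply/setIidl => x _ h.
rewrite (_ : _ `&` _ = `]del, +oo[ `&` (fun x => `|diff_quot u x (ratr (rt n)) - diff_quot u x (ratr (rt m))|) @^-1` `]-oo, e]); last first.
  apply/seteqP; split => x [dx h]; split=> //.
    by rewrite /= in_itv/=; apply: h.
suff mf : measurable_fun `]del, +oo[ (fun x => `|diff_quot u x (ratr (rt n)) - diff_quot u x (ratr (rt m))|).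
  by apply: mf; exact: measurable_itv.
apply: measurableT_comp => //.
by apply: measurable_funB; apply: measurable_diff_quot => //;
  rewrite ltW//; [move: qd|move: rd]; rewrite ltr_norml => /andP[]; lra.
Qed.

(** The derivative is a limit of difference quotients on the measurable set of
    differentiability, and constant off it. *)
Lemma measurable_derive1 u : {in half_line, continuous u} ->
  measurable_fun (half_line : set R) (derive1 u).
Proof.
move=> cu.
pose E : set R := \bigcap_k \bigcup_n small_osc u k.+1%:R^-1 n.+1%:R^-1.
have mE : measurable E.
  apply: bigcapT_measurable => k; apply: bigcupT_measurable => n.
  exact: measurable_small_osc.
have EP x : half_line x -> derivable u x 1 <-> E x.
  rewrite /half_line/= in_itv/= andbT => x0.
  rewrite derivable_small_osc//; split=> H k; first by move=> _; have [n] := H k; exists n.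
  by have [n _ ?] := H k I; exists n.
have mI : measurable (half_line : set R) by exact: measurable_itv.
rewrite (_ : half_line = half_line `&` E `|` half_line `\` E); last first.
  by rewrite setUIDK.
apply/measurable_funU; [exact: measurableI|exact: measurableD|split].
- apply: (@measurable_fun_cvg _ _ R _ (fun n x => diff_quot u x n.+1%:R^-1)).
    move=> n; apply: (@measurable_funS _ _ _ _ half_line) => //.
    by apply: measurable_diff_quot => //; rewrite oppr_le0.
  move=> x [Ix /(EP _ Ix)/derivable_diff_quot ].
  move=> qc; have /cvgr_dnbhsP := qc.
  move=> /(_ (fun n => n.+1%:R^-1)); apply; split.
    by move=> n; rewrite invr_neq0.
  exact: cvg_harmonic.
- apply: (eq_measurable_fun (cst (point : R))); last exact: measurable_cst.
  move=> x; rewrite inE => -[Ix xE]; apply/esym.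
  by apply: dvgP => qc; apply: xE; apply/(EP _ Ix)/derivable_diff_quot.
Qed.

Lemma loc_ac_continuous u : loc_abs_continuous u -> {in half_line, continuous u}.
Proof.
move=> acu x; rewrite inE /half_line/= in_itv/= andbT => x0.
apply/cvgrPdist_le => e e0.
have [del del0 H] := abs_continuous_list (acu (x / 2) (x + 1)
  (divr_gt0 x0 (ltr0Sn _ _)) (ltac:(lra))) e0.
near=> y.
have yd : `|x - y| < Num.min del (Num.min (x / 2) 1).
  by near: y; apply: (@cvgr_dist_lt _ _ _ _ _ id) => //; rewrite !lt_min del0 divr_gt0/=.
move: yd; rewrite !lt_min => /and3P[y1 y2 y3].
have [xy|yx] := leP x y.
  have := H [:: (y, x)]; rewrite big_seq1/= distrC; apply; split=> //.
    by move: y2 y3; rewrite distrC !ger0_norm ?subr_ge0// /in_range/= xy !andbT => *; apply/andP; split; lra.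
  by rewrite big_seq1/=; move: y1; rewrite distrC ger0_norm ?subr_ge0.
have := H [:: (x, y)]; rewrite big_seq1/=; apply; split=> //.
  by move: y2 y3; rewrite !gtr0_norm ?subr_gt0// /in_range/= (ltW yx) !andbT => *; apply/andP; split; lra.
by rewrite big_seq1/=; move: y1; rewrite gtr0_norm ?subr_gt0.
Unshelve. all: by end_near. Qed.

(** Lebesgue's differentiation theorem identifies the density with the
    derivative. *)
Lemma loc_ac_density u c d : loc_abs_continuous u -> 0 < c -> c <= d ->
  exists g : R -> R, [/\ leb.-integrable setT (EFin \o g),
    forall x y, c <= x -> x <= y -> y <= d ->
      (\int[leb]_(t in `]x, y]) (g t)%:E = (u y - u x)%:E)%E &
    {ae leb, forall x, x \in `]c, d] -> derivable u x 1 /\ derive1 u x = g x}].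
Proof.
move=> acu c0 cd.
have cd1 : c < d + 1 by lra.
have [g [ig gE]] := ac_density (ltW cd1) (acu _ _ c0 cd1).
exists g; split=> //.
  by move=> x y cx xy yd; apply: gE => //; lra.
have [||N [mN N0 NP]] := @FTC1 _ g (BRight c).
- by move=> y; apply: (integrableS measurableT).
- by apply: open_integrable_locally => //; exact: openT.
exists N; split=> // x /= xP; apply: NP => /= H; apply: xP.
rewrite in_itv/= => /andP[cx xd].
have [|dF FE] := H; first by rewrite lte_fin.
set F := fun y => _ in dF FE.
have uF : {near x, (fun y => u c + F y) =1 u}.
  near=> y; rewrite /F /Rintegral gE//=; first by ring.
    by apply: ltW; near: y; apply: lt_nbhsr.
  by apply: ltW; near: y; apply: lt_nbhsl; lra.
have dF' : derivable (fun y => u c + F y) x 1 by apply: derivableD.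
split; first exact: near_eq_derivable uF dF'.
rewrite -FE !derive1E -(near_eq_derive _ uF) deriveD// derive_cst add0r.
by [].
Unshelve. all: by end_near. Qed.

Lemma aeS (P Q : R -> Prop) : (forall x, P x -> Q x) ->
  {ae leb, forall x, P x} -> {ae leb, forall x, Q x}.
Proof.
by move=> PQ [N [mN N0 NP]]; exists N; split=> // x /= xQ; apply: NP => /PQ.
Qed.

Lemma loc_ac_derivable u : loc_abs_continuous u ->
  {ae leb, forall x, half_line x -> derivable u x 1}.
Proof.
move=> acu.
have cover n : {ae leb, forall x, x \in `]n.+1%:R^-1, n.+1%:R] -> derivable u x 1}.
  have [||g [_ _]] := @loc_ac_density u n.+1%:R^-1 n.+1%:R acu.
  - by rewrite invr_gt0.
  - by rewrite (@le_trans _ _ 1) ?ler1n// invf_le1// ler1n.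
  by apply: aeS => x H /H[].
have := ae_foralln cover; apply: aeS => x H.
rewrite /half_line/= in_itv/= andbT => x0.
have [n nx] := exists_inv_succ_lt x0.
pose m := maxn n (Num.bound x).
apply: (H m); rewrite in_itv/=; apply/andP; split.
  by apply: le_lt_trans nx; rewrite lef_pV2 ?posrE// ler_nat ltnS leq_maxl.
apply/ltW; apply: lt_trans (archi_boundP (ltW x0)) _.
by rewrite ltr_nat ltnS leq_maxr.
Qed.

Lemma ae_eq_integrable (D : set R) (f g : R -> R) : measurable D ->
  measurable_fun D g -> leb.-integrable D (EFin \o f) ->
  {ae leb, forall x, D x -> g x = f x} ->
  leb.-integrable D (EFin \o g) /\
  (\int[leb]_(x in D) (g x)%:E = \int[leb]_(x in D) (f x)%:E)%E.
Proof.
move=> mD mg intf gf.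
have mf := measurable_int _ intf.
have mg' : measurable_fun D (EFin \o g) by exact/measurable_EFinP.
split; last first.
  apply: ae_eq_integral => //.
  by apply: aeS gf => x /= h /h ->.
apply/integrableP; split=> //.
have /integrableP[_] := intf; apply: le_lt_trans.
rewrite le_eqVlt; apply/orP; left; apply/eqP.
apply: ae_eq_integral => //; try exact: measurableT_comp.
by apply: aeS gf => x /= h /h ->.
Qed.

Lemma half_line_oc c d : 0 < c -> `]c, d] `<=` (half_line : set R).
Proof.
by move=> c0 x; rewrite /half_line/= !in_itv/= andbT => /andP[/(lt_trans c0)].
Qed.

Lemma loc_ac_FTC u c d : loc_abs_continuous u -> 0 < c -> c <= d ->
  leb.-integrable `]c, d] (EFin \o derive1 u) /\
  (\int[leb]_(t in `]c, d]) (derive1 u t)%:E = (u d - u c)%:E)%E.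
Proof.
move=> acu c0 cd; have [g [ig gE gae]] := loc_ac_density acu c0 cd.
have mD : measurable (`]c, d]%classic : set R) by exact: measurable_itv.
have igD : leb.-integrable `]c, d] (EFin \o g) by exact: (integrableS measurableT).
have mu' : measurable_fun `]c, d] (derive1 u).
  apply: (@measurable_funS _ _ _ _ half_line); [exact: measurable_itv|exact: half_line_oc|].
  exact: measurable_derive1 (loc_ac_continuous acu).
have [|i1 i2] := ae_eq_integrable mD mu' igD.
  by apply: aeS gae => x h /h[].
by split=> //; rewrite i2 gE.
Qed.

End DerivativeMeasurability.

(** * The Bessel form as a bilinear form *)

#[local] Opaque derive1.

(** The inner product with weight [x ^ 2]. It is locked: two of these integrals
    are only ever compared through the lemmas below. *)
HB.lock Definition wip (R : realType) (f g : R -> R) : R :=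
  \int[@lebesgue_measure R]_(x in half_line) (f x * g x * x ^+ 2).
Canonical wip_unlockable := Unlockable wip.unlock.
Arguments wip {R} f g.

Section BesselSpace.
Context {R : realType}.
Implicit Types (u v w f g h : R -> R) (c d e : R).
Local Notation leb := (@lebesgue_measure R).

Lemma in_half_lineE (x : R) : half_line x = (0 < x) :> Prop.
Proof. by rewrite /half_line/= in_itv/= andbT. Qed.

Lemma measurable_half_line : measurable (half_line : set (measurableTypeR R)).
Proof. exact: measurable_itv. Qed.
Hint Resolve measurable_half_line : core.

(** All closure properties of absolute continuity below come from comparing
    increments. *)
Lemma loc_ac_dominated u v w : loc_abs_continuous u -> loc_abs_continuous v ->
  (forall c d, 0 < c -> c < d -> exists2 M, 0 < M & forall s t, c <= s -> s <= t -> t <= d ->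
     `|w t - w s| <= M * (`|u t - u s| + `|v t - v s|)) ->
  loc_abs_continuous w.
Proof.
move=> acu acv H c d c0 cd e e0; have [M M0 {}H] := H c d c0 cd.
have eM : 0 < e / (2 * M) by rewrite divr_gt0// mulr_gt0.
have [d1 d10 H1] := acu c d c0 cd _ eM; have [d2 d20 H2] := acv c d c0 cd _ eM.
exists (Num.min d1 d2); first by rewrite lt_min d10.
move=> n s t st tI; rewrite lt_min => /andP[s1 s2].
have -> : e = M * (e / (2 * M) + e / (2 * M)) by field; rewrite lt0r_neq0.
apply: (le_lt_trans _ (_ : M * (\sum_(i < n) `|u (t i) - u (s i)| + \sum_(i < n) `|v (t i) - v (s i)|) < _)).
  rewrite -big_split mulr_sumr; apply: ler_sum => i _.
  by have [? [? ?]] := st i; exact: H.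
by rewrite ltr_pM2l// ltrD// ?H1 ?H2.
Qed.

Lemma loc_ac_id : loc_abs_continuous (@idfun R).
Proof.
move=> c d c0 cd e e0; exists e => // n s t st tI /=.
by under [in X in _ -> X]eq_bigr do rewrite ger0_norm ?subr_ge0 ?(st _).2.1//.
Qed.

Lemma continuous_half_line_bounded f c d : {in half_line, continuous f} -> 0 < c -> c <= d ->
  exists2 M, 0 < M & forall x, c <= x -> x <= d -> `|f x| <= M.
Proof.
move=> cf c0 cd.
have [|m _ mP] := @EVT_max R (fun x => `|f x|) c d cd.
  apply: continuous_in_subspaceT => x; rewrite inE/= in_itv/= => /andP[cx xd].
  apply: continuous_comp; last exact: norm_continuous.
  by apply: cf; rewrite inE in_half_lineE; lra.
exists (`|f m| + 1); first by rewrite ltr_pwDr.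
move=> x cx xd; apply: le_trans (mP x _) _; last by rewrite lerDl.
by rewrite in_itv/= cx xd.
Qed.

Lemma loc_acM u v : loc_abs_continuous u -> loc_abs_continuous v ->
  loc_abs_continuous (fun x => u x * v x).
Proof.
move=> acu acv; apply: (loc_ac_dominated acu acv) => c d c0 cd.
have [M M0 MP] := continuous_half_line_bounded (loc_ac_continuous acu) c0 (ltW cd).
have [N N0 NP] := continuous_half_line_bounded (loc_ac_continuous acv) c0 (ltW cd).
exists (M + N); first exact: addr_gt0.
move=> s t cs st td.
have -> : u t * v t - u s * v s = u t * (v t - v s) + v s * (u t - u s) by ring.
apply: le_trans (ler_normD _ _) _; rewrite !normrM.
have h1 : `|u t| <= M by apply: MP => //; apply: le_trans st.
have h2 : `|v s| <= N by apply: NP => //; apply: le_trans td.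
have := ler_wpM2r (normr_ge0 (v t - v s)) h1.
have := ler_wpM2r (normr_ge0 (u t - u s)) h2.
have := mulr_ge0 (ltW M0) (normr_ge0 (u t - u s)).
have := mulr_ge0 (ltW N0) (normr_ge0 (v t - v s)).
by lra.
Qed.

Lemma loc_ac_lin (a : R) u v : loc_abs_continuous u -> loc_abs_continuous v ->
  loc_abs_continuous (fun x => a * u x + v x).
Proof.
move=> acu acv; apply: (loc_ac_dominated acu acv) => c d c0 cd.
exists (`|a| + 1); first by rewrite ltr_pwDr.
move=> s t cs st td.
have -> : a * u t + v t - (a * u s + v s) = a * (u t - u s) + (v t - v s) by ring.
apply: le_trans (ler_normD _ _) _; rewrite normrM.
have := normr_ge0 a; have := normr_ge0 (u t - u s); have := normr_ge0 (v t - v s).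
have := mulr_ge0 (normr_ge0 a) (normr_ge0 (v t - v s)).
by lra.
Qed.

Lemma C1_lipschitz f f' c d : (forall x : R, 0 < x -> is_derive x 1 f (f' x)) ->
  {in half_line, continuous f'} -> 0 < c -> c <= d ->
  exists2 M, 0 < M & forall s t, c <= s -> s <= t -> t <= d -> `|f t - f s| <= M * (t - s).
Proof.
move=> df cf' c0 cd; have [M M0 MP] := continuous_half_line_bounded cf' c0 cd.
exists M => // s t cs st td.
have [//|x||z zst ->] := @MVT_segment R f f' s t.
- by move=> xst; apply: df; move: xst; rewrite in_itv/= => /andP[h _]; lra.
- apply: derivable_within_continuous => x; rewrite in_itv/= => /andP[h _].
  by have [] : is_derive x 1 f (f' x) by apply: df; lra.
rewrite normrM (ger0_norm (x := t - s)) ?subr_ge0// ler_wpM2r ?subr_ge0// MP//.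
  by move: zst; rewrite in_itv/= => /andP[h _]; lra.
by move: zst; rewrite in_itv/= => /andP[_ h]; lra.
Qed.

Lemma lipschitz_loc_ac f : (forall c d, 0 < c -> c < d -> exists2 M, 0 < M &
    forall s t, c <= s -> s <= t -> t <= d -> `|f t - f s| <= M * (t - s)) ->
  loc_abs_continuous f.
Proof.
move=> H; apply: (loc_ac_dominated loc_ac_id loc_ac_id) => c d c0 cd.
have [M M0 MP] := H c d c0 cd; exists M => // s t cs st td /=.
apply: le_trans (MP s t cs st td) _; apply: ler_wpM2l; first exact: ltW.
by apply: le_trans (ler_norm _) _; rewrite lerDl.
Qed.

Lemma C1_loc_ac f f' : (forall x : R, 0 < x -> is_derive x 1 f (f' x)) ->
  {in half_line, continuous f'} -> loc_abs_continuous f.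
Proof.
move=> df cf'; apply: lipschitz_loc_ac => c d c0 cd.
exact: (C1_lipschitz df cf' c0 (ltW cd)).
Qed.

(** * Square-integrability for the weight [x ^ 2] *)

Definition sqint f := measurable_fun (half_line : set R) f /\
  (\int[leb]_(x in half_line) (f x ^+ 2 * x ^+ 2)%:E < +oo)%E.

Lemma measurable_sqr_weight (D : set R) : measurable_fun D (fun x : R => x ^+ 2).
Proof. by apply: measurable_funTS; exact: exprn_measurable. Qed.

Lemma measurable_wmul (D : set R) f g : measurable_fun D f -> measurable_fun D g ->
  measurable_fun D (fun x => f x * g x * x ^+ 2).
Proof.
move=> mf mg; apply: measurable_funM; last exact: measurable_sqr_weight.
exact: measurable_funM.
Qed.

Lemma integrable_ge0 f : (forall x, 0 <= f x) -> measurable_fun (half_line : set R) f ->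
  leb.-integrable half_line (EFin \o f) <->
  (\int[leb]_(x in half_line) (f x)%:E < +oo)%E.
Proof.
move=> f0 mf.
have E : (\int[leb]_(x in half_line) `|(EFin \o f) x| = \int[leb]_(x in half_line) (f x)%:E)%E.
  by apply: eq_integral => x _; rewrite /= ger0_norm.
split=> [/integrableP[_]|h]; first by rewrite E.
by apply/integrableP; split; [exact/measurable_EFinP|rewrite E].
Qed.

Lemma sqintE f : sqint f <-> measurable_fun (half_line : set R) f /\
  leb.-integrable half_line (fun x => (f x * f x * x ^+ 2)%:E).
Proof.
suff E : measurable_fun (half_line : set R) f ->
    leb.-integrable half_line (fun x => (f x * f x * x ^+ 2)%:E) <->
    (\int[leb]_(x in half_line) (f x ^+ 2 * x ^+ 2)%:E < +oo)%E.
  by split=> -[mf /(E mf)].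
move=> mf; apply: (integrable_ge0 (f := fun x => f x ^+ 2 * x ^+ 2)).
  by move=> x; rewrite mulr_ge0 ?sqr_ge0.
exact: measurable_wmul.
Qed.

Lemma sqint_prod f g : sqint f -> sqint g ->
  leb.-integrable half_line (fun x => (f x * g x * x ^+ 2)%:E).
Proof.
move=> /sqintE[mf If] /sqintE[mg Ig].
have Ifg := integrableD measurable_half_line If Ig.
apply: (le_integrable _ _ _ Ifg) => //.
  by apply/measurable_EFinP; apply: measurable_wmul.
move=> x _ /=; rewrite lee_fin -mulrDl -!expr2 normrM [leRHS]normrM ler_wpM2r//.
rewrite [leRHS]ger0_norm ?addr_ge0 ?sqr_ge0// ler_norml.
have := sqr_ge0 (f x + g x); have := sqr_ge0 (f x - g x).
have := sqr_ge0 (f x); have := sqr_ge0 (g x).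
by rewrite !expr2 => *; apply/andP; split; lra.
Qed.

Lemma wip_linl (c : R) f g h : sqint f -> sqint g -> sqint h ->
  wip (fun x => c * f x + g x) h = c * wip f h + wip g h.
Proof.
move=> sf sg sh; rewrite unlock -RintegralZl//; last exact: sqint_prod.
rewrite -RintegralD//; last exact: sqint_prod.
  by apply: eq_Rintegral => x _; ring.
exact: (integrableZl measurable_half_line c (sqint_prod sf sh)).
Qed.

Lemma wip_ge0 f : 0 <= wip f f.
Proof.
by rewrite unlock; apply: Rintegral_ge0 => x _; rewrite -expr2 mulr_ge0// sqr_ge0.
Qed.

Lemma sqint_lin (c : R) f g : sqint f -> sqint g -> sqint (fun x => c * f x + g x).
Proof.
move=> sf sg; apply/sqintE; split.
  by apply: measurable_funD; [apply: measurable_funM => //|]; [case: sf|case: sg].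
have i1 := sqint_prod sf sf; have i2 := sqint_prod sf sg; have i3 := sqint_prod sg sg.
have := integrableD measurable_half_line (integrableZl measurable_half_line (c ^+ 2) i1)
  (integrableD measurable_half_line (integrableZl measurable_half_line (2 * c) i2) i3).
apply: eq_integrable => // x _ /=.
by rewrite -!EFinM -!EFinD; congr EFin; ring.
Qed.

Lemma wip_ae f g h : sqint f -> sqint h -> measurable_fun (half_line : set R) g ->
  {ae leb, forall x, half_line x -> g x = f x} -> wip g h = wip f h.
Proof.
move=> sf sh mg gf; rewrite unlock /Rintegral.
have mgh : measurable_fun half_line (fun x : R => g x * h x * x ^+ 2).
  by apply: measurable_wmul => //; case: sh.
have ae : {ae leb, forall x, half_line x -> g x * h x * x ^+ 2 = f x * h x * x ^+ 2}.
  by apply: aeS gf => x H /H ->.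
by have [_ ->] := ae_eq_integrable measurable_half_line mgh (sqint_prod sf sh) ae.
Qed.

Lemma sqint_ae f g : sqint f -> measurable_fun (half_line : set R) g ->
  {ae leb, forall x, half_line x -> g x = f x} -> sqint g.
Proof.
move=> sf mg gf; apply/sqintE; split=> //.
have ae : {ae leb, forall x, half_line x -> g x * g x * x ^+ 2 = f x * f x * x ^+ 2}.
  by apply: aeS gf => x H /H ->.
by have [] := ae_eq_integrable measurable_half_line (measurable_wmul mg mg) (sqint_prod sf sf) ae.
Qed.

Lemma continuous_wip_eq0 f : {in half_line, continuous f} -> sqint f ->
  wip f f = 0 -> forall x, 0 < x -> f x = 0.
Proof.
move=> cf sf f0 x x0; apply/eqP; apply: contraT => fx.
have [mf If] := (sqintE f).1 sf.
have mff : measurable_fun (half_line : set R) (fun x => (f x * f x * x ^+ 2)%:E).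
  by case/integrableP: If.
have I0 : (\int[leb]_(x in half_line) (f x * f x * x ^+ 2)%:E = 0)%E.
  rewrite -(fineK (integrable_fin_num measurable_half_line If)).
  by move: f0; rewrite unlock /Rintegral => ->.
have [] := (ae_eq_integral_abs leb measurable_half_line mff).1.
  rewrite -[RHS]I0; apply: eq_integral => y _; rewrite /= ger0_norm//.
  by rewrite -expr2 mulr_ge0 ?sqr_ge0.
move=> N [mN N0 NP].
have [d d0 dP] : exists2 d : R, 0 < d & forall y, `|x - y| < d -> f y != 0.
  have : \forall y \near x, f y != 0.
    have cfx : f @ x --> f x by apply: cf; rewrite inE in_half_lineE.
    exact: (cvgr_neq0 _ cfx fx).
  by move=> /nbhs_ballP[d /= d0 dP]; exists d => // y yd; apply: dP.
have : (leb (`]x, (x + d)%R[%classic : set R) <= leb N)%E.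
  apply: le_measure; rewrite ?inE//.
  move=> y; rewrite /= in_itv/= => /andP[xy yd]; apply: NP => /= H.
  have y0 : 0 < y := lt_trans x0 xy.
  have Iy : half_line y by rewrite in_half_lineE.
  have [] := H Iy => /eqP; rewrite !mulf_eq0 ?expf_eq0/= (gt_eqF y0) ?orbF orbb.
  by apply/negP/dP; rewrite distrC gtr0_norm ?subr_gt0//; lra.
rewrite N0 lebesgue_measure_itv/= lte_fin ltrDl d0 -EFinB lee_fin; lra.
Qed.

(** * Bilinearity of the Bessel form *)

Lemma bessel_domE u : bessel_dom u <->
  [/\ loc_abs_continuous u, sqint u & sqint (derive1 u)].
Proof.
have two (k : R) : 0 < k -> measurable_fun (half_line : set R) u ->
    sqint u <-> (\int[leb]_(x in half_line) (u x ^+ 2 * (k * x ^+ 2))%:E < +oo)%E.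
  move=> k0 mu.
  rewrite -(@integrable_ge0 (fun x => u x ^+ 2 * (k * x ^+ 2))); last 2 first.
  - move=> x; apply: mulr_ge0; first exact: sqr_ge0.
    by apply: mulr_ge0; [exact: ltW|exact: sqr_ge0].
  - apply: measurable_funM; first exact: measurable_funX.
    by apply: measurable_funM; [exact: measurable_cst|exact: measurable_sqr_weight].
  split=> [/sqintE[_ /(integrableZl measurable_half_line k)]|].
    apply: eq_integrable => // x _ /=; rewrite -EFinM; congr EFin; ring.
  move=> /(integrableZl measurable_half_line k^-1) H; apply/sqintE; split=> //.
  move: H; apply: eq_integrable => // x _ /=; rewrite -EFinM; congr EFin.
  by field; rewrite lt0r_neq0.
split=> [[acu [mu Lu] Du]|[acu su [mdu Du]]]; split=> //.
- exact/(two 2).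
- by split=> //; exact: measurable_derive1 (loc_ac_continuous acu).
- by split; [case: su|apply/(two 2) => //; case: su].
Qed.

Lemma bessel_dom_continuous u : bessel_dom u -> {in half_line, continuous u}.
Proof. by case=> /loc_ac_continuous. Qed.

Lemma derive1_lin_ae (c : R) u v : loc_abs_continuous u -> loc_abs_continuous v ->
  {ae leb, forall x, half_line x ->
    derive1 (fun x => c * u x + v x) x = c * derive1 u x + derive1 v x}.
Proof.
move=> /loc_ac_derivable[N [mN N0 NP]] /loc_ac_derivable[M [mM M0 MP]].
exists (N `|` M); split; first exact: measurableU.
  by apply/eqP; rewrite -measure_le0 (le_trans (measureU2 _ _ _))// [X in (X + _)%E]N0 [X in (_ + X)%E]M0 adde0.
move=> x /= H; apply: contrapT => /not_orP[xN xM]; apply: H => Ix.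
have du : derivable u x 1 by apply: contrapT => h; apply: xN; apply: NP => /(_ Ix).
have dv : derivable v x 1 by apply: contrapT => h; apply: xM; apply: MP => /(_ Ix).
have cu : derivable (c \*: u) x 1 by exact: derivableZ.
by rewrite !derive1E (deriveD cu dv) (deriveZ c du).
Qed.

Lemma bessel_dom_lin (c : R) u v : bessel_dom u -> bessel_dom v ->
  bessel_dom (fun x => c * u x + v x).
Proof.
move=> /bessel_domE[acu su du] /bessel_domE[acv sv dv].
apply: (bessel_domE (fun x => c * u x + v x)).2.
have ac := loc_ac_lin c acu acv; split; [exact: ac|exact: sqint_lin|].
have md := measurable_derive1 (loc_ac_continuous ac).
exact: (sqint_ae (sqint_lin c du dv) md (derive1_lin_ae c acu acv)).
Qed.

Lemma bessel_form_lamE (lam : R) u v : bessel_dom u -> bessel_dom v ->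
  bessel_form_lam lam u v = wip (derive1 u) (derive1 v) + 2 * lam * wip u v.
Proof.
move=> /bessel_domE[acu su du] /bessel_domE[acv sv dv].
have -> : 2 * lam * wip u v = lam * (2 * wip u v) by rewrite mulrA [lam * 2]mulrC.
rewrite /bessel_form_lam /bessel_form unlock.
rewrite -(RintegralZl 2 measurable_half_line (sqint_prod su sv)).
congr (_ + lam * _).
by apply: eq_Rintegral => x _; ring.
Qed.

Lemma bessel_form_lamC (lam : R) u v : bessel_form_lam lam u v = bessel_form_lam lam v u.
Proof.
have E1 : bessel_form u v = bessel_form v u.
  by apply: eq_Rintegral => x _; rewrite [derive1 u x * _]mulrC.
rewrite /bessel_form_lam E1; congr (_ + lam * _).
by apply: eq_Rintegral => x _; rewrite [u x * _]mulrC.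
Qed.

Lemma bessel_form_lam_linl (lam c : R) u v w : bessel_dom u -> bessel_dom v -> bessel_dom w ->
  bessel_form_lam lam (fun x => c * u x + v x) w =
  c * bessel_form_lam lam u w + bessel_form_lam lam v w.
Proof.
move=> bu bv bw.
have buv := bessel_dom_lin c bu bv.
rewrite (bessel_form_lamE lam buv bw) (bessel_form_lamE lam bu bw) (bessel_form_lamE lam bv bw).
have [acu su du] := (bessel_domE u).1 bu; have [acv sv dv] := (bessel_domE v).1 bv.
have [acw sw dw] := (bessel_domE w).1 bw.
have md := measurable_derive1 (bessel_dom_continuous buv).
have e1 := wip_ae (sqint_lin c du dv) dw md (derive1_lin_ae c acu acv).
have e2 := wip_linl c du dv dw; have e3 := wip_linl c su sv sw.
rewrite e1 e2 e3; ring.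
Qed.

Lemma bessel_form_lam_ge0 (lam : R) u : 0 <= lam -> bessel_dom u ->
  0 <= bessel_form_lam lam u u.
Proof.
move=> l0 bu; rewrite (bessel_form_lamE lam bu bu).
by apply: addr_ge0; [exact: wip_ge0|apply: mulr_ge0; [exact: mulr_ge0|exact: wip_ge0]].
Qed.

Lemma bessel_form_lam_eq0 (lam : R) u : 0 < lam -> bessel_dom u ->
  bessel_form_lam lam u u = 0 -> forall x, 0 < x -> u x = 0.
Proof.
move=> l0 bu; rewrite (bessel_form_lamE lam bu bu) => /eqP.
have [_ su _] := (bessel_domE u).1 bu.
rewrite paddr_eq0; last 2 first.
- exact: wip_ge0.
- by apply: mulr_ge0; [rewrite mulr_ge0// ltW|exact: wip_ge0].
move=> /andP[_].
rewrite !mulf_eq0 (gt_eqF l0) pnatr_eq0/= => /eqP.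
exact: continuous_wip_eq0 (bessel_dom_continuous bu) su.
Qed.

(** The difference of [u] and [w0] lies in [ker J], so that both [w0] and the chosen
    projection [w] differ from [u] by something orthogonal to the complement.
    Then [w - w0], which is in the complement, is orthogonal to itself, hence 0
    on the half-line. *)
Lemma projJP (lam : R) u w0 : 0 < lam -> bessel_dom u -> kerJ_orth lam w0 ->
  restrN w0 = restrN u ->
  let w := projJ lam u in
  [/\ bessel_dom w, restrN w = restrN u &
      bessel_form_lam lam w w <= bessel_form_lam lam u u].
Proof.
move=> l0 bu w0P w0u w.
have subE f g : f - g = (fun x => (-1) * g x + f x).
  by apply/funext => x; rewrite !fctE; ring.
have bsub f g : bessel_dom f -> bessel_dom g -> bessel_dom (f - g).
  by move=> bf bg; rewrite subE; exact: bessel_dom_lin.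
have Bsub f g h : bessel_dom f -> bessel_dom g -> bessel_dom h ->
    bessel_form_lam lam (f - g) h = bessel_form_lam lam f h - bessel_form_lam lam g h.
  move=> bf bg bh; rewrite subE (bessel_form_lam_linl lam (-1) bg bf bh); ring.
have [bw0 w0k] := w0P.
have bu0 := bsub _ _ bu bw0.
have kerw0 : kerJ (u - w0).
  split; first exact: bu0.
  move=> n; change (u n.+1%:R - w0 n.+1%:R = 0).
  by have := congr1 (@^~ n) w0u; rewrite /restrN => ->; rewrite subrr.
have [wP worth] : kerJ_orth lam w /\
    forall v, kerJ_orth lam v -> bessel_form_lam lam (u - w) v = 0.
  pose S := [set w | kerJ_orth lam w /\
    forall v, kerJ_orth lam v -> bessel_form_lam lam (u - w) v = 0].
  have Sw0 : S w0.
    split; first exact: w0P.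
    by move=> v [bv vP]; rewrite bessel_form_lamC; exact: vP.
  by have := @xgetPex _ (fun=> 0) S (ex_intro _ w0 Sw0).
have [bw wk] := wP.
have buw := bsub _ _ bu bw; have bww0 := bsub _ _ bw bw0.
have orth_diff : kerJ_orth lam (w - w0).
  split; first exact: bww0.
  by move=> v kv; rewrite (Bsub _ _ _ bw bw0 kv.1) (wk _ kv) (w0k _ kv) subrr.
have diff0 : bessel_form_lam lam (w - w0) (w - w0) = 0.
  have diffE : w - w0 = (u - w0) - (u - w) by apply/funext => x; rewrite !fctE; ring.
  rewrite [X in bessel_form_lam _ X _]diffE (Bsub _ _ _ bu0 buw bww0).
  rewrite (worth _ orth_diff) subr0 bessel_form_lamC.
  exact: (orth_diff.2 _ kerw0).
have ww0 x : 0 < x -> w x = w0 x.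
  move=> x0; apply/eqP; rewrite -subr_eq0; apply/eqP.
  exact: (bessel_form_lam_eq0 l0 bww0 diff0 x0).
split; [exact: bw|by rewrite -w0u; apply/funext => n; apply: ww0; rewrite ltr0n|].
have e1 := Bsub _ _ _ bu bw buw; have e2 := Bsub _ _ _ bu bw bw.
rewrite (worth _ wP) in e2; rewrite bessel_form_lamC in e2.
have e3 := Bsub _ _ _ bu bw bu; rewrite bessel_form_lamC in e3.
have := bessel_form_lam_ge0 (ltW l0) buw; rewrite e1.
rewrite (bessel_form_lamC lam w (u - w)) (worth _ wP) subr0.
rewrite (bessel_form_lamC lam u (u - w)) (Bsub _ _ _ bu bw bu).
move/eqP: e2; rewrite eq_sym subr_eq0 => /eqP; rewrite bessel_form_lamC => ->.
by rewrite subr_ge0.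
Qed.

End BesselSpace.

(** * Energy bounds the values at the integers *)

Section BesselEstimates.
Context {R : realType}.
Implicit Types (u v w f g h s : R -> R) (c d e t : R).
Local Notation leb := (@lebesgue_measure R).
Local Notation "''int_' ( c , d ) f" := (\int[leb]_(x in `]c, d]) f x)
  (at level 10, c, d at level 9, f at level 8).

Lemma measurable_itvR (i : interval R) : measurable ([set` i] : set (measurableTypeR R)).
Proof. exact: measurable_itv. Qed.

Lemma itv_int_split f c d e : c <= d -> d <= e -> leb.-integrable `]c, e] (EFin \o f) ->
  'int_(c, e) f = 'int_(c, d) f + 'int_(d, e) f.
Proof.
move=> cd de intf.
have E : `]c, e]%classic = `]c, d]%classic `|` `]d, e]%classic :> set R.
  by apply: itv_bndbnd_setU; rewrite bnd_simp.
rewrite E Rintegral_setU//= -?E//; apply/disj_setPS => x [/=].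
by rewrite !in_itv/=; lra.
Qed.

Lemma integrable_oc f c d : 0 < c -> leb.-integrable half_line (EFin \o f) ->
  leb.-integrable `]c, d] (EFin \o f).
Proof.
move=> c0; apply: (integrableS (@measurable_half_line R)) => //.
exact: half_line_oc.
Qed.

Lemma continuous_integrable_oc f c d : 0 < c -> {in half_line, continuous f} ->
  leb.-integrable `]c, d] (EFin \o f).
Proof.
move=> c0 cf; apply: (integrableS (measurable_itvR `[c, d])) => //; first exact: subset_itv_oc_cc.
apply: continuous_compact_integrable; first exact: segment_compact.
apply: continuous_in_subspaceT => x; rewrite inE/= in_itv/= => /andP[cx _].
by apply: cf; rewrite inE in_half_lineE; lra.
Qed.

Lemma itv_int_le_half_line f c d : 0 < c -> (forall x, 0 <= f x) ->
  leb.-integrable half_line (EFin \o f) ->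
  'int_(c, d) f <= \int[leb]_(x in half_line) f x.
Proof.
move=> c0 f0 intf; apply: fine_le.
- exact: (integrable_fin_num _ (integrable_oc d c0 intf)).
- exact: (integrable_fin_num (@measurable_half_line R) intf).
apply: ge0_subset_integral => //.
- exact: measurable_half_line.
- exact: measurable_int intf.
- by move=> x _; rewrite lee_fin.
- exact: half_line_oc.
Qed.

Lemma C1_FTC f f' c d : (forall x : R, 0 < x -> is_derive x 1 f (f' x)) ->
  {in half_line, continuous f'} -> 0 < c -> c <= d ->
  'int_(c, d) f' = f d - f c.
Proof.
move=> df cf' c0 cd; have [_ E] := loc_ac_FTC (C1_loc_ac df cf') c0 cd.
rewrite /Rintegral -[RHS]/(fine (f d - f c)%:E) -E; congr fine.
apply: eq_integral => x; rewrite inE => /(half_line_oc c0).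
rewrite in_half_lineE => x0; rewrite derive1E.
by have [_ ->] := df x x0.
Qed.

Lemma is_derive_inv (x : R) : 0 < x -> is_derive x 1 (fun y : R => - y^-1) (x ^- 2).
Proof.
move=> x0; apply: is_derive_eq; first by apply: is_deriveN; apply: is_deriveV; rewrite gt_eqF.
by rewrite /GRing.scale/= mulr1 opprK.
Qed.

(** Pointwise, [2 u'] is at most [t^-1 (x u')^2 + t x^-2]. The parameter [t] keeps
    the bound linear in the energy. *)
Lemma increment_bound u c d t : bessel_dom u -> 0 < c -> c <= d -> 0 < t ->
  2 * `|u d - u c| <= t^-1 * 'int_(c, d) (fun x => derive1 u x * derive1 u x * x ^+ 2)
                      + t * (c^-1 - d^-1).
Proof.
move=> /bessel_domE[acu su du] c0 cd t0.
have [iu Eu] := loc_ac_FTC acu c0 cd.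
have ci : {in half_line, continuous (fun y : R => y ^- 2)}.
  move=> x; rewrite inE in_half_lineE => x0.
  by apply: cvgV; [rewrite expf_neq0 ?gt_eqF|exact: exprn_continuous].
have inv2 : 'int_(c, d) (fun x => x ^- 2) = c^-1 - d^-1.
  by rewrite (C1_FTC is_derive_inv)//; ring.
have ii := continuous_integrable_oc d c0 ci.
have i2 := integrable_oc d c0 (sqint_prod du du).
have mD : measurable (`]c, d]%classic : set (measurableTypeR R)) by [].
have key sg : sg ^+ 2 = 1 -> 2 * (sg * (u d - u c)) <= t^-1 *
    'int_(c, d) (fun x => derive1 u x * derive1 u x * x ^+ 2) + t * (c^-1 - d^-1).
  move=> sg2; have -> : u d - u c = 'int_(c, d) (derive1 u) by rewrite /Rintegral Eu.
  rewrite -inv2 -!RintegralZl//; last first.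
    exact: (integrableZl mD sg iu).
  rewrite -RintegralD//; last 2 first.
  - exact: (integrableZl mD t^-1 i2).
  - exact: (integrableZl mD t ii).
  apply: le_Rintegral => //.
  - exact: (integrableZl mD 2 (integrableZl mD sg iu)).
  - exact: (integrableD mD (integrableZl mD t^-1 i2) (integrableZl mD t ii)).
  move=> x; move=> /(half_line_oc c0); rewrite in_half_lineE => x0.
  set p := derive1 u x.
  have -> : t^-1 * (p * p * x ^+ 2) + t * x ^- 2 =
     2 * (sg * p) + t^-1 * (p * x - sg * t / x) ^+ 2.
    have -> : t * x ^- 2 = sg ^+ 2 * (t * x ^- 2) by rewrite sg2 mul1r.
    by field; rewrite !gt_eqF.
  by rewrite lerDl mulr_ge0 ?sqr_ge0 ?invr_ge0 ?ltW.
have [h|h] := leP 0 (u d - u c).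
  by rewrite ger0_norm// -[X in 2 * X]mul1r; apply: key; rewrite expr1n.
by rewrite ltr0_norm// -mulN1r; apply: key; rewrite sqrrN expr1n.
Qed.

(** The best [t] in [increment_bound]. The resistance between two points is the
    increment of the scale function [-1/x]. *)
Lemma bessel_increment_sqr u c d : bessel_dom u -> 0 < c -> c < d ->
  (u d - u c) ^+ 2 <= (c^-1 - d^-1) *
     'int_(c, d) (fun x => derive1 u x * derive1 u x * x ^+ 2).
Proof.
move=> bu c0 cd; have d0 := lt_trans c0 cd.
have r0 : 0 < c^-1 - d^-1 by rewrite subr_gt0 ltf_pV2 ?posrE.
have [->|dne] := eqVneq (u d - u c) 0.
  rewrite expr0n/=; apply: mulr_ge0; first exact: ltW.
  by apply: Rintegral_ge0 => x _; rewrite -expr2 mulr_ge0 ?sqr_ge0.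
have n0 : 0 < `|u d - u c| by rewrite normr_gt0.
have t0 : 0 < `|u d - u c| / (c^-1 - d^-1) by rewrite divr_gt0.
have := increment_bound bu c0 (ltW cd) t0.
move: (Rintegral _ _ _) => I; move: (c^-1 - d^-1) r0 {t0} => r r0.
rewrite -[(u d - u c) ^+ 2]ger0_norm ?sqr_ge0// normrX.
move: (`|u d - u c|) n0 => x x0 h.
have : (2 * x) * x <= (((x / r)^-1 * I + x / r * r)) * x by rewrite ler_wpM2r// ltW.
have -> : ((x / r)^-1 * I + x / r * r) * x = r * I + x ^+ 2.
  by field; rewrite !gt_eqF.
by rewrite expr2; lra.
Qed.

(** * Consequences for the values at the integers *)

Lemma wip_ge_itv f c d : 0 < c -> sqint f ->
  'int_(c, d) (fun x => f x * f x * x ^+ 2) <= wip f f.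
Proof.
move=> c0 sf; rewrite unlock; apply: itv_int_le_half_line => //.
- by move=> x; rewrite -expr2 mulr_ge0 ?sqr_ge0.
- exact: sqint_prod.
Qed.

Lemma inv_sub_succ (y : R) : y != 0 -> y + 1 != 0 ->
  y^-1 - (y + 1)^-1 = (y * (y + 1))^-1.
Proof. by move=> h1 h2; field; rewrite h1 h2. Qed.

Lemma trace_energy_le u N : bessel_dom u ->
  \sum_(n < N) n.+1%:R * n.+2%:R * (u n.+2%:R - u n.+1%:R) ^+ 2 <=
  wip (derive1 u) (derive1 u).
Proof.
move=> bu; have [acu su du] := (bessel_domE u).1 bu.
have i2 := sqint_prod du du.
apply: le_trans (wip_ge_itv N.+1%:R ltr01 du).
elim: N => [|N IH]; first by rewrite big_ord0; apply: Rintegral_ge0 => x _; rewrite -expr2 mulr_ge0 ?sqr_ge0.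
rewrite big_ord_recr/= (@itv_int_split _ 1 N.+1%:R); last first.
- exact: (integrable_oc _ ltr01 i2).
- by rewrite ler_nat.
- by rewrite ler1n.
apply: lerD IH _.
have h := bessel_increment_sqr bu (ltr0Sn R N) (_ : N.+1%:R < N.+2%:R).
have {h} := h (ltac:(by rewrite ltr_nat)).
have -> : (N.+1%:R^-1 - N.+2%:R^-1 : R) = (N.+1%:R * N.+2%:R)^-1.
  by rewrite -[N.+2%:R]natr1 inv_sub_succ// natr1.
by rewrite ler_pdivlMl ?mulr_gt0.
Qed.

(** Beyond a far point the energy allows only small oscillations, so a large
    value there persists up to infinity, against square-integrability. *)
Lemma bessel_dom_vanishes u : bessel_dom u ->
  forall e, 0 < e -> exists N : nat, forall n, (N <= n)%N -> `|u n.+1%:R| <= e.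
Proof.
move=> bu e e0; have [acu su du] := (bessel_domE u).1 bu.
set E := wip (derive1 u) (derive1 u); set S := wip u u.
have E0 : 0 <= E by exact: wip_ge0.
have S0 : 0 <= S by exact: wip_ge0.
pose t := 2 * (E + 1) / e.
have t0 : 0 < t by rewrite divr_gt0// mulr_gt0// ltr_wpDl.
have [N hN] : exists N : nat, 2 * t / e <= N%:R.
  exists (Num.bound (2 * t / e)); apply/ltW/archi_boundP.
  by apply: divr_ge0; [apply: mulr_ge0; [by []|exact: ltW]|exact: ltW].
exists N => n Nn; rewrite leNgt; apply/negP => large.
set x : R := n.+1%:R in large.
have x1 : 1 <= x by rewrite /x ler1n.
have x0 : 0 < x by lra.
have tx : t / x <= e / 2.
  rewrite ler_pdivrMr// mulrC mulrA ler_pdivlMr//.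
  have : 2 * t / e <= x by apply: le_trans hN _; rewrite ler_nat (leq_trans Nn).
  by rewrite ler_pdivrMr//; lra.
have Et : t^-1 * E <= e / 2.
  rewrite mulrC ler_pdivrMr// /t.
  have -> : e / 2 * (2 * (E + 1) / e) = E + 1 by field; rewrite gt_eqF.
  lra.
have far y : x <= y -> e / 2 <= `|u y|.
  move=> xy; have y0 : 0 < y by lra.
  have := increment_bound bu x0 xy t0.
  have h1 := wip_ge_itv y x0 du.
  have h2 : t^-1 * 'int_(x, y) (fun x => derive1 u x * derive1 u x * x ^+ 2) <= t^-1 * E.
    by rewrite ler_wpM2l// invr_ge0 ltW.
  have h3 : t * (x^-1 - y^-1) <= t / x.
    by apply: ler_wpM2l; [exact: ltW|rewrite gerBl invr_ge0 ltW].
  have h4 : `|u x| <= `|u y| + `|u y - u x|.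
    have {1}-> : u x = u y - (u y - u x) by ring.
    exact: ler_normB.
  move: h2; move: (Rintegral _ _ _) => I h2.
  move: large h4 tx Et h3 h2.
  move: (t^-1 * I) (t * (x^-1 - y^-1)) (t / x) (t^-1 * E) (`|u x|) (`|u y|) (`|u y - u x|).
  by move=> *; lra.
pose M := 4 * (S + 1) / e ^+ 2.
have M0 : 0 < M by rewrite divr_gt0 ?exprn_gt0// mulr_gt0// ltr_wpDl.
have : M * (e / 2) ^+ 2 <= S.
  apply: le_trans (wip_ge_itv (x + M) x0 su).
  have mD := measurable_itvR `]x, x + M].
  have -> : M * (e / 2) ^+ 2 = 'int_(x, x + M) (fun=> (e / 2) ^+ 2).
    rewrite Rintegral_cst//= lebesgue_measure_itv/= lte_fin ltrDl M0 -EFinB/=.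
    by rewrite mulrC; congr (_ * _); ring.
  apply: le_Rintegral => //.
  - apply: (continuous_integrable_oc _ x0) => y _; exact: cst_continuous.
  - exact: (integrable_oc _ x0 (sqint_prod su su)).
  move=> y /=; rewrite in_itv/= => /andP[xy _].
  rewrite -expr2 -[u y ^+ 2]ger0_norm ?sqr_ge0// normrX.
  have h := far y (ltW xy).
  have h2 : (e / 2) ^+ 2 <= `|u y| ^+ 2 by rewrite ler_sqr ?nnegrE// divr_ge0// ltW.
  have h3 : 1 <= y ^+ 2 by rewrite -[1](expr1n R 2) ler_sqr ?nnegrE; lra.
  have := mulr_ge0 (sqr_ge0 `|u y|) (_ : 0 <= y ^+ 2 - 1).
  by rewrite subr_ge0 h3 => /(_ isT); lra.
have -> : M * (e / 2) ^+ 2 = S + 1 by rewrite /M; field; rewrite gt_eqF.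
by lra.
Qed.

End BesselEstimates.

(** * The Euler-Lagrange equation of the form *)

Section LocalSolutions.
Context {R : realType}.
Implicit Types (u v w f g s : R -> R) (c d e kap : R).
Local Notation leb := (@lebesgue_measure R).
Local Notation "''int_' ( c , d ) f" := (\int[leb]_(x in `]c, d]) f x)
  (at level 10, c, d at level 9, f at level 8).

(** [w] solves [(x^2 w')' = kap x^2 w] on the half-line, with flux [s = x^2 w']. *)
Definition local_solution kap w s :=
  (forall x : R, 0 < x -> is_derive x 1 w (s x / x ^+ 2)) /\
  (forall x : R, 0 < x -> is_derive x 1 s (kap * x ^+ 2 * w x)).

Definition energy_density kap u v (x : R) : R :=
  (derive1 u x * derive1 v x + kap * (u x * v x)) * x ^+ 2.

Lemma measurable_energy_density kap u v : loc_abs_continuous u -> loc_abs_continuous v ->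
  measurable_fun (half_line : set R) (energy_density kap u v).
Proof.
move=> acu acv; apply: measurable_funM; last exact: measurable_sqr_weight.
have cu := loc_ac_continuous acu; have cv := loc_ac_continuous acv.
apply: measurable_funD.
  by apply: measurable_funM; exact: measurable_derive1.
apply: measurable_funM; first exact: measurable_cst.
by apply: measurable_funM; exact: measurable_continuous_half_line.
Qed.

Lemma is_derive_continuous f f' : (forall x : R, 0 < x -> is_derive x 1 f (f' x)) ->
  {in half_line, continuous f}.
Proof.
move=> df x; rewrite inE in_half_lineE => x0.
have [dx _] := df x x0.
by apply: differentiable_continuous; apply/derivable1_diffP.
Qed.

Lemma is_derive_derive1 f (x l : R) : is_derive x 1 f l -> derive1 f x = l.
Proof. by move=> [_ <-]; rewrite derive1E. Qed.

Lemma continuous_half_lineM f g : {in half_line, continuous f} ->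
  {in half_line, continuous g} -> {in half_line, continuous (fun x => f x * g x)}.
Proof. by move=> cf cg x xI; apply: cvgM; [exact: cf|exact: cg]. Qed.

Lemma continuous_half_line_sqr : {in (half_line : set R), continuous (fun x : R => x ^+ 2)}.
Proof. by move=> x _; exact: exprn_continuous. Qed.

Lemma continuous_half_line_sqrV : {in (half_line : set R), continuous (fun x : R => x ^- 2)}.
Proof.
move=> x; rewrite inE in_half_lineE => x0.
by apply: cvgV; [rewrite expf_neq0 ?gt_eqF|exact: exprn_continuous].
Qed.

Section Consequences.
Variables (kap : R) (w s : R -> R).
Hypothesis ws : local_solution kap w s.

Lemma local_solution_continuous : {in half_line, continuous w}.
Proof. exact: is_derive_continuous ws.1. Qed.

Lemma local_flux_continuous : {in half_line, continuous s}.
Proof. exact: is_derive_continuous ws.2. Qed.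

Lemma local_slope_continuous : {in half_line, continuous (fun x => s x / x ^+ 2)}.
Proof.
exact: continuous_half_lineM local_flux_continuous continuous_half_line_sqrV.
Qed.

Lemma local_solution_loc_ac : loc_abs_continuous w.
Proof. exact: C1_loc_ac ws.1 local_slope_continuous. Qed.

Lemma local_flux_loc_ac : loc_abs_continuous s.
Proof.
apply: (C1_loc_ac ws.2); apply: continuous_half_lineM local_solution_continuous.
by apply: continuous_half_lineM continuous_half_line_sqr => x _; exact: cst_continuous.
Qed.

(** Green's formula: the energy density against [v] is the derivative of
    [s * v]. *)
Lemma local_green v c d : loc_abs_continuous v -> 0 < c -> c <= d ->
  leb.-integrable `]c, d] (EFin \o energy_density kap w v) /\
  'int_(c, d) (energy_density kap w v) = s d * v d - s c * v c.
Proof.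
move=> acv c0 cd.
have [i1 E1] := loc_ac_FTC (loc_acM local_flux_loc_ac acv) c0 cd.
have mI := measurable_funS (@measurable_half_line R) (half_line_oc (d := d) c0)
  (measurable_energy_density kap local_solution_loc_ac acv).
have ae : {ae leb, forall x, [set` `]c, d]] x ->
    energy_density kap w v x = derive1 (fun x => s x * v x) x}.
  apply: aeS (loc_ac_derivable acv) => x dv xcd.
  have := half_line_oc c0 xcd; rewrite in_half_lineE => x0.
  have {}dv : derivable v x 1 by apply: dv; rewrite in_half_lineE.
  have dsv : is_derive x 1 (s * v) (s x *: 'D_1 v x + v x *: (kap * x ^+ 2 * w x)).
    by apply: is_deriveM; [exact: ws.2|exact: derivableP].
  rewrite /energy_density (is_derive_derive1 dsv) (is_derive_derive1 (ws.1 x x0)) -derive1E.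
  rewrite /GRing.scale/=; move: (derive1 v x) => p.
  by field; rewrite gt_eqF.
have [i2 E2] := ae_eq_integrable (measurable_itvR _) mI i1 ae.
by split=> //; rewrite /Rintegral E2 E1.
Qed.

End Consequences.
End LocalSolutions.

(** * Gluing solutions along the integers *)

Section Interpolation.
Context {R : realType}.
Implicit Types (u v w f g : R -> R) (c d e kap : R).
Local Notation leb := (@lebesgue_measure R).
Local Notation "''int_' ( c , d ) f" := (\int[leb]_(x in `]c, d]) f x)
  (at level 10, c, d at level 9, f at level 8).

(** Intervals that exhaust the half-line and stay away from the singular endpoint
    0; each of them meets finitely many cells. *)
Definition window (n : nat) : set (measurableTypeR R) := `]n.+1%:R^-1, n.+1%:R]%classic.

Lemma window_half_line : \bigcup_n window n = half_line.
Proof.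
apply/seteqP; split => [x [n _]|x].
  by apply: half_line_oc; rewrite invr_gt0.
rewrite in_half_lineE => x0.
have [n nx] := exists_inv_succ_lt x0.
exists (maxn n (Num.bound x)) => //; rewrite /window/= in_itv/=; apply/andP; split.
  by apply: le_lt_trans nx; rewrite lef_pV2 ?posrE// ler_nat ltnS leq_maxl.
apply/ltW; apply: lt_trans (archi_boundP (ltW x0)) _.
by rewrite ltr_nat ltnS leq_maxr.
Qed.

Lemma window_nondecreasing : {homo window : n m / (n <= m)%N >-> (n <= m)%O}.
Proof.
move=> n m nm; apply/subsetPset => x; rewrite /window/= !in_itv/= => /andP[h1 h2].
apply/andP; split; first by apply: le_lt_trans h1; rewrite lef_pV2 ?posrE// ler_nat ltnS.
by apply: le_trans h2 _; rewrite ler_nat ltnS.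
Qed.

Lemma measurable_window n : measurable (window n : set (measurableTypeR R)).
Proof. exact: measurable_itvR. Qed.

Lemma window_bounded_integrable f C : (forall x, 0 <= f x) ->
  measurable_fun (half_line : set R) f ->
  (forall n, leb.-integrable (window n) (EFin \o f)) ->
  (forall n, \int[leb]_(x in window n) f x <= C) ->
  leb.-integrable half_line (EFin \o f).
Proof.
move=> f0 mf intf fC.
apply/(integrable_ge0 f0 mf).
have mw n : measurable_fun (window n) (EFin \o f) by exact: measurable_int (intf n).
have f0' (n : nat) x : window n x -> (0%R <= (EFin \o f) x)%E by move=> _; rewrite lee_fin.
have cv := ge0_nondecreasing_set_cvg_integral (mu := leb) window_nondecreasing measurable_window mw f0'.
rewrite window_half_line in cv.
apply: (@le_lt_trans _ _ C%:E); last exact: ltry.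
rewrite -(cvg_lim (@ereal_hausdorff R) cv).
apply: lime_le; first by apply/cvg_ex; eexists; exact: cv.
apply: nearW => n; have := fC n; rewrite /Rintegral -lee_fin fineK//.
exact: (integrable_fin_num (measurable_window n) (intf n)).
Qed.

Lemma window_integral_cvg f : leb.-integrable half_line (EFin \o f) ->
  \int[leb]_(x in window n) f x @[n --> \oo] --> \int[leb]_(x in half_line) f x.
Proof.
move=> intf.
have sub n : window n `<=` half_line.
  by rewrite -window_half_line; exact: bigcup_sup.
pose F n := (EFin \o f) \_ (window n).
have mF n : measurable_fun (half_line : set (measurableTypeR R)) (F n).
  have /integrableP[mf _] := intf.
  apply: (iffLR (measurable_restrict (EFin \o f) (measurable_window n) (@measurable_half_line R))).
  exact: (measurable_funS (@measurable_half_line R) (@subIsetl _ _ _) mf).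
have Ff x : half_line x -> F n x @[n --> \oo] --> (EFin \o f) x.
  rewrite -window_half_line => -[m _ mx].
  apply: cvg_near_cst; near=> n; rewrite /F patchE ifT// inE.
  have : (window m <= window n)%O by apply: window_nondecreasing; near: n; exact: nbhs_infty_ge.
  by move=> /subsetPset; apply.
have fin x : half_line x -> abse ((EFin \o f) x) \is a fin_num by [].
have dom n x : half_line x -> (`|F n x| <= `|(EFin \o f) x|)%E.
  by move=> _; rewrite /F patchE; case: ifP => // _; rewrite abse0.
have := dominated_cvg (@measurable_half_line R) mF Ff fin (integrable_abse intf) dom.
have -> : (fun n => \int[leb]_(x in half_line) F n x)%E =
    (fun n => \int[leb]_(x in window n) (EFin \o f) x)%E.
  by apply/funext => n; rewrite /F -integral_mkcondr setIidr.
move=> cv; apply: fine_cvg; rewrite fineK; first exact: cv.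
exact: (integrable_fin_num (@measurable_half_line R) intf).
Unshelve. all: by end_near. Qed.

(** The piece of index [k] is used on the cell between [k] and [k.+1]. *)
Definition glue (W : nat -> R -> R) x := W (Num.truncn x) x.

Section Glue.
Variables (kap : R) (W S : nat -> R -> R).
Hypothesis WS : forall k, local_solution kap (W k) (S k).
Hypothesis Wmatch : forall k, W k k.+1%:R = W k.+1 k.+1%:R.
Let w := glue W.

Lemma glueE k x : k%:R <= x -> x <= k.+1%:R -> w x = W k x.
Proof.
move=> kx; rewrite le_eqVlt => /orP[/eqP ->|xk].
  by rewrite /w /glue (_ : Num.truncn _ = k.+1) ?Wmatch// natrK.
by rewrite /w /glue (_ : Num.truncn _ = k)//; apply: truncn_def; rewrite kx.
Qed.

(** Only the values of adjacent pieces match, not their slopes. *)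
Lemma glue_lipschitz c n : 0 < c -> c <= 1 -> exists2 M, 0 < M &
  forall s t, c <= s -> s <= t -> t <= n.+1%:R -> `|w t - w s| <= M * (t - s).
Proof.
move=> c0 c1; elim: n => [|n [M M0 IH]].
  have [M M0 H] := C1_lipschitz (WS 0).1 (local_slope_continuous (WS 0)) c0 c1.
  by exists M => // s t cs st t1; rewrite !(@glueE 0) ?H//; lra.
have n0 : (0 : R) < n.+1%:R by rewrite ltr0n.
have nn : (n.+1%:R : R) <= n.+2%:R by rewrite ler_nat.
have [N N0 H] := C1_lipschitz (WS n.+1).1 (local_slope_continuous (WS n.+1)) n0 nn.
have HN (s t : R) : n.+1%:R <= s -> s <= t -> t <= n.+2%:R -> `|w t - w s| <= N * (t - s).
  by move=> ns st tn; rewrite !(@glueE n.+1) ?H// (le_trans _ tn, le_trans ns).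
exists (M + N); first exact: addr_gt0.
have widen (K s t : R) : 0 <= K -> s <= t -> 0 <= K * (t - s).
  by move=> K0 st; rewrite mulr_ge0// subr_ge0.
move=> s t cs st tn; rewrite mulrDl.
have [tn1|n1t] := leP t n.+1%:R.
  by have := IH s t cs st tn1; have := widen N s t (ltW N0) st; lra.
have [sn1|n1s] := leP s n.+1%:R; last first.
  by have := HN s t (ltW n1s) st tn; have := widen M s t (ltW M0) st; lra.
have -> : w t - w s = (w t - w n.+1%:R) + (w n.+1%:R - w s) by ring.
have h1 := IH s _ cs sn1 (lexx _); have h2 := HN _ t (lexx _) (ltW n1t) tn.
have v1 := widen N s _ (ltW N0) sn1; have v2 := widen M _ t (ltW M0) (ltW n1t).
apply: le_trans (ler_normD _ _) _; lra.
Qed.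

Lemma glue_loc_ac : loc_abs_continuous w.
Proof.
apply: lipschitz_loc_ac => c d c0 cd.
have m0 : 0 < Num.min c 1 by rewrite lt_min c0 ltr01.
have m1 : Num.min c 1 <= 1 by rewrite ge_min lexx orbT.
have [M M0 H] := @glue_lipschitz _ (Num.bound d) m0 m1; exists M => // s t cs st td.
apply: H => //; first by rewrite ge_min cs.
apply: le_trans td _; apply/ltW/(lt_trans (archi_boundP (ltW (lt_trans c0 cd)))).
by rewrite ltr_nat.
Qed.

Lemma glue_derive1 k x : k%:R < x -> x < k.+1%:R -> derive1 w x = derive1 (W k) x.
Proof.
move=> kx xk; rewrite !derive1E; apply: near_eq_derive; near=> y.
apply: glueE; apply: ltW.
  by near: y; exact: lt_nbhsr.
by near: y; exact: lt_nbhsl.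
Unshelve. all: by end_near. Qed.

(** Green's formula for the glued function, on one cell. *)
Lemma glue_green k v c d : loc_abs_continuous v -> 0 < c -> k%:R <= c -> c <= d ->
  d <= k.+1%:R ->
  leb.-integrable `]c, d] (EFin \o energy_density kap w v) /\
  'int_(c, d) (energy_density kap w v) = S k d * v d - S k c * v c.
Proof.
move=> acv c0 kc cd dk.
have [i1 E1] := local_green (WS k) acv c0 cd.
have mI := measurable_funS (@measurable_half_line R) (half_line_oc (d := d) c0)
  (measurable_energy_density kap glue_loc_ac acv).
have ae : {ae leb, forall x, [set` `]c, d]] x ->
    energy_density kap w v x = energy_density kap (W k) v x}.
  exists [set k.+1%:R]; split; first exact: measurable_set1.
    exact: lebesgue_measure_set1.
  move=> x /= xP; apply: contrapT => xk; apply: xP; rewrite in_itv/= => /andP[cx xd].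
  have xk1 : x < k.+1%:R by rewrite lt_neqAle (le_trans xd dk) andbT; apply/eqP.
  rewrite /energy_density (@glue_derive1 k)//; last exact: le_lt_trans cx.
  by rewrite (@glueE k)// ?ltW// (le_lt_trans kc).
have [i2 E2] := ae_eq_integrable (measurable_itvR _) mI i1 ae.
by split=> //; rewrite /Rintegral E2 -E1.
Qed.

(** On a cell the glued function minimises the energy among the functions with
    the same values at the endpoints, by completing the square. *)
Lemma glue_minimal k u : 0 <= kap -> loc_abs_continuous u ->
  leb.-integrable `]k.+1%:R, k.+2%:R] (EFin \o energy_density kap u u) ->
  u k.+1%:R = W k.+1 k.+1%:R -> u k.+2%:R = W k.+1 k.+2%:R ->
  'int_(k.+1%:R, k.+2%:R) (energy_density kap w w) <=
  'int_(k.+1%:R, k.+2%:R) (energy_density kap u u).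
Proof.
move=> kap0 acu iu u1 u2.
have k0 : (0 : R) < k.+1%:R by rewrite ltr0n.
have kk : (k.+1%:R : R) <= k.+2%:R by rewrite ler_nat.
have [iwu Ewu] := glue_green acu k0 (lexx _) kk (lexx _).
have [iww Eww] := glue_green glue_loc_ac k0 (lexx _) kk (lexx _).
have ww1 : w k.+1%:R = W k.+1 k.+1%:R by apply: glueE.
have ww2 : w k.+2%:R = W k.+1 k.+2%:R by apply: glueE.
have same : 'int_(k.+1%:R, k.+2%:R) (energy_density kap w u) =
    'int_(k.+1%:R, k.+2%:R) (energy_density kap w w).
  by rewrite Ewu Eww u1 u2 ww1 ww2.
have mD := measurable_itvR (R := R) `]k.+1%:R, k.+2%:R].
have -> : 'int_(k.+1%:R, k.+2%:R) (energy_density kap w w) =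
    'int_(k.+1%:R, k.+2%:R) (fun x => 2 * energy_density kap w u x - energy_density kap w w x).
  have i2 := integrableZl mD 2 iwu.
  rewrite (RintegralB mD i2 iww) (RintegralZl 2 mD iwu) same.
  by move: (Rintegral _ _ _) => I; ring.
apply: le_Rintegral => //.
  exact: (integrableB mD (integrableZl mD 2 iwu) iww).
move=> x _; rewrite -subr_ge0 /energy_density.
move: (derive1 w x) (derive1 u x) (w x) (u x) => p q y z.
have -> : (q * q + kap * (z * z)) * x ^+ 2 -
   (2 * ((p * q + kap * (y * z)) * x ^+ 2) - (p * p + kap * (y * y)) * x ^+ 2) =
   ((p - q) ^+ 2 + kap * (y - z) ^+ 2) * x ^+ 2 by ring.
by rewrite mulr_ge0 ?sqr_ge0// addr_ge0 ?sqr_ge0// mulr_ge0 ?sqr_ge0.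
Qed.

End Glue.
End Interpolation.

(** * Explicit solutions and their energy *)

Section Interpolants.
Context {R : realType}.
Implicit Types (u v w f g : R -> R) (c d e kap lam : R).
Local Notation leb := (@lebesgue_measure R).
Local Notation "''int_' ( c , d ) f" := (\int[leb]_(x in `]c, d]) f x)
  (at level 10, c, d at level 9, f at level 8).

Lemma itv_integrable_join f c d e : c <= d -> d <= e ->
  leb.-integrable `]c, d] (EFin \o f) -> leb.-integrable `]d, e] (EFin \o f) ->
  leb.-integrable `]c, e] (EFin \o f).
Proof.
move=> cd de /integrableP[m1 i1] /integrableP[m2 i2].
have E : `]c, e]%classic = `]c, d]%classic `|` `]d, e]%classic :> set (measurableTypeR R).
  by apply: itv_bndbnd_setU; rewrite bnd_simp.
have mf : measurable_fun (`]c, e]%classic : set (measurableTypeR R)) (EFin \o f).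
  by rewrite E; apply/measurable_funU.
apply/integrableP; split=> //.
rewrite E ge0_integral_setU//; first by rewrite lte_add_pinfty.
- by rewrite -E; exact: measurableT_comp.
- apply/disj_setPS => x [/=]; rewrite !in_itv/=; lra.
Qed.

Lemma cells_integrable f n :
  (forall k, leb.-integrable `]k.+1%:R, k.+2%:R] (EFin \o f)) ->
  leb.-integrable `]1, n.+1%:R] (EFin \o f).
Proof.
move=> H; elim: n => [|n IH].
  by apply: (integrableS (measurable_itvR `]1, 2])) (H 0%N) => // x; rewrite /= !in_itv/=; lra.
by apply: (@itv_integrable_join _ _ n.+1%:R); rewrite ?ler1n ?ler_nat.
Qed.

Lemma cells_sum f n : (forall k, leb.-integrable `]k.+1%:R, k.+2%:R] (EFin \o f)) ->
  'int_(1, n.+1%:R) f = \sum_(k < n) 'int_(k.+1%:R, k.+2%:R) f.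
Proof.
move=> H; elim: n => [|n IH].
  by rewrite big_ord0 set_itv_ge ?Rintegral_set0//= bnd_simp ltxx.
rewrite big_ord_recr/= -IH; apply: itv_int_split; rewrite ?ler1n ?ler_nat//.
exact: cells_integrable.
Qed.

Lemma energy_density_ge0 kap u x : 0 <= kap -> 0 <= energy_density kap u u x.
Proof.
move=> k0; rewrite /energy_density -!expr2 mulr_ge0 ?sqr_ge0// addr_ge0 ?sqr_ge0//.
by rewrite mulr_ge0 ?sqr_ge0.
Qed.

Lemma bessel_form_density lam u v : bessel_dom u -> bessel_dom v ->
  leb.-integrable half_line (EFin \o energy_density (2 * lam) u v) /\
  bessel_form_lam lam u v = \int[leb]_(x in half_line) energy_density (2 * lam) u v x.
Proof.
move=> bu bv; have [acu su du] := (bessel_domE u).1 bu; have [acv sv dv] := (bessel_domE v).1 bv.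
have i1 := sqint_prod du dv; have i2 := sqint_prod su sv.
have i3 := integrableZl (@measurable_half_line R) (2 * lam) i2.
have E x : energy_density (2 * lam) u v x = derive1 u x * derive1 v x * x ^+ 2 + 2 * lam * (u x * v x * x ^+ 2).
  by rewrite /energy_density; move: (derive1 u x) (derive1 v x) => p q; ring.
split.
  have := integrableD (@measurable_half_line R) i1 i3.
  by apply: eq_integrable; [exact: measurable_half_line|move=> x _; rewrite /= E].
rewrite (bessel_form_lamE lam bu bv) unlock.
rewrite -(RintegralZl (2 * lam) (@measurable_half_line R) i2).
rewrite -(RintegralD (@measurable_half_line R) i1 i3).
by apply: eq_Rintegral => x _; rewrite E.
Qed.

Lemma window_split f n : leb.-integrable `]n.+1%:R^-1, 1] (EFin \o f) ->
  (forall k, leb.-integrable `]k.+1%:R, k.+2%:R] (EFin \o f)) ->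
  leb.-integrable (window n) (EFin \o f) /\
  \int[leb]_(x in window n) f x =
    'int_(n.+1%:R^-1, 1) f + \sum_(k < n) 'int_(k.+1%:R, k.+2%:R) f.
Proof.
move=> i0 ik; have i1 := cells_integrable n ik.
have n1 : (n.+1%:R^-1 : R) <= 1 by rewrite invf_le1 ?ler1n.
have n2 : (1 : R) <= n.+1%:R by rewrite ler1n.
have ij := itv_integrable_join n1 n2 i0 i1.
by split=> //; rewrite /window (itv_int_split n1 n2 ij) cells_sum.
Qed.

Lemma bessel_dom_of_energy kap w : 0 < kap -> loc_abs_continuous w ->
  leb.-integrable half_line (EFin \o energy_density kap w w) -> bessel_dom w.
Proof.
move=> k0 acw iw; apply: (bessel_domE w).2.
have cw := loc_ac_continuous acw.
have mw := measurable_continuous_half_line cw; have mdw := measurable_derive1 cw.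
have dom (C : R) f : measurable_fun (half_line : set R) f ->
    (forall x, f x * f x * x ^+ 2 <= C * energy_density kap w w x) -> sqint f.
  move=> mf H; apply/sqintE; split; first exact: mf.
  have iC := integrableZl (@measurable_half_line R) C iw.
  apply: (le_integrable _ _ _ iC).
  - exact: measurable_half_line.
  - by apply/measurable_EFinP; exact: measurable_wmul.
  move=> x _ /=; rewrite lee_fin ger0_norm; last by rewrite -expr2 mulr_ge0 ?sqr_ge0.
  by apply: le_trans (H x) _; rewrite ler_norm.
split; first exact: acw.
- apply: (dom kap^-1 _ mw) => x; rewrite ler_pdivlMl// /energy_density.
  have := mulr_ge0 (sqr_ge0 (derive1 w x)) (sqr_ge0 x); move: (derive1 w x) (w x) => p q.
  by rewrite expr2 => h; rewrite -subr_ge0; apply: le_trans h _; rewrite le_eqVlt; apply/orP; left; apply/eqP; ring.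
- apply: (dom 1 _ mdw) => x; rewrite mul1r /energy_density ler_wpM2r ?sqr_ge0// lerDl.
  by rewrite mulr_ge0 ?(ltW k0)// -expr2 sqr_ge0.
Qed.

Lemma is_derive_exp_lin (m x : R) : is_derive x 1 (fun y => expR (m * y)) (m * expR (m * x)).
Proof.
have h : is_derive x 1 (fun y : R => m * y) m.
  apply: is_derive_eq (is_deriveM (is_derive_cst m x 1) (is_derive_id x 1)) _.
  by rewrite /GRing.scale/= mulr1 mulr0 addr0.
rewrite mulrC; exact: (@is_derive1_comp _ expR (fun y => m * y) x _ _ (is_derive_expR (m * x)) h).
Qed.

Lemma is_derive_exp_comb (m al be x : R) :
  is_derive x 1 (fun y => al * expR (m * y) + be * expR (- m * y))
    (m * (al * expR (m * x) - be * expR (- m * x))).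
Proof.
have dexp (c k : R) : is_derive x 1 (fun y => c * expR (k * y)) (c * k * expR (k * x)).
  apply: is_derive_eq (is_deriveM (is_derive_cst c x 1) (is_derive_exp_lin k x)) _.
  by rewrite /GRing.scale/= mulr0 addr0 mulrA.
by apply: is_derive_eq (is_deriveD (dexp al m) (dexp be (- m))) _; ring.
Qed.

Lemma exp_flux_derive (m al be x : R) : is_derive x 1
  (fun x => x * (m * (al * expR (m * x) - be * expR (- m * x))) -
            (al * expR (m * x) + be * expR (- m * x)))
  (m ^+ 2 * (x * (al * expR (m * x) + be * expR (- m * x)))).
Proof.
have dV := is_derive_exp_comb m al be x.
have dP : is_derive x 1 (fun y => m * (al * expR (m * y) - be * expR (- m * y)))
    (m * (m * (al * expR (m * x) + be * expR (- m * x)))).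
  have h : is_derive x 1 (fun y => al * expR (m * y) - be * expR (- m * y))
     (m * (al * expR (m * x) + be * expR (- m * x))).
    have := is_derive_exp_comb m al (- be) x; rewrite mulNr opprK.
    by under eq_fun do rewrite [- be * _]mulNr.
  by apply: is_derive_eq (is_deriveM (is_derive_cst m x 1) h) _; rewrite /GRing.scale/= mulr0 addr0.
apply: is_derive_eq (is_deriveB (is_deriveM (is_derive_id x 1) dP) dV) _.
by rewrite /GRing.scale/=; ring.
Qed.

(** Writing [w = V / x] turns the equation for [w] into [V'' = m^2 V]. *)
Lemma exp_local_solution (m al be : R) :
  local_solution (m ^+ 2) (fun x => (al * expR (m * x) + be * expR (- m * x)) / x)
   (fun x => x * (m * (al * expR (m * x) - be * expR (- m * x))) -
             (al * expR (m * x) + be * expR (- m * x))).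
Proof.
split=> x x0.
- have dinv : is_derive x 1 (fun y : R => y^-1) (- x ^- 2).
    apply: is_derive_eq; first by apply: is_deriveV; rewrite gt_eqF.
    by rewrite /GRing.scale/= mulr1.
  apply: is_derive_eq (is_deriveM (is_derive_exp_comb m al be x) dinv) _.
  by rewrite /GRing.scale/=; field; rewrite gt_eqF.
- apply: is_derive_eq (exp_flux_derive m al be x) _.
  by field; rewrite gt_eqF.
Qed.

End Interpolants.

(** * Existence of the projection *)

Section TraceOfD.
Context {R : realType}.
Implicit Types (u v w f g : R -> R) (c d e kap lam : R).
Local Notation leb := (@lebesgue_measure R).
Local Notation "''int_' ( c , d ) f" := (\int[leb]_(x in `]c, d]) f x)
  (at level 10, c, d at level 9, f at level 8).

(** The values of [V] at the ends of a cell determine the two coefficients. *)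
Lemma exp_coefficients (m A B : R) (k : nat) : 0 < m -> exists ab : R * R,
  ab.1 * expR (m * k%:R) + ab.2 * expR (- m * k%:R) = A /\
  ab.1 * expR (m * k.+1%:R) + ab.2 * expR (- m * k.+1%:R) = B.
Proof.
move=> m0; pose p := expR (m * k%:R); pose q := expR m.
have p0 : p != 0 by rewrite gt_eqF// expR_gt0.
have q1 : 1 < q by rewrite /q expR_gt1.
have q0 : q != 0 by rewrite gt_eqF//; lra.
have qq : q ^+ 2 - 1 != 0.
  by rewrite gt_eqF// subr_gt0 -[1](expr1n R 2) ltr_pXn2r ?nnegrE//; lra.
have Ep : expR (- m * k%:R) = p^-1 by rewrite mulNr expRN.
have Eq : expR (m * k.+1%:R) = p * q by rewrite -natr1 mulrDr mulr1 expRD.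
have Epq : expR (- m * k.+1%:R) = (p * q)^-1 by rewrite mulNr expRN Eq.
pose al := (B * q - A) / (p * (q ^+ 2 - 1)).
exists (al, p * (A - al * p)); rewrite /= Ep Eq Epq -/p; split.
  by field.
by rewrite /al; field; rewrite p0 q0 qq.
Qed.

(** The flux of [sinh (m x) / x] is [O(x)] at the origin, because its derivative
    is bounded there and it starts from 0. *)
Lemma flux_at_origin (m : R) : 0 < m ->
  exists2 M, 0 < M & forall x : R, 0 <= x -> x <= 1 ->
    0 <= x * (m * (expR (m * x) + expR (- m * x))) - (expR (m * x) - expR (- m * x)) <= M * x.
Proof.
move=> m0.
pose s (x : R) := x * (m * (1 * expR (m * x) - (-1) * expR (- m * x))) - (1 * expR (m * x) + (-1) * expR (- m * x)).
pose s' (x : R) := m ^+ 2 * (x * (expR (m * x) - expR (- m * x))).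
have ds (x : R) : is_derive x 1 s (s' x).
  by apply: is_derive_eq (exp_flux_derive m 1 (-1) x) _; rewrite /s'; ring.
exists (m ^+ 2 * expR m); first by rewrite mulr_gt0 ?exprn_gt0 ?expR_gt0.
move=> x x0 x1.
have s0 : s 0 = 0 by rewrite /s mulr0 mulr0 expR0; ring.
have -> : x * (m * (expR (m * x) + expR (- m * x))) - (expR (m * x) - expR (- m * x)) = s x - s 0.
  by rewrite s0 /s; ring.
have cs : {within `[0, x], continuous s}.
  by apply: derivable_within_continuous => y _; have [] := ds y.
have [y + ->] := MVT_segment x0 (fun y _ => ds y) cs.
rewrite in_itv/= subr0 => /andP[y0 yx].
have e1 : expR (- m * y) <= expR (m * y) by rewrite ler_expR mulNr; have := mulr_ge0 (ltW m0) y0; lra.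
have e2 : expR (m * y) <= expR m by rewrite ler_expR -[leRHS]mulr1 ler_wpM2l ?(ltW m0)//; lra.
have e3 := expR_gt0 (- m * y); have e4 := expR_gt0 m.
have d0 : 0 <= expR (m * y) - expR (- m * y) by rewrite subr_ge0.
rewrite /s'; apply/andP; split.
  by apply: mulr_ge0 => //; apply: mulr_ge0; [exact: sqr_ge0|exact: mulr_ge0].
apply: ler_wpM2r => //; apply: ler_wpM2l; first exact: sqr_ge0.
apply: (@le_trans _ _ (1 * expR m)); last by rewrite mul1r.
by apply: ler_pM => //; lra.
Qed.

(** Finite energy permits growth like [x ^ (-1/2)] at the origin, which the
    factor [c] absorbs. Hence the origin contributes no boundary term. *)
Lemma origin_decay v : bessel_dom v -> v 1 = 0 ->
  forall e, 0 < e -> exists2 del, 0 < del & forall c, 0 < c -> c < del -> c * `|v c| <= e.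
Proof.
move=> bv v1 e e0; have [acv sv dv] := (bessel_domE v).1 bv.
set E := wip (derive1 v) (derive1 v); have E0 : 0 <= E by exact: wip_ge0.
exists (Num.min 1 (e ^+ 2 / (E + 1))); first by rewrite lt_min ltr01 divr_gt0 ?exprn_gt0//; lra.
move=> c c0; rewrite lt_min => /andP[c1]; rewrite ltr_pdivlMr; last by lra.
move=> cE; have := increment_bound bv c0 (ltW c1) e0.
have := wip_ge_itv 1 c0 dv; rewrite -/E v1 sub0r normrN invr1.
move: (Rintegral _ _ _) (`|v c|) => I y IE h.
have h1 : c * (2 * y) <= c * (e^-1 * I + e * (c^-1 - 1)) by rewrite ler_wpM2l ?(ltW c0).
have E1 : c * (e^-1 * I + e * (c^-1 - 1)) = (c * I) / e + e - c * e by field; rewrite !gt_eqF.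
have h2 : (c * I) / e <= e.
  rewrite ler_pdivrMr// -expr2; apply: le_trans (ltW cE).
  by rewrite ler_wpM2l ?(ltW c0)//; lra.
have h3 := mulr_gt0 c0 e0.
by rewrite E1 in h1; lra.
Qed.

(** On each cell [w] solves the Euler-Lagrange equation, so only boundary terms
    remain when the form is tested against [v]. They vanish at the integers with
    [v], and at the origin because the first piece is the regular solution. *)
Theorem orthogonal_interpolant lam u : 0 < lam -> bessel_dom u ->
  exists w, kerJ_orth lam w /\ restrN w = restrN u.
Proof.
move=> l0 bu; have [acu su du] := (bessel_domE u).1 bu.
pose m := Num.sqrt (2 * lam).
have m0 : 0 < m by rewrite sqrtr_gt0 mulr_gt0.
have m2 : m ^+ 2 = 2 * lam by rewrite sqr_sqrtr// mulr_ge0// ltW.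
have kap0 : 0 < 2 * lam by rewrite mulr_gt0.
have /choice[ab abP] := fun k => exp_coefficients (k%:R * u k%:R) (k.+1%:R * u k.+1%:R) k m0.
pose W k x := ((ab k).1 * expR (m * x) + (ab k).2 * expR (- m * x)) / x.
pose S k x := x * (m * ((ab k).1 * expR (m * x) - (ab k).2 * expR (- m * x))) -
             ((ab k).1 * expR (m * x) + (ab k).2 * expR (- m * x)).
have WS k : local_solution (2 * lam) (W k) (S k) by rewrite -m2; exact: exp_local_solution.
have WR k : W k k.+1%:R = u k.+1%:R.
  by rewrite /W (abP k).2 mulrC mulKf// pnatr_eq0.
have WL k : W k.+1 k.+1%:R = u k.+1%:R.
  by rewrite /W (abP k.+1).1 mulrC mulKf// pnatr_eq0.
have match_W k : W k k.+1%:R = W k.+1 k.+1%:R by rewrite WR WL.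
pose w := glue W.
have acw : loc_abs_continuous w by exact: glue_loc_ac WS match_W.
have wn k : w k.+1%:R = u k.+1%:R by rewrite /w (glueE match_W (k := k)) ?WR// ler_nat.
have green := glue_green WS match_W.
have n0 k : (0 : R) < k.+1%:R by rewrite ltr0n.
have n1 k : (k.+1%:R : R) <= k.+2%:R by rewrite ler_nat.
have inv0 n : (0 : R) < n.+1%:R^-1 by rewrite invr_gt0.
have inv1 n : (n.+1%:R^-1 : R) <= 1 by rewrite invf_le1 ?ler1n.
(* On the first cell the solution is a multiple of sinh(m x) / x. *)
have ab0 : (ab 0).2 = - (ab 0).1.
  have := (abP 0).1; rewrite mul0r mulr0 mulr0 expR0 !mulr1 => /eqP.
  by rewrite addr_eq0 => /eqP ->; rewrite opprK.
have [M M0 originP] := flux_at_origin m0.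
have S0E x : S 0 x = (ab 0).1 * (x * (m * (expR (m * x) + expR (- m * x))) - (expR (m * x) - expR (- m * x))).
  by rewrite /S ab0; ring.
have S0W0 x : 0 < x -> x <= 1 -> 0 <= S 0%N x * w x.
  move=> x0 x1; rewrite /w (glueE match_W (k := 0))//; last exact: ltW.
  have /andP[h _] := originP x (ltW x0) x1.
  have -> : S 0%N x * W 0%N x = (ab 0).1 ^+ 2 * (x * (m * (expR (m * x) + expR (- m * x))) - (expR (m * x) - expR (- m * x))) * ((expR (m * x) - expR (- m * x)) / x).
    by rewrite S0E /W ab0; ring.
  apply: mulr_ge0; first by apply: mulr_ge0 => //; exact: sqr_ge0.
  apply: divr_ge0; last exact: ltW.
  by rewrite subr_ge0 ler_expR mulNr; have := mulr_gt0 m0 x0; lra.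
have cell k v := fun acv : loc_abs_continuous v => green k.+1 v k.+1%:R k.+2%:R acv (n0 k) (lexx _) (n1 k) (lexx _).
have first n v := fun acv : loc_abs_continuous v => green 0%N v n.+1%:R^-1 1 acv (inv0 n) (ltW (inv0 n)) (inv1 n) (lexx _).
have win n v := fun acv : loc_abs_continuous v => window_split (first n v acv).1 (fun k => (cell k v acv).1).
have [iu _] := bessel_form_density lam bu bu.
have iw : leb.-integrable half_line (EFin \o energy_density (2 * lam) w w).
  apply: (@window_bounded_integrable _ _ (S 0%N 1 * w 1 +
      \int[leb]_(x in half_line) energy_density (2 * lam) u u x)).
  - by move=> x; apply: energy_density_ge0; exact: ltW.
  - exact: measurable_energy_density.
  - by move=> n; exact: (win n w acw).1.
  move=> n; rewrite (win n w acw).2; apply: lerD.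
    by rewrite (first n w acw).2 gerBl S0W0.
  apply: (@le_trans _ _ (\sum_(k < n) 'int_(k.+1%:R, k.+2%:R) (energy_density (2 * lam) u u))).
    apply: ler_sum => k _; apply: (glue_minimal WS match_W (ltW kap0) acu).
    - exact: (integrable_oc _ (n0 k) iu).
    - by rewrite WL.
    - by rewrite WR.
  rewrite -cells_sum; last by move=> k; exact: (integrable_oc _ (n0 k) iu).
  by apply: (@itv_int_le_half_line R _ 1 _ ltr01 _ iu) => x; apply: energy_density_ge0; exact: ltW.
have bw : bessel_dom w := bessel_dom_of_energy kap0 acw iw.
exists w; split; last by apply/funext => n; exact: wn.
split; first exact: bw.
move=> v [bv vn]; have [acv _ _] := (bessel_domE v).1 bv.
have vn' k : v k.+1%:R = 0 by exact: vn.
have [iwv ->] := bessel_form_density lam bw bv.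
have cv := window_integral_cvg iwv.
suff cv0 : \int[leb]_(x in window n) energy_density (2 * lam) w v x @[n --> \oo] --> (0 : R).
  exact: (cvg_unique (@Rhausdorff R) cv cv0).
have E n : \int[leb]_(x in window n) energy_density (2 * lam) w v x = - (S 0%N n.+1%:R^-1 * v n.+1%:R^-1).
  rewrite (win n v acv).2 (first n v acv).2 (vn' 0%N) mulr0 sub0r big1 ?addr0// => k _.
  by rewrite (cell k v acv).2 !vn' !mulr0 subrr.
have -> : (fun n => \int[leb]_(x in window n) energy_density (2 * lam) w v x) =
    (fun n => - (S 0%N n.+1%:R^-1 * v n.+1%:R^-1)) by apply/funext => n; rewrite E.
apply/cvgrPdist_le => e e0.
pose C := `|(ab 0).1| * M + 1.
have C0 : 0 < C by rewrite ltr_wpDl// mulr_ge0// ltW.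
have [del del0 H] := origin_decay bv (vn' 0%N) (divr_gt0 e0 C0).
near=> n.
have nd : (n.+1%:R^-1 : R) < del by near: n; exact: near_infty_natSinv_lt (PosNum del0).
have h := H _ (inv0 n) nd.
rewrite sub0r opprK normrM S0E normrM.
have /andP[h1 h2] := originP _ (ltW (inv0 n)) (inv1 n).
rewrite [`|_ - _|]ger0_norm//.
move: (n.+1%:R^-1 * _ - _) h1 h2 => q q0 qM.
apply: (@le_trans _ _ (C * (n.+1%:R^-1 * `|v n.+1%:R^-1|))).
  rewrite mulrA ler_wpM2r// /C mulrDl mul1r -mulrA.
  apply: (@le_trans _ _ (`|(ab 0).1| * (M * n.+1%:R^-1))); first by rewrite ler_wpM2l.
  by rewrite lerDl ltW.
by rewrite mulrC -ler_pdivlMr.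
Unshelve. all: by end_near. Qed.

End TraceOfD.

(** * Two-sided bounds for the approximating forms *)

Section TraceFormBounds.
Context {R : realType}.
Implicit Types (u v w : R -> R) (f g : nat -> R) (lam : R).
Local Notation leb := (@lebesgue_measure R).
Local Notation "''int_' ( c , d ) f" := (\int[leb]_(x in `]c, d]) f x)
  (at level 10, c, d at level 9, f at level 8).

(** The inverse of the resistance [1/(n + 1) - 1/(n + 2)] between the points
    of indices [n] and [n.+1]. *)
Definition conductance n : R := n.+1%:R * n.+2%:R.

Lemma conductance_gt0 n : 0 < conductance n.
Proof. by rewrite mulr_gt0. Qed.

Definition edge_energy f n : R := conductance n * (f n.+1 - f n) ^+ 2.

Lemma edge_energy_ge0 f n : 0 <= edge_energy f n.
Proof. by rewrite mulr_ge0 ?sqr_ge0// ltW// conductance_gt0. Qed.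

Lemma harmonic_local_solution (al be : R) :
  local_solution 0 (fun x => al + be * x^-1) (fun=> - be).
Proof.
split=> x x0.
  have dinv : is_derive x 1 (fun y : R => y^-1) (- x ^- 2).
    apply: is_derive_eq; first by apply: is_deriveV; rewrite gt_eqF.
    by rewrite /GRing.scale/= mulr1.
  apply: is_derive_eq (is_deriveD (is_derive_cst al x 1) (is_deriveM (is_derive_cst be x 1) dinv)) _.
  by rewrite /GRing.scale/= mulr0 addr0 add0r mulrN mulNr.
by rewrite !mul0r; exact: is_derive_cst.
Qed.

(** A finitely supported sequence extends to the half-line by the function that
    is harmonic on each cell and constant near the origin; its energy is the
    discrete one. *)
Lemma harmonic_interpolant g N : (forall n, (N <= n)%N -> g n = 0) ->
  exists u, [/\ bessel_dom u, restrN u = g &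
    wip (derive1 u) (derive1 u) <= \sum_(n < N) edge_energy g n].
Proof.
move=> gN.
pose be k : R := if k is n.+1 then conductance n * (g n - g n.+1) else 0.
pose al k : R := if k is n.+1 then g n - be k / n.+1%:R else g 0%N.
pose W k (x : R) := al k + be k * x^-1.
pose S k (x : R) := - be k.
have WS k : local_solution 0 (W k) (S k) by exact: harmonic_local_solution.
have WL k : W k.+1 k.+1%:R = g k by rewrite /W /al subrK.
have WR k : W k k.+1%:R = g k.
  case: k => [|k]; first by rewrite /W /al /be mul0r addr0.
  rewrite /W /al /be /conductance -[k.+2%:R]natr1.
  have k0 : (k.+1%:R : R) != 0 by [].
  have k1 : (k.+1%:R + 1 : R) != 0 by rewrite natr1.
  by move: (k.+1%:R) k0 k1 => x x0 x1; field; rewrite x0 x1.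
have match_W k : W k k.+1%:R = W k.+1 k.+1%:R by rewrite WR WL.
pose w := glue W.
have acw : loc_abs_continuous w by exact: glue_loc_ac WS match_W.
have wn k : w k.+1%:R = g k by rewrite /w (glueE match_W (k := k)) ?WR// ler_nat.
have green := glue_green WS match_W.
have n0 k : (0 : R) < k.+1%:R by rewrite ltr0n.
have n1 k : (k.+1%:R : R) <= k.+2%:R by rewrite ler_nat.
have inv0 n : (0 : R) < n.+1%:R^-1 by rewrite invr_gt0.
have inv1 n : (n.+1%:R^-1 : R) <= 1 by rewrite invf_le1 ?ler1n.
have cell k v := fun acv : loc_abs_continuous v => green k.+1 v k.+1%:R k.+2%:R acv (n0 k) (lexx _) (n1 k) (lexx _).
have first n v := fun acv : loc_abs_continuous v => green 0%N v n.+1%:R^-1 1 acv (inv0 n) (ltW (inv0 n)) (inv1 n) (lexx _).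
have win n v := fun acv : loc_abs_continuous v => window_split (first n v acv).1 (fun k => (cell k v acv).1).
have cellE k : 'int_(k.+1%:R, k.+2%:R) (energy_density 0 w w) = edge_energy g k.
  by rewrite (cell k w acw).2 !wn /S /be /edge_energy; ring.
have tail k : (N <= k)%N -> edge_energy g k = 0.
  by move=> Nk; rewrite /edge_energy !gN ?(leqW Nk)// subrr expr0n mulr0.
have energy_bound n : \int[leb]_(x in window n) energy_density 0 w w x <= \sum_(k < N) edge_energy g k.
  rewrite (win n w acw).2 (first n w acw).2 /S /be oppr0 !mul0r subrr add0r.
  under eq_bigr do rewrite cellE.
  have [nN|Nn] := leqP n N.
    rewrite -(subnK nN) addnC big_split_ord/= lerDl.
    by apply: sumr_ge0 => k _; exact: edge_energy_ge0.
  rewrite -(subnK (ltnW Nn)) addnC big_split_ord/= [X in _ + X]big1 ?addr0// => k _.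
  by rewrite tail// leq_addr.
have mE := measurable_energy_density 0 acw acw.
have E0 x : 0 <= energy_density 0 w w x by exact: energy_density_ge0.
have iE := window_bounded_integrable E0 mE (fun n => (win n w acw).1) energy_bound.
have cw := loc_ac_continuous acw.
have mw := measurable_continuous_half_line cw; have mdw := measurable_derive1 cw.
have EE x : energy_density 0 w w x = derive1 w x * derive1 w x * x ^+ 2.
  by rewrite /energy_density mul0r addr0.
have sdw : sqint (derive1 w).
  apply/sqintE; split; first exact: mdw.
  move: iE; apply: eq_integrable; first exact: measurable_half_line.
  by move=> x _; rewrite /= EE.
(* Outside (0, N + 1] the interpolant vanishes and near 0 it is constant. *)
have sw : sqint w.
  pose F x := w x * w x * x ^+ 2.
  have F0 x : 0 <= F x by rewrite /F -expr2 mulr_ge0 ?sqr_ge0.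
  have cF : {in half_line, continuous F}.
    apply: continuous_half_lineM; last exact: continuous_half_line_sqr.
    exact: continuous_half_lineM.
  have iF c d : 0 < c -> leb.-integrable `]c, d] (EFin \o F).
    by move=> c0; exact: continuous_integrable_oc.
  apply/sqintE; split; first exact: mw.
  apply: (@window_bounded_integrable _ F (g 0%N ^+ 2 + 'int_(1, N.+1%:R) F)).
  - exact: F0.
  - exact: measurable_continuous_half_line.
  - by move=> n; exact: iF.
  move=> n; have [_ ->] := window_split (iF _ 1 (inv0 n)) (fun k => iF _ _ (n0 k)).
  apply: lerD.
    apply: (@le_trans _ _ ('int_(n.+1%:R^-1, 1) (fun=> g 0%N ^+ 2))).
      apply: le_Rintegral => //; first exact: iF.
        by apply: continuous_integrable_oc => // x _; exact: cst_continuous.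
      move=> x /=; rewrite in_itv/= => /andP[x0 x1].
      have {}x0 : 0 < x := lt_trans (inv0 n) x0.
      rewrite /F /w (glueE match_W (k := 0))//; last exact: ltW.
      rewrite /W /al /be mul0r addr0 -expr2 -[leRHS]mulr1 ler_wpM2l ?sqr_ge0//.
      by rewrite expr_le1// ltW.
    rewrite Rintegral_cst//= lebesgue_measure_itv/= lte_fin.
    case: ifP => _; last by rewrite mulr0 sqr_ge0.
    by rewrite -EFinB/= -[leRHS]mulr1 ler_wpM2l ?sqr_ge0// gerBl ltW.
  rewrite cells_sum; last by move=> k; exact: iF.
  have cell0 k : (N <= k)%N -> 'int_(k.+1%:R, k.+2%:R) F = 0.
    move=> Nk; transitivity ('int_(k.+1%:R, k.+2%:R) (fun=> 0)); last by rewrite /Rintegral integral0.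
    apply: eq_Rintegral => x; rewrite inE/= in_itv/= => /andP[kx xk].
    rewrite /F /w (glueE match_W (k := k.+1)) ?(ltW kx)//.
    by rewrite /W /al /be !gN ?(leqW Nk)// subrr mulr0 mul0r subrr mul0r addr0 !mul0r.
  have [nN|Nn] := leqP n N.
    rewrite -(subnK nN) addnC big_split_ord/= lerDl.
    by apply: sumr_ge0 => k _; apply: Rintegral_ge0 => x _.
  rewrite -(subnK (ltnW Nn)) addnC big_split_ord/= [X in _ + X]big1 ?addr0// => k _.
  by rewrite cell0// leq_addr.
exists w; split; first exact: (bessel_domE w).2 (And3 acw sw sdw).
  by apply/funext => n; exact: wn.
have -> : wip (derive1 w) (derive1 w) = \int[leb]_(x in half_line) energy_density 0 w w x.
  by rewrite unlock; apply: eq_Rintegral => x _; rewrite EE.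
have cv := window_integral_cvg iE.
rewrite -(cvg_lim (@Rhausdorff R) cv).
apply: limr_le; first by apply/cvg_ex; eexists; exact: cv.
exact: nearW.
Qed.

Variable a : nat -> R.

(** The projection keeps the values at the integers, and these bound its
    energy from below. *)
Lemma trace_form_lam_ge lam f N : 0 < lam ->
  ((\sum_(n < N) edge_energy f n)%:E <= trace_form_lam a lam f)%E.
Proof.
move=> l0; apply: le_ereal_inf_tmp => _ [u [[bu _] <-] <-].
have [w0 [w0P w0u]] := orthogonal_interpolant l0 bu.
have [bw wu _] := projJP l0 bu w0P w0u.
set w := projJ lam u in bw wu *.
rewrite lee_fin (bessel_form_lamE lam bw bw) -wu.
apply: (le_trans (trace_energy_le N bw)).
by rewrite lerDl; apply: mulr_ge0; [rewrite mulr_ge0// ltW|exact: wip_ge0].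
Qed.

Lemma trace_form_lam_vanishes lam f : (trace_form_lam a lam f < +oo)%E ->
  forall e, 0 < e -> exists N : nat, forall n, (N <= n)%N -> `|f n| <= e.
Proof.
move=> /ereal_inf_lt[_ [u [[bu _] uf] _] _] e e0.
by have [N H] := bessel_dom_vanishes bu e0; exists N => n /H; rewrite -uf.
Qed.

(** The projection has at most the energy of the harmonic interpolant, whose
    square norm gives [C]. *)
Lemma trace_form_lam_le g N : (forall n, (N <= n)%N -> g n = 0) -> l2 a g ->
  exists2 C, 0 <= C & forall lam, 0 < lam ->
  (trace_form_lam a lam g <= (\sum_(n < N) edge_energy g n + lam * C)%:E)%E.
Proof.
move=> gN lg; have [u [bu ug Eu]] := harmonic_interpolant gN.
exists (2 * wip u u); first by rewrite mulr_ge0// wip_ge0.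
move=> lam l0; have [w0 [w0P w0u]] := orthogonal_interpolant l0 bu.
have [bw wu wle] := projJP l0 bu w0P w0u.
apply: (@le_trans _ _ (bessel_form_lam lam (projJ lam u) (projJ lam u))%:E).
  apply: ereal_inf_lbound; exists u => //; split=> //; split=> //.
  by rewrite ug.
rewrite lee_fin; apply: le_trans wle _.
rewrite (bessel_form_lamE lam bu bu); apply: lerD; first exact: Eu.
by rewrite mulrA [lam * 2]mulrC.
Qed.

End TraceFormBounds.

(** * Weighted square-summable sequences *)

Lemma cvg_le_bound (R : realType) (x : nat -> R) (l C : R) : x @ \oo --> l ->
  (\forall j \near \oo, x j <= C) -> l <= C.
Proof.
move=> xl xC; rewrite -(cvg_lim (@Rhausdorff R) xl).
by apply: limr_le => //; apply/cvg_ex; exists l.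
Qed.

Lemma cvg_norm_bound (R : realType) (x : nat -> R) (l C : R) : x @ \oo --> l ->
  (\forall j \near \oo, `|x j| <= C) -> `|l| <= C.
Proof. by move=> xl; apply: cvg_le_bound; exact: cvg_norm. Qed.

Section WeightedL2.
Context {R : realType} (a : nat -> R) (a_gt0 : forall n, 0 < a n).
Implicit Types (f g h : nat -> R) (c e : R) (F : nat -> nat -> R).

Let a_ge0 n : 0 <= a n := ltW (a_gt0 n).

Lemma l2P f : l2 a f <-> exists C, forall N, \sum_(0 <= n < N) a n * f n ^+ 2 <= C.
Proof.
have p0 n : (0 <= (a n * f n ^+ 2)%:E)%E by rewrite lee_fin mulr_ge0 ?sqr_ge0.
split=> [lf|[C HC]].
  have S0 : (0 <= \sum_(0 <= n <oo) (a n * f n ^+ 2)%:E)%E by exact: nneseries_ge0.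
  exists (fine (\sum_(0 <= n <oo) (a n * f n ^+ 2)%:E)%E) => N.
  rewrite -lee_fin fineK ?ge0_fin_numE// -sumEFin.
  by apply: nneseries_lim_ge => *.
apply: (@le_lt_trans _ _ C%:E); last exact: ltry.
apply: lime_le; first exact: is_cvg_nneseries.
by apply: nearW => N; rewrite sumEFin lee_fin.
Qed.

Lemma series_bounded_cvg (u : nat -> R) C : (forall n, 0 <= u n) ->
  (forall N, \sum_(0 <= n < N) u n <= C) -> cvgn (series u).
Proof.
move=> u0 uC; apply: nondecreasing_is_cvgn; first exact: nondecreasing_series.
by exists C => _ [N _ <-]; exact: uC.
Qed.

Lemma series_dominated_cvg (u v : nat -> R) : (forall n, `|u n| <= v n) ->
  cvgn (series v) -> cvgn (series u).
Proof.
move=> uv cv; apply: normed_cvg; apply: series_le_cvg cv => //.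
- by move=> n /=; exact: normr_ge0.
- by move=> n; exact: le_trans (normr_ge0 _) (uv n).
Qed.

Lemma series_le_lim (u : nat -> R) N : (forall n, 0 <= u n) -> cvgn (series u) ->
  \sum_(0 <= n < N) u n <= limn (series u).
Proof.
by move=> u0 cu; apply: (nondecreasing_cvgn_le _ cu N); exact: nondecreasing_series.
Qed.

Lemma l2_cvg_sqr f : l2 a f -> cvgn (series (fun n => a n * f n ^+ 2)).
Proof.
move=> /l2P[C HC]; apply: series_bounded_cvg HC => n.
by rewrite mulr_ge0 ?sqr_ge0.
Qed.

Lemma l2_cvg f g : l2 a f -> l2 a g -> cvgn (series (fun n => a n * f n * g n)).
Proof.
move=> lf lg.
apply: (@series_dominated_cvg _ (fun n => a n * f n ^+ 2 + a n * g n ^+ 2)).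
  move=> n; rewrite -mulrA -mulrDr normrM ger0_norm// ler_wpM2l// ler_norml.
  have := sqr_ge0 (f n + g n); have := sqr_ge0 (f n - g n).
  have := sqr_ge0 (f n); have := sqr_ge0 (g n).
  by rewrite !expr2 => *; apply/andP; split; lra.
rewrite (_ : series _ = series (fun n => a n * f n ^+ 2) + series (fun n => a n * g n ^+ 2)).
  by apply: is_cvgD; exact: l2_cvg_sqr.
by apply/funext => n; rewrite /series/= fctE big_split.
Qed.

Lemma l2_inner_cvg f g : l2 a f -> l2 a g ->
  series (fun n => a n * f n * g n) @ \oo --> l2_inner a f g.
Proof. exact: l2_cvg. Qed.

Lemma l2_lin c f g : l2 a f -> l2 a g -> l2 a (c *: f + g).
Proof.
move=> /l2P[C HC] /l2P[D HD]; apply/l2P; exists (2 * c ^+ 2 * C + 2 * D) => N.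
apply: (@le_trans _ _ (2 * c ^+ 2 * \sum_(0 <= n < N) a n * f n ^+ 2 + 2 * \sum_(0 <= n < N) a n * g n ^+ 2)).
  rewrite !mulr_sumr -big_split; apply: ler_sum => n _ /=.
  rewrite !fctE /GRing.scale/=.
  have := mulr_ge0 (a_ge0 n) (sqr_ge0 (c * f n - g n)); rewrite !expr2; lra.
by apply: lerD; rewrite ler_wpM2l// mulr_ge0 ?sqr_ge0.
Qed.

Lemma l2_0 : l2 a 0.
Proof.
by apply/l2P; exists 0 => N; rewrite big1// => n _; rewrite expr0n mulr0.
Qed.

Lemma l2Z c f : l2 a f -> l2 a (c *: f).
Proof. by move=> lf; rewrite -[c *: f]addr0; exact: l2_lin l2_0. Qed.

Lemma l2D f g : l2 a f -> l2 a g -> l2 a (f + g).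
Proof. by move=> lf lg; rewrite -[f]scale1r; exact: l2_lin. Qed.

Lemma l2N f : l2 a f -> l2 a (- f).
Proof. by move=> lf; rewrite -scaleN1r; exact: l2Z. Qed.

Lemma l2B f g : l2 a f -> l2 a g -> l2 a (f - g).
Proof. by move=> lf lg; apply: l2D => //; exact: l2N. Qed.

Lemma l2_le f g : (forall n, `|f n| <= `|g n|) -> l2 a g -> l2 a f.
Proof.
move=> fg /l2P[C HC]; apply/l2P; exists C => N; apply: le_trans (HC N).
apply: ler_sum => n _; rewrite ler_wpM2l//.
by rewrite -[f n ^+ 2]real_normK ?num_real// -[g n ^+ 2]real_normK ?num_real// ler_sqr ?nnegrE.
Qed.

Lemma l2_fin f N : (forall n, (N <= n)%N -> f n = 0) -> l2 a f.
Proof.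
move=> fN; apply/l2P; exists (\sum_(0 <= n < N) a n * f n ^+ 2) => M.
have [MN|NM] := leqP M N.
  rewrite (big_cat_nat (leq0n M) MN)/= lerDl sumr_ge0// => n _.
  by rewrite mulr_ge0 ?sqr_ge0.
rewrite (big_cat_nat (leq0n N) (ltnW NM))/= [X in _ + X](_ : _ = 0) ?addr0//.
by rewrite big_nat big1// => n /andP[Nn _]; rewrite fN// expr0n mulr0.
Qed.

Lemma l2_innerC f g : l2_inner a f g = l2_inner a g f.
Proof.
by rewrite /l2_inner; congr (limn (series _)); apply/funext => n; rewrite mulrAC.
Qed.

Lemma l2_inner_linl c f g h : l2 a f -> l2 a g -> l2 a h ->
  l2_inner a (c *: f + g) h = c * l2_inner a f h + l2_inner a g h.
Proof.
move=> lf lg lh; apply: cvg_lim; first exact: Rhausdorff.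
have -> : series (fun n => a n * (c *: f + g) n * h n) =
    (fun N => c * series (fun n => a n * f n * h n) N + series (fun n => a n * g n * h n) N).
  apply/funext => N; rewrite /series/= mulr_sumr -big_split; apply: eq_bigr => n _ /=.
  by rewrite !fctE /GRing.scale/=; ring.
by apply: cvgD; [apply: cvgMr|]; exact: l2_inner_cvg.
Qed.

Lemma l2_inner0l h : l2_inner a 0 h = 0.
Proof.
rewrite /l2_inner (_ : (fun n => _) = (fun=> 0)); last by apply/funext => n; rewrite mulr0 mul0r.
apply: cvg_lim; first exact: Rhausdorff.
by rewrite (_ : series _ = cst 0); [exact: cvg_cst|apply/funext => N; rewrite /series/= big1].
Qed.

Lemma l2_innerZl c f h : l2 a f -> l2 a h -> l2_inner a (c *: f) h = c * l2_inner a f h.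
Proof.
by move=> lf lh; rewrite -[c *: f]addr0 l2_inner_linl ?l2_inner0l ?addr0//; exact: l2_0.
Qed.

Lemma l2_innerDl f g h : l2 a f -> l2 a g -> l2 a h ->
  l2_inner a (f + g) h = l2_inner a f h + l2_inner a g h.
Proof. by move=> lf lg lh; rewrite -[f]scale1r l2_inner_linl// mul1r scale1r. Qed.

Lemma l2_innerBl f g h : l2 a f -> l2 a g -> l2 a h ->
  l2_inner a (f - g) h = l2_inner a f h - l2_inner a g h.
Proof.
move=> lf lg lh; rewrite l2_innerDl//; last exact: l2N.
by rewrite -scaleN1r l2_innerZl// mulN1r.
Qed.

Lemma l2_innerDr f g h : l2 a f -> l2 a g -> l2 a h ->
  l2_inner a h (f + g) = l2_inner a h f + l2_inner a h g.
Proof. by move=> *; rewrite l2_innerC l2_innerDl// ![l2_inner a _ h]l2_innerC. Qed.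

Lemma l2_innerBr f g h : l2 a f -> l2 a g -> l2 a h ->
  l2_inner a h (f - g) = l2_inner a h f - l2_inner a h g.
Proof. by move=> *; rewrite l2_innerC l2_innerBl// ![l2_inner a _ h]l2_innerC. Qed.

Lemma l2_innerZr c f h : l2 a f -> l2 a h -> l2_inner a h (c *: f) = c * l2_inner a h f.
Proof. by move=> *; rewrite l2_innerC l2_innerZl// l2_innerC. Qed.

Lemma l2_innerE f : l2_inner a f f = limn (series (fun n => a n * f n ^+ 2)).
Proof. by rewrite /l2_inner; congr (limn (series _)); apply/funext => n; rewrite -mulrA. Qed.

Lemma l2_partial_le f N : l2 a f -> \sum_(0 <= n < N) a n * f n ^+ 2 <= l2_inner a f f.
Proof.
move=> lf; rewrite l2_innerE; apply: series_le_lim; last exact: l2_cvg_sqr.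
by move=> n; rewrite mulr_ge0 ?sqr_ge0.
Qed.

Lemma l2_inner_le f C : l2 a f -> (forall N, \sum_(0 <= n < N) a n * f n ^+ 2 <= C) ->
  l2_inner a f f <= C.
Proof.
move=> lf HC; rewrite l2_innerE; apply: limr_le; first exact: l2_cvg_sqr.
by apply: nearW => N; exact: HC.
Qed.

Lemma l2_inner_ge0 f : l2 a f -> 0 <= l2_inner a f f.
Proof. by move=> /(l2_partial_le 0); rewrite big_geq. Qed.

Lemma l2_point_le f n : l2 a f -> a n * f n ^+ 2 <= l2_inner a f f.
Proof.
move=> lf; apply: le_trans (l2_partial_le n.+1 lf).
rewrite big_nat_recr//= lerDr sumr_ge0// => i _.
by rewrite mulr_ge0 ?sqr_ge0.
Qed.

Lemma l2_norm_ge0 f : 0 <= l2_norm a f.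
Proof. exact: sqrtr_ge0. Qed.

Lemma l2_normK f : l2 a f -> l2_norm a f ^+ 2 = l2_inner a f f.
Proof. by move=> lf; rewrite sqr_sqrtr// l2_inner_ge0. Qed.

Lemma l2_CauchySchwarz f g : l2 a f -> l2 a g ->
  `|l2_inner a f g| <= l2_norm a f * l2_norm a g.
Proof.
move=> lf lg; set A := l2_inner a f f; set B := l2_inner a g g; set C := l2_inner a f g.
have A0 : 0 <= A by exact: l2_inner_ge0.
have B0 : 0 <= B by exact: l2_inner_ge0.
have quad t : 0 <= t ^+ 2 * A + 2 * t * C + B.
  have ltf : l2 a (t *: f) by exact: l2Z.
  have <- : l2_inner a (t *: f + g) (t *: f + g) = t ^+ 2 * A + 2 * t * C + B.
    rewrite l2_innerDl//; last exact: l2D.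
    rewrite !l2_innerDr// !l2_innerZl// !l2_innerZr// -/A -/B -/C (l2_innerC g f) -/C.
    by ring.
  exact: l2_inner_ge0 (l2D ltf lg).
rewrite /l2_norm -/A -/B -sqrtrM// -[`|C|]ger0_norm// -sqrtr_sqr ler_wsqrtr//.
rewrite real_normK ?num_real//.
have [A00|An0] := eqVneq A 0.
  rewrite A00 mul0r.
  have [->|C0] := eqVneq C 0; first by rewrite expr0n.
  have := quad (- (B + 1) / (2 * C)); rewrite A00 mulr0 add0r.
  have -> : 2 * (- (B + 1) / (2 * C)) * C + B = - 1 by field.
  by rewrite oppr_ge0 ler10.
have A1 : 0 < A by rewrite lt_neqAle eq_sym An0.
have := quad (- C / A).
have -> : (- C / A) ^+ 2 * A + 2 * (- C / A) * C + B = (A * B - C ^+ 2) / A by field.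
by rewrite pmulr_lge0 ?invr_gt0// subr_ge0.
Qed.

Lemma l2_normD f g : l2 a f -> l2 a g -> l2_norm a (f + g) <= l2_norm a f + l2_norm a g.
Proof.
move=> lf lg; have lfg := l2D lf lg.
rewrite -(ler_sqr (x := l2_norm a (f + g))) ?nnegrE ?addr_ge0 ?l2_norm_ge0//.
rewrite l2_normK// l2_innerDl// !l2_innerDr// sqrrD !l2_normK// (l2_innerC g f).
have := le_trans (ler_norm _) (l2_CauchySchwarz lf lg).
by rewrite -mulr_natr; lra.
Qed.

Lemma l2_normZ c f : l2 a f -> l2_norm a (c *: f) = `|c| * l2_norm a f.
Proof.
move=> lf; rewrite /l2_norm l2_innerZl ?l2_innerZr//; last exact: l2Z.
by rewrite mulrA -expr2 sqrtrM ?sqr_ge0// sqrtr_sqr.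
Qed.

Lemma l2_normN f : l2 a f -> l2_norm a (- f) = l2_norm a f.
Proof. by move=> lf; rewrite -scaleN1r l2_normZ// normrN1 mul1r. Qed.

Lemma l2_distC f g : l2 a f -> l2 a g -> l2_norm a (f - g) = l2_norm a (g - f).
Proof. by move=> lf lg; rewrite -opprB l2_normN//; exact: l2B. Qed.

Lemma l2_normB f g : l2 a f -> l2 a g -> l2_norm a (f - g) <= l2_norm a f + l2_norm a g.
Proof. by move=> lf lg; rewrite -(l2_normN lg) l2_normD//; exact: l2N. Qed.

Lemma l2_norm_triangle h f g : l2 a f -> l2 a g -> l2 a h ->
  l2_norm a (f - g) <= l2_norm a (f - h) + l2_norm a (h - g).
Proof.
move=> lf lg lh; rewrite (_ : f - g = (f - h) + (h - g)); last by rewrite addrA subrK.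
by apply: l2_normD; exact: l2B.
Qed.

Lemma l2_norm0 : l2_norm a 0 = 0.
Proof. by rewrite /l2_norm l2_inner0l sqrtr0. Qed.

Lemma l2_norm_eq0 f : l2 a f -> l2_norm a f = 0 -> f = 0.
Proof.
move=> lf f0; apply/funext => n; apply/eqP; rewrite -sqrf_eq0.
have := l2_point_le n lf; rewrite -l2_normK// f0 expr0n /=.
rewrite (pmulr_rle0 _ (a_gt0 n)) => h.
by apply/eqP/le_anti; rewrite h sqr_ge0.
Qed.

Definition unit_seq (n : nat) : nat -> R := fun k => (k == n)%:R.

Lemma l2_unit n : l2 a (unit_seq n).
Proof. by apply: (@l2_fin _ n.+1) => k nk; rewrite /unit_seq gtn_eqF. Qed.

Lemma l2_inner_fin f g N : (forall n, (N <= n)%N -> g n = 0) ->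
  l2_inner a f g = \sum_(0 <= n < N) a n * f n * g n.
Proof.
move=> gN; apply: cvg_lim; first exact: Rhausdorff.
apply: cvg_near_cst; near=> M; rewrite /series/=.
have NM : (N <= M)%N by near: M; exact: nbhs_infty_ge.
rewrite (big_cat_nat (leq0n N) NM)/= [X in _ + X](_ : _ = 0) ?addr0//.
by rewrite big_nat big1// => n /andP[Nn _]; rewrite gN// mulr0.
Unshelve. all: by end_near. Qed.

Lemma l2_inner_unit f n : l2_inner a f (unit_seq n) = a n * f n.
Proof.
rewrite (@l2_inner_fin _ _ n.+1); last by move=> k nk; rewrite /unit_seq gtn_eqF.
rewrite big_nat_recr//= /unit_seq eqxx mulr1 big_nat big1 ?add0r// => k /andP[_ kn].
by rewrite ltn_eqF// mulr0.
Qed.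

Lemma cvg_sum_nat (X : nat -> nat -> R) (Y : nat -> R) N :
  (forall n, X j n @[j --> \oo] --> Y n) ->
  \sum_(0 <= n < N) X j n @[j --> \oo] --> \sum_(0 <= n < N) Y n.
Proof.
move=> XY; elim: N => [|N IH].
  by rewrite big_geq//; under eq_fun do rewrite big_geq//; exact: cvg_cst.
rewrite big_nat_recr//=; under eq_fun do rewrite big_nat_recr//=.
exact: cvgD.
Qed.

(** Fatou's lemma for sequences. *)
Lemma l2_fatou F f C : (forall n, F j n @[j --> \oo] --> f n) ->
  (\forall j \near \oo, l2 a (F j) /\ l2_inner a (F j) (F j) <= C) ->
  l2 a f /\ l2_inner a f f <= C.
Proof.
move=> Ff FC.
have H N : \sum_(0 <= n < N) a n * f n ^+ 2 <= C.
  have cv : \sum_(0 <= n < N) a n * F j n ^+ 2 @[j --> \oo] --> \sum_(0 <= n < N) a n * f n ^+ 2.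
    apply: cvg_sum_nat => n; apply: cvgMr.
    by apply: (@cvgM _ _ _ _ (F ^~ n) (F ^~ n)); exact: Ff.
  apply: (cvg_le_bound cv).
  by apply: filterS FC => j [lF]; apply: le_trans; exact: l2_partial_le.
have lf : l2 a f by apply/l2P; exists C.
by split=> //; exact: l2_inner_le.
Qed.

(** Dominated convergence for series. *)
Lemma tannery (X : nat -> nat -> R) (Y B : nat -> R) :
  (forall n, X j n @[j --> \oo] --> Y n) -> (forall j n, `|X j n| <= B n) ->
  cvgn (series B) -> limn (series (X j)) @[j --> \oo] --> limn (series Y).
Proof.
move=> XY XB cB.
have B0 n : 0 <= B n by exact: le_trans (normr_ge0 _) (XB 0%N n).
have YB n : `|Y n| <= B n.
  by apply: cvg_norm_bound (XY n) _; exact: nearW.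
have cX j : cvgn (series (X j)) by exact: series_dominated_cvg (XB j) cB.
have cY : cvgn (series Y) by exact: series_dominated_cvg YB cB.
have tail (Z : nat -> R) N : (forall n, `|Z n| <= B n) -> cvgn (series Z) ->
    `|limn (series Z) - series Z N| <= limn (series B) - series B N.
  move=> ZB cZ.
  have c2 : (series Z M - series Z N) @[M --> \oo] --> limn (series Z) - series Z N.
    by apply: cvgB => //; exact: cvg_cst.
  apply: (cvg_norm_bound c2); near=> M.
  have NM : (N <= M)%N by near: M; exact: nbhs_infty_ge.
  rewrite sub_series_geq//; apply: le_trans (ler_norm_sum _ _ _) _.
  apply: (@le_trans _ _ (\sum_(N <= k < M) B k)); first exact: ler_sum.
  rewrite -sub_series_geq// lerB//; apply: series_le_lim => //.
apply/cvgrPdist_le => e e0.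
have e30 : 0 < e / 3 by rewrite divr_gt0.
have [N hN] : exists N, limn (series B) - series B N <= e / 3.
  have /cvgrPdist_le /(_ _ e30) [N _ /(_ N (leqnn N))] := (cB : series B @ \oo --> limn (series B)).
  by move=> /(le_trans (ler_norm _)); exists N.
have cN : series (X j) N @[j --> \oo] --> series Y N.
  exact: cvg_sum_nat.
have /cvgrPdist_le /(_ _ e30) := cN; apply: filterS => j hj.
have h1 := le_trans (tail _ N YB cY) hN; have h2 := le_trans (tail _ N (XB j) (cX j)) hN.
move: hj h1 h2; move: (limn _) (limn _) (series Y N) (series (X j) N) => x y z t.
by rewrite !ler_norml => /andP[? ?] /andP[? ?] /andP[? ?]; apply/andP; split; lra.
Unshelve. all: by end_near. Qed.

Lemma l2_dominated F f g : (forall n, F j n @[j --> \oo] --> f n) ->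
  (forall j n, `|F j n| <= `|g n|) -> l2 a g -> l2_norm a (F j - f) @[j --> \oo] --> (0 : R).
Proof.
move=> Ff Fg lg.
have fg n : `|f n| <= `|g n|.
  by apply: cvg_norm_bound (Ff n) _; exact: nearW.
have cv : limn (series (fun n => a n * (F j - f) n ^+ 2)) @[j --> \oo] --> limn (series (fun=> 0 : R)).
  apply: (@tannery _ _ (fun n => 4 * (a n * g n ^+ 2))).
  - move=> n; rewrite -[X in _ --> X](mulr0 (a n)); apply: cvgMr.
    have c1 : F j n - f n @[j --> \oo] --> (0 : R).
      by rewrite -(subrr (f n)); apply: cvgB; [exact: Ff|exact: cvg_cst].
    have c2 := cvgM c1 c1; rewrite mulr0 in c2; exact: c2.
  - move=> j n; rewrite normrM (ger0_norm (a_ge0 n)) mulrCA ler_wpM2l//.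
    rewrite normrX -[4](_ : 2 ^+ 2 = 4); last by rewrite -natrX.
    rewrite -[g n ^+ 2]real_normK ?num_real// -exprMn ler_sqr ?nnegrE ?mulr_ge0//.
    apply: le_trans (ler_normB _ _) _; rewrite mulr2n mulrDl mul1r.
    exact: lerD.
  - apply: (@series_bounded_cvg _ (4 * l2_inner a g g)).
      by move=> n; apply: mulr_ge0 => //; apply: mulr_ge0 => //; exact: sqr_ge0.
    by move=> N; rewrite -mulr_sumr ler_wpM2l// l2_partial_le.
have -> : (fun j => l2_norm a (F j - f)) = (fun j => Num.sqrt (limn (series (fun n => a n * (F j - f) n ^+ 2)))).
  by apply/funext => j; rewrite /l2_norm l2_innerE.
have z : limn (series (fun=> 0 : R)) = 0.
  apply: cvg_lim; first exact: Rhausdorff.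
  by rewrite (_ : series _ = cst 0); [exact: cvg_cst|apply/funext => N; rewrite /series/= big1].
rewrite z in cv; rewrite -[X in _ --> X]sqrtr0.
by apply: cvg_comp cv _; exact: sqrt_continuous.
Qed.

End WeightedL2.

(** * Limits inferior and superior *)

Section ExtendedLimits.
Context {R : realType}.
Implicit Types (u : nat -> \bar R).

Lemma limn_einf_le_esup u : (limn_einf u <= limn_esup u)%E.
Proof.
rewrite limn_einf_lim limn_esup_lim; apply: lee_lim.
- exact: is_cvg_einfs.
- exact: is_cvg_esups.
- by apply: nearW => n; exact: einfs_le_esups.
Qed.

Lemma limn_einf_frequently u x : (limn_einf u < x)%E ->
  forall N, exists2 j, (N <= j)%N & (u j < x)%E.
Proof.
move=> ux N; have : (einfs u N < x)%E.
  apply: le_lt_trans ux; rewrite limn_einf_lim.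
  by apply: lime_ge; [exact: is_cvg_einfs|near=> n; apply: nondecreasing_einfs; near: n; exact: nbhs_infty_ge].
by move=> /ereal_inf_lt[_ [j /= Nj <-] ujx]; exists j.
Unshelve. all: by end_near. Qed.

Lemma limn_esup_le_near u x : (\forall j \near \oo, (u j <= x)%E) -> (limn_esup u <= x)%E.
Proof.
move=> [N _ uN]; rewrite limn_esup_lim.
apply: lime_le; first exact: is_cvg_esups.
near=> n; apply: ge_ereal_sup => _ [j /= nj <-]; apply: uN => /=.
by apply: leq_trans nj; near: n; exact: nbhs_infty_ge.
Unshelve. all: by end_near. Qed.

(** Extraction along a diagonal. *)
Lemma diagonal_cvg0 (x : nat -> nat -> R) : (forall K, x K j @[j --> \oo] --> (0 : R)) ->
  exists k : nat -> nat, forall K, \forall j \near \oo,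
    (K <= k j)%N /\ x (k j) j <= K.+1%:R^-1.
Proof.
move=> x0.
have /choice[J JP] : forall K, exists J, forall j, (J <= j)%N -> x K j <= K.+1%:R^-1.
  move=> K; have e0 : (0 : R) < K.+1%:R^-1 by rewrite invr_gt0.
  have /cvgrPdist_le /(_ _ e0) [N _ NP] := x0 K; exists N => j Nj.
  by have := NP j Nj; rewrite sub0r normrN; apply: le_trans (ler_norm _).
pose P j (i : 'I_j.+1) := (J i <= j)%N.
exists (fun j => \max_(i < j.+1 | P j i) i) => K.
near=> j.
have Kj : (K < j.+1)%N by rewrite ltnS; near: j; exact: nbhs_infty_ge.
have PK : P j (Ordinal Kj) by rewrite /P /=; near: j; exact: nbhs_infty_ge.
have Kk : (K <= \max_(i < j.+1 | P j i) i)%N by exact: (@leq_bigmax_cond _ (P j) (fun i => i : nat) _ PK).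
split=> //.
have [|i Pi Ei] := @eq_bigmax_cond _ (P j) (fun i => i : nat).
  by apply/card_gt0P; exists (Ordinal Kj).
rewrite Ei in Kk *; apply: le_trans (JP i j Pi) _.
by rewrite lef_pV2 ?posrE// ler_nat ltnS.
Unshelve. all: by end_near. Qed.

End ExtendedLimits.

(** * The trace form *)

Section TraceForm.
Context {R : realType} (a : nat -> R) (a_gt0 : forall n, 0 < a n).
Implicit Types (f g v : nat -> R) (e c lam : R).

Local Notation b := (@conductance R).
Let b_gt0 := @conductance_gt0 R.

Definition increment f : nat -> R := fun n => f n.+1 - f n.

(** The values at the integers of a function in the Bessel space tend to 0, also
    when the weights [a] are summable and square-summability does not force it. *)
Definition trace_dom f := [/\ l2 a f, l2 b (increment f) & f @ \oo --> (0 : R)].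

Definition energy f g : R := l2_inner b (increment f) (increment g).

Definition discrete_form f : \bar R :=
  if `[< trace_dom f >] then (energy f f)%:E else +oo%E.

Lemma discrete_formE f : trace_dom f -> discrete_form f = (energy f f)%:E.
Proof. by move=> df; rewrite /discrete_form asboolT. Qed.

Lemma discrete_form_lty f : (discrete_form f < +oo)%E <-> trace_dom f.
Proof.
split=> [|df]; last by rewrite discrete_formE// ltry.
by rewrite /discrete_form; case: asboolP => //; rewrite ltxx.
Qed.

Lemma increment_lin c f g : increment (c *: f + g) = c *: increment f + increment g.
Proof. by apply/funext => n; rewrite /increment !fctE /GRing.scale/=; ring. Qed.

Lemma energy_partial f N : \sum_(0 <= n < N) b n * increment f n ^+ 2 = \sum_(n < N) edge_energy f n.
Proof. by rewrite big_mkord. Qed.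

Lemma sum_inv_conductance n M : (n <= M)%N ->
  \sum_(n <= k < M) (b k)^-1 = n.+1%:R^-1 - M.+1%:R^-1.
Proof.
elim: M => [|M IH]; first by rewrite leqn0 => /eqP ->; rewrite big_geq// subrr.
rewrite leq_eqVlt => /predU1P[->|]; first by rewrite big_geq// subrr.
rewrite ltnS => nM; rewrite big_nat_recr//= IH// /conductance -[M.+2%:R]natr1.
rewrite -inv_sub_succ ?natr1//; ring.
Qed.

(** Cauchy-Schwarz along the path from [n] to [M], whose resistance is
    [1/(n+1) - 1/(M+1)]. *)
Lemma increment_sqr_le f C n M : (n <= M)%N ->
  (forall N, \sum_(i < N) edge_energy f i <= C) -> (f M - f n) ^+ 2 <= C / n.+1%:R.
Proof.
move=> nM fC.
have lf : l2 b (increment f) by apply/(l2P b_gt0); exists C => N; rewrite energy_partial.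
pose g k := if (n <= k < M)%N then (b k)^-1 else 0.
have gM k : (M <= k)%N -> g k = 0 by move=> Mk; rewrite /g [(k < M)%N]ltnNge Mk andbF.
have lg : l2 b g by exact: l2_fin gM.
have range_sum (F : nat -> R) : \sum_(0 <= k < M) (if (n <= k < M)%N then F k else 0) = \sum_(n <= k < M) F k.
  rewrite (big_cat_nat (leq0n n) nM)/= big_nat big1 ?add0r.
    by rewrite big_nat [RHS]big_nat; apply: eq_bigr => k ->.
  by move=> k /andP[_ kn]; rewrite leqNgt kn.
have E1 : l2_inner b (increment f) g = f M - f n.
  rewrite (l2_inner_fin _ _ gM) -(telescope_sumr f nM) -range_sum.
  apply: eq_bigr => k _; rewrite /g; case: ifP => _; last by rewrite mulr0.
  by rewrite mulrAC divff ?mul1r// gt_eqF.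
have E2 : l2_inner b g g = n.+1%:R^-1 - M.+1%:R^-1.
  rewrite (l2_inner_fin _ _ gM) -sum_inv_conductance// -range_sum.
  apply: eq_bigr => k _; rewrite /g; case: ifP => _; last by rewrite mulr0.
  by rewrite divff ?mul1r// gt_eqF.
have := l2_CauchySchwarz b_gt0 lf lg; rewrite E1 => CS.
have : `|f M - f n| ^+ 2 <= (l2_norm b (increment f) * l2_norm b g) ^+ 2.
  by rewrite ler_sqr ?nnegrE ?mulr_ge0 ?l2_norm_ge0.
rewrite real_normK ?num_real// exprMn !l2_normK// E2 => h; apply: le_trans h _.
have fC' : l2_inner b (increment f) (increment f) <= C.
  by apply: l2_inner_le => // N; rewrite energy_partial.
have f0 := l2_inner_ge0 b_gt0 lf.
apply: ler_pM => //; first by rewrite subr_ge0 lef_pV2 ?posrE// ler_nat ltnS.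
by rewrite gerBl invr_ge0.
Qed.

Lemma vanishing_sqr_le f C n : f @ \oo --> (0 : R) ->
  (forall N, \sum_(i < N) edge_energy f i <= C) -> f n ^+ 2 <= C / n.+1%:R.
Proof.
move=> f0 fC.
have c : (f M - f n) ^+ 2 @[M --> \oo] --> f n ^+ 2.
  have c1 : f M - f n @[M --> \oo] --> 0 - f n by apply: cvgB => //; exact: cvg_cst.
  have c2 := cvgM c1 c1; have -> : f n ^+ 2 = (0 - f n) * (0 - f n) by ring.
  exact: c2.
apply: (cvg_le_bound c); near=> M; apply: increment_sqr_le => //.
by near: M; exact: nbhs_infty_ge.
Unshelve. all: by end_near. Qed.

Lemma vanishes_of_sqr_le f C : (forall n, f n ^+ 2 <= C / n.+1%:R) -> f @ \oo --> (0 : R).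
Proof.
move=> H; apply/cvgrPdist_le => e e0.
have C0 : 0 <= C by have := H 0%N; rewrite divr1; apply: le_trans; exact: sqr_ge0.
near=> n; rewrite sub0r normrN -(@ler_pXn2r _ 2)// ?nnegrE ?(ltW e0)// real_normK ?num_real//.
apply: le_trans (H n) _; rewrite ler_pdivrMr// -ler_pdivrMl ?exprn_gt0//.
apply: ltW; apply: (@lt_trans _ _ n%:R); last by rewrite ltr_nat.
by near: n; exact: nbhs_infty_gtr.
Unshelve. all: by end_near. Qed.

Lemma trace_dom_bound f C : l2 a f -> f @ \oo --> (0 : R) ->
  (forall N, \sum_(i < N) edge_energy f i <= C) -> trace_dom f /\ energy f f <= C.
Proof.
move=> lf f0 fC.
have lf' : l2 b (increment f) by apply/(l2P b_gt0); exists C => N; rewrite energy_partial.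
by split=> //; apply: l2_inner_le => // N; rewrite energy_partial.
Qed.

Lemma energy_partial_le f N : l2 b (increment f) -> \sum_(i < N) edge_energy f i <= energy f f.
Proof. by move=> lf; rewrite -energy_partial; exact: l2_partial_le. Qed.

(** Lower semicontinuity of the discrete form along pointwise convergence;
    vanishing at infinity survives because it is quantified by the energy. *)
Lemma trace_dom_fatou (F : nat -> nat -> R) f C : l2 a f ->
  (forall n, F j n @[j --> \oo] --> f n) ->
  (forall j, F j @ \oo --> (0 : R)) ->
  (forall j N, \sum_(i < N) edge_energy (F j) i <= C) ->
  trace_dom f /\ energy f f <= C.
Proof.
move=> lf Ff F0 FC; apply: trace_dom_bound => //.
  apply: (@vanishes_of_sqr_le _ C) => n.
  have c : F j n ^+ 2 @[j --> \oo] --> f n ^+ 2 by exact: (cvgM (Ff n) (Ff n)).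
  by apply: (cvg_le_bound c); apply: nearW => j; exact: (vanishing_sqr_le n (F0 j) (FC j)).
move=> N; rewrite -energy_partial.
have c : \sum_(0 <= n < N) b n * increment (F j) n ^+ 2 @[j --> \oo] --> \sum_(0 <= n < N) b n * increment f n ^+ 2.
  apply: (@cvg_sum_nat _ (fun j n => b n * increment (F j) n ^+ 2)) => n; apply: cvgMr.
  have c1 : increment (F j) n @[j --> \oo] --> increment f n by apply: cvgB; exact: Ff.
  exact: (cvgM c1 c1).
by apply: (cvg_le_bound c); apply: nearW => j; rewrite energy_partial.
Qed.

(** * Truncation *)

(** Cutting the values instead of the index set: unlike a cutoff at a large
    index, this contraction of the values does not increase the energy. *)
Definition soft_threshold e (x : R) := Num.max (x - e) 0 + Num.min (x + e) 0.

Lemma soft_threshold_dist e x y : 0 <= e ->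
  `|soft_threshold e x - soft_threshold e y| <= `|x - y|.
Proof.
move=> e0; rewrite /soft_threshold /Num.max /Num.min.
by do 4 case: ifPn; rewrite -?leNgt => *; rewrite ler_norml; apply/andP; split;
  have := ler_norm (x - y); have := ler_norm (y - x); rewrite [`|y - x|]distrC => *; lra.
Qed.

Lemma soft_threshold_eq0 e x : 0 <= e -> `|x| <= e -> soft_threshold e x = 0.
Proof.
move=> e0; rewrite ler_norml => /andP[? ?]; rewrite /soft_threshold /Num.max /Num.min.
by do 2 case: ifPn; rewrite -?leNgt => *; lra.
Qed.

Lemma soft_threshold_near e x : 0 <= e -> `|x - soft_threshold e x| <= e.
Proof.
move=> e0; rewrite /soft_threshold /Num.max /Num.min.
by do 2 case: ifPn; rewrite -?leNgt => *; rewrite ler_norml; apply/andP; split; lra.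
Qed.

Definition truncation f k : nat -> R := fun n => soft_threshold k.+1%:R^-1 (f n).

Let inv_ge0 k : (0 : R) <= k.+1%:R^-1. Proof. by rewrite invr_ge0. Qed.

Lemma truncation_fin f k : f @ \oo --> (0 : R) ->
  exists N, forall n, (N <= n)%N -> truncation f k n = 0.
Proof.
move=> /cvgrPdist_le f0; have k0 : (0 : R) < k.+1%:R^-1 by rewrite invr_gt0.
have [N _ NP] := f0 _ k0; exists N => n Nn; apply: soft_threshold_eq0 => //.
by have := NP n Nn; rewrite sub0r normrN.
Qed.

Lemma truncation_cvg f n : truncation f k n @[k --> \oo] --> f n.
Proof.
apply/cvgrPdist_le => e e0; near=> k; apply: le_trans (soft_threshold_near _ _) _ => //.
by apply: ltW; near: k; exact: near_infty_natSinv_lt (PosNum e0).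
Unshelve. all: by end_near. Qed.

Lemma truncation_le f k n : `|truncation f k n| <= `|f n|.
Proof.
have := soft_threshold_dist (f n) 0 (inv_ge0 k).
by rewrite [soft_threshold _ 0]soft_threshold_eq0 ?normr0// !subr0.
Qed.

Lemma truncation_increment f k n : `|increment (truncation f k) n| <= `|increment f n|.
Proof. exact: soft_threshold_dist. Qed.

Lemma truncation_edge f k N : \sum_(i < N) edge_energy (truncation f k) i <= \sum_(i < N) edge_energy f i.
Proof.
apply: ler_sum => i _; rewrite /edge_energy ler_wpM2l ?(ltW (b_gt0 _))//.
rewrite -[leLHS]real_normK ?num_real// -[leRHS]real_normK ?num_real// ler_sqr ?nnegrE//.
exact: truncation_increment.
Qed.

Lemma truncation_l2_cvg f : l2 a f -> l2_norm a (truncation f k - f) @[k --> \oo] --> (0 : R).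
Proof.
move=> lf.
exact: (l2_dominated a_gt0 (@truncation_cvg f) (truncation_le f) lf).
Qed.

(** * Mosco convergence *)

Lemma l2_weak_pointwise (F : nat -> nat -> R) f n : l2_weak_cvg a F f -> F j n @[j --> \oo] --> f n.
Proof.
move=> /(_ _ (l2_unit a_gt0 n)); under eq_fun do rewrite l2_inner_unit.
rewrite l2_inner_unit => c.
have : (a n)^-1 * (a n * F j n) @[j --> \oo] --> (a n)^-1 * (a n * f n) by apply: cvgMr.
have an0 : a n != 0 by rewrite gt_eqF.
by rewrite mulKf//; under eq_fun do rewrite mulKf//.
Qed.

Lemma l2_strong_weak (F : nat -> nat -> R) f : (forall j, l2 a (F j)) -> l2 a f ->
  l2_strong_cvg a F f -> l2_weak_cvg a F f.
Proof.
move=> lF lf Ff g lg.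
suff c0 : l2_inner a (F j - f) g @[j --> \oo] --> (0 : R).
  have -> : (fun j => l2_inner a (F j) g) = (fun j => l2_inner a (F j - f) g + l2_inner a f g).
    by apply/funext => j; rewrite l2_innerBl// subrK.
  by rewrite -[X in _ --> X]add0r; apply: cvgD => //; exact: cvg_cst.
have c : l2_norm a (F j - f) * l2_norm a g @[j --> \oo] --> (0 : R).
  by rewrite -[X in _ --> X](mul0r (l2_norm a g)); exact: cvgMl.
apply/cvgr0Pnorm_le => e e0; have /cvgr0Pnorm_le /(_ e e0) := c.
apply: filterS => j; apply: le_trans.
rewrite [leRHS]ger0_norm ?mulr_ge0 ?l2_norm_ge0//.
by apply: l2_CauchySchwarz => //; exact: l2B.
Qed.

(** Along a subsequence the energies are bounded, and weak convergence is
    pointwise convergence, so semicontinuity applies. *)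
Lemma discrete_form_liminf (lam : nat -> R) (F : nat -> nat -> R) f :
  (forall j, 0 < lam j) -> l2 a f -> l2_weak_cvg a F f ->
  (discrete_form f <= limn_einf (fun j => trace_form_lam a (lam j) (F j)))%E.
Proof.
move=> lam0 lf wF; set L := limn_einf _.
have H c : (L < c%:E)%E -> (discrete_form f <= c%:E)%E.
  move=> /limn_einf_frequently Lc.
  have /choice[js jsP] : forall k, exists j, (k <= j)%N /\ (trace_form_lam a (lam j) (F j) < c%:E)%E.
    by move=> k; have [j ? ?] := Lc k; exists j.
  have jsoo : js @ \oo --> \oo.
    move=> A [N _ NA]; exists N => // k /= Nk; apply: NA => /=.
    exact: leq_trans Nk (jsP k).1.
  have [|||df fc] := @trace_dom_fatou (F \o js) f c lf.
  - by move=> n; exact: (cvg_comp _ _ jsoo (l2_weak_pointwise wF)).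
  - move=> k; apply/cvgrPdist_le => e e0.
    have [|N NP] := @trace_form_lam_vanishes _ a (lam (js k)) (F (js k)) _ e e0.
      by apply: lt_trans (jsP k).2 _; rewrite ltry.
    by exists N => // n /= /NP; rewrite sub0r normrN.
  - move=> k N; rewrite -lee_fin; apply: le_trans (trace_form_lam_ge _ _ _ (lam0 (js k))) (ltW (jsP k).2).
  by rewrite discrete_formE// lee_fin.
have q0 : (0 <= discrete_form f)%E.
  rewrite /discrete_form; case: asboolP => [[_ lf' _]|_]; last exact: leey.
  by rewrite lee_fin; exact: l2_inner_ge0.
case: L H => [l|H|H]; last 2 first.
- exact: leey.
- exfalso; have := le_trans q0 (H (-1) (ltNyr _)); rewrite lee_fin; lra.
by move=> H; apply/lee_addgt0Pr => e e0; rewrite -EFinD; apply: H; rewrite lte_fin ltrDl.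
Qed.

(** A truncation costs [lam * C] for a constant [C] that may grow as the
    truncation gets finer, whence the diagonal sequence. *)
Lemma discrete_form_recovery (lam : nat -> R) f : (forall j, 0 < lam j) ->
  lam @ \oo --> (0 : R) -> l2 a f ->
  exists F, [/\ forall j, l2 a (F j), l2_strong_cvg a F f &
    (limn_esup (fun j => trace_form_lam a (lam j) (F j)) <= discrete_form f)%E].
Proof.
move=> lam0 lamc lf; rewrite /discrete_form; case: asboolP => [df|_]; last first.
  exists (fun=> f); split=> //; last exact: leey.
  by rewrite /l2_strong_cvg subrr l2_norm0//; exact: cvg_cst.
have [_ lf' f0] := df.
have lt k : l2 a (truncation f k) by apply: l2_le lf => // n; exact: truncation_le.
have /choice[C CP] : forall k, exists C, 0 <= C /\ forall mu, 0 < mu ->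
    (trace_form_lam a mu (truncation f k) <= (energy f f + mu * C)%:E)%E.
  move=> k; have [N NP] := truncation_fin k f0.
  have [C C0 H] := trace_form_lam_le NP (lt k); exists C; split=> // mu mu0.
  apply: le_trans (H mu mu0) _; rewrite lee_fin lerD2r.
  by apply: le_trans (truncation_edge _ _ _) (energy_partial_le _ lf').
have [k kP] := @diagonal_cvg0 _ (fun K j => lam j * C K) (fun K => ltac:(
  rewrite -[X in _ --> X](mul0r (C K)); exact: cvgMl)).
have koo : k @ \oo --> \oo.
  move=> A [N _ NA]; have [M _ MP] := kP N; exists M => // j /= Mj; apply: NA => /=.
  exact: (MP j Mj).1.
exists (fun j => truncation f (k j)); split=> //.
  exact: (cvg_comp _ _ koo (truncation_l2_cvg lf)).
apply/lee_addgt0Pr => e e0; apply: limn_esup_le_near.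
have [K Ke] := exists_inv_succ_lt e0; have := kP K; apply: filterS => j [_ jK].
apply: le_trans ((CP (k j)).2 _ (lam0 j)) _; rewrite -EFinD lee_fin lerD2l.
exact: le_trans jK (ltW Ke).
Qed.

Theorem trace_formE : trace_form a = discrete_form.
Proof.
have mosco : mosco_cvg_at0 a (trace_form_lam a) discrete_form.
  move=> lam lam0 lamc; split=> [F f lF lf wF|f lf].
    exact: discrete_form_liminf.
  exact: discrete_form_recovery.
have offl2 f : ~ l2 a f -> discrete_form f = +oo%E.
  by move=> lf; rewrite /discrete_form asboolF// => -[].
apply: xget_unique; first by split.
move=> q [qoo qm]; apply/funext => f.
have [lf|lf] := pselect (l2 a f); last by rewrite qoo// offl2.
pose lam j : R := j.+1%:R^-1.
have lam0 j : 0 < lam j by rewrite invr_gt0.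
have lamc : lam @ \oo --> (0 : R) by exact: cvg_harmonic.
have [q1 q2] := qm lam lam0 lamc; have [d1 d2] := mosco lam lam0 lamc.
apply/eqP; rewrite eq_le; apply/andP; split.
  have [F [lF sF qF]] := d2 f lf.
  apply: le_trans (q1 F f lF lf (l2_strong_weak lF lf sF)) _.
  exact: le_trans (limn_einf_le_esup _) qF.
have [F [lF sF qF]] := q2 f lf.
apply: le_trans (d1 F f lF lf (l2_strong_weak lF lf sF)) _.
exact: le_trans (limn_einf_le_esup _) qF.
Qed.

End TraceForm.

(** * The generator of the trace form *)

Section Generator.
Context {R : realType} (a : nat -> R) (a_gt0 : forall n, 0 < a n).
Implicit Types (f g v z : nat -> R) (c h e s t : R).

Local Notation b := (@conductance R).
Local Notation trace_dom := (trace_dom a).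
Let b_gt0 := @conductance_gt0 R.
Let a_neq0 n : a n != 0. Proof. by rewrite gt_eqF. Qed.

Definition flux f n : R := b n * increment f n.

(** No flux enters the first point from the left: it is a reflecting end. *)
Definition flux_in f n : R := if n is m.+1 then flux f m else 0.

(** The nonnegative operator of the form, acting on all sequences. *)
Definition gen f n : R := (flux_in f n - flux f n) / a n.

Lemma gen_lin c f g : gen (c *: f + g) = c *: gen f + gen g.
Proof.
apply/funext => n; have an := a_neq0 n; rewrite /gen /flux_in /flux /increment ?fctE /GRing.scale/=.
by case: n an => [|n] an; field.
Qed.

Lemma gen0 : gen 0 = 0.
Proof. by have := gen_lin (-1) 0 0; rewrite !scaleN1r !addNr. Qed.

Lemma genZ c f : gen (c *: f) = c *: gen f.
Proof. by rewrite -[c *: f]addr0 gen_lin gen0 addr0. Qed.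

Lemma genD f g : gen (f + g) = gen f + gen g.
Proof. by rewrite -[f]scale1r gen_lin !scale1r. Qed.

Lemma genB f g : gen (f - g) = gen f - gen g.
Proof. by rewrite addrC -scaleN1r gen_lin scaleN1r addrC. Qed.

Lemma gen_local f g n : f n.-1 = g n.-1 -> f n = g n -> f n.+1 = g n.+1 -> gen f n = gen g n.
Proof.
rewrite /gen /flux_in /flux /increment => h0 h1 h2; rewrite h1 h2.
by case: n h0 h1 h2 => [//|n] /= -> ->.
Qed.

Lemma summation_by_parts f g N :
  \sum_(0 <= n < N) (flux_in f n - flux f n) * g n =
  \sum_(0 <= n < N) flux f n * increment g n - flux_in f N * g N.
Proof.
elim: N => [|N IH]; first by rewrite !big_geq// mul0r subrr.
by rewrite !big_nat_recr//= IH /increment /=; ring.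
Qed.

Lemma green_fin f g N : (forall n, (N <= n)%N -> g n = 0) ->
  l2_inner a (gen f) g = energy f g.
Proof.
move=> gN; have gN' n : (N <= n)%N -> increment g n = 0.
  by move=> Nn; rewrite /increment !gN ?subrr// leqW.
rewrite /energy (l2_inner_fin _ _ gN) (l2_inner_fin _ _ gN').
rewrite (_ : \sum_(0 <= n < N) a n * gen f n * g n = \sum_(0 <= n < N) (flux_in f n - flux f n) * g n).
  by rewrite summation_by_parts gN// mulr0 subr0.
by apply: eq_bigr => n _; rewrite /gen; congr (_ * _); rewrite mulrC divfK.
Qed.

Lemma trace_dom_lin c f g : trace_dom f -> trace_dom g -> trace_dom (c *: f + g).
Proof.
move=> [lf lf' f0] [lg lg' g0]; split; first exact: l2_lin.
  by rewrite increment_lin; exact: l2_lin.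
rewrite -[X in _ --> X](addr0 0) -[X in _ --> X + _](mulr0 c).
by apply: cvgD => //; apply: cvgMr.
Qed.

Lemma trace_dom_fin f N : (forall n, (N <= n)%N -> f n = 0) -> trace_dom f.
Proof.
move=> fN; split; first exact: l2_fin fN.
  by apply: (@l2_fin _ _ b_gt0 _ N) => n Nn; rewrite /increment !fN ?subrr// leqW.
by apply: cvg_near_cst; exists N.
Qed.

Lemma trace_dom0 : trace_dom 0.
Proof. exact: (@trace_dom_fin _ 0). Qed.

Lemma trace_domZ c f : trace_dom f -> trace_dom (c *: f).
Proof. by move=> df; rewrite -[c *: f]addr0; apply: trace_dom_lin => //; exact: trace_dom0. Qed.

Lemma trace_domD f g : trace_dom f -> trace_dom g -> trace_dom (f + g).
Proof. by move=> df dg; rewrite -[f]scale1r; exact: trace_dom_lin. Qed.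

Lemma trace_domB f g : trace_dom f -> trace_dom g -> trace_dom (f - g).
Proof. by move=> df dg; rewrite addrC -scaleN1r; exact: trace_dom_lin. Qed.

Lemma gen_fin f N : (forall n, (N <= n)%N -> f n = 0) -> forall n, (N < n)%N -> gen f n = 0.
Proof.
move=> fN [|n]//; rewrite ltnS => Nn.
by rewrite /gen /flux_in /flux /increment !fN ?(leqW, subrr, mulr0, subr0, mul0r)// ?leqW// leqW.
Qed.

(** Green's formula extends from finitely supported [v] to the whole form
    domain by truncation. *)
Lemma green f v : trace_dom f -> l2 a (gen f) -> trace_dom v ->
  energy f v = l2_inner a (gen f) v.
Proof.
move=> [lf lf' f0] lg [lv lv' v0].
have fin k : energy f (truncation v k) = l2_inner a (gen f) (truncation v k).
  by have [N NP] := truncation_fin k v0; rewrite (green_fin _ NP).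
have c1 : energy f (truncation v k) @[k --> \oo] --> energy f v.
  apply: (@tannery _ _ _ (fun n => `|b n * increment f n * increment v n|)).
  - move=> n; apply: cvgMr; apply: cvgB; exact: truncation_cvg.
  - by move=> k n; rewrite !normrM ler_wpM2l ?mulr_ge0// truncation_increment.
  - apply: (@series_dominated_cvg _ _ (fun n => b n * increment f n ^+ 2 + b n * increment v n ^+ 2)).
      move=> n; rewrite normr_id -mulrA -mulrDr normrM (ger0_norm (ltW (b_gt0 n))) ler_wpM2l ?(ltW (b_gt0 n))// ler_norml.
      move: (increment f n) (increment v n) => x y.
      have := sqr_ge0 (x + y); have := sqr_ge0 (x - y); have := sqr_ge0 x; have := sqr_ge0 y.
      by rewrite !expr2 => *; apply/andP; split; lra.
    rewrite (_ : series _ = series (fun n => b n * increment f n ^+ 2) + series (fun n => b n * increment v n ^+ 2)).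
      by apply: is_cvgD; exact: l2_cvg_sqr.
    by apply/funext => n; rewrite /series/= fctE big_split.
have lt k : l2 a (truncation v k) by apply: l2_le lv => // n; exact: truncation_le.
have c2 : l2_inner a (gen f) (truncation v k) @[k --> \oo] --> l2_inner a (gen f) v.
  under eq_fun do rewrite l2_innerC; rewrite l2_innerC.
  by apply: (l2_strong_weak a_gt0 lt lv) lg; exact: truncation_l2_cvg.
rewrite (funext fin : (fun k => _) = _) in c1.
exact: (cvg_unique (@Rhausdorff R) c1 c2).
Qed.

Lemma energyC f g : energy f g = energy g f.
Proof. exact: l2_innerC. Qed.

Lemma form_domE f : form_dom a (discrete_form a) f <-> trace_dom f.
Proof.
split=> [[_ /(discrete_form_lty a)]//|df]; split; first by case: df.
exact/discrete_form_lty.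
Qed.

Lemma form_polarE f g : trace_dom f -> trace_dom g ->
  form_polar (discrete_form a) f g = energy f g.
Proof.
move=> df dg; have [_ lf _] := df; have [_ lg _] := dg.
rewrite /form_polar !discrete_formE /=; [|exact: trace_domB|exact: trace_domD].
have iD : increment (f + g) = increment f + increment g.
  by rewrite -[f]scale1r increment_lin !scale1r.
have iB : increment (f - g) = increment f - increment g.
  by rewrite addrC -scaleN1r increment_lin scaleN1r addrC.
rewrite /energy iD iB (l2_innerDl b_gt0 lf lg (l2D b_gt0 lf lg)).
rewrite (l2_innerBl b_gt0 lf lg (l2B b_gt0 lf lg)).
rewrite (l2_innerDr b_gt0 lf lg lf) (l2_innerDr b_gt0 lf lg lg).
rewrite (l2_innerBr b_gt0 lf lg lf) (l2_innerBr b_gt0 lf lg lg).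
rewrite (l2_innerC b (increment g) (increment f)).
by field.
Qed.

Lemma form_operatorE f g : form_operator a (discrete_form a) f g <->
  [/\ trace_dom f, l2 a g & g = gen f].
Proof.
split=> [[/form_domE df lg H]|[df lg gE]].
  split=> //; apply/funext => n.
  have uN : forall k, (n.+1 <= k)%N -> unit_seq n k = 0 :> R.
    by move=> k nk; rewrite /unit_seq gtn_eqF.
  have du := trace_dom_fin uN.
  have := H _ ((form_domE _).2 du); rewrite (form_polarE df du) -(green_fin _ uN).
  by rewrite !l2_inner_unit => /(mulfI (a_neq0 n)).
split=> //; first exact/form_domE.
by move=> v /form_domE dv; rewrite (form_polarE df dv) gE green -?gE.
Qed.

(** * The maximum principle *)

(** At a point where a negative minimum is attained the operator is nonpositive;
    the condition at infinity makes the minimum attained. *)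
Lemma maximum_principle h z : 0 <= h -> (forall n, 0 <= z n + h * gen z n) ->
  (forall e, 0 < e -> exists N, forall n, (N <= n)%N -> - e <= z n) ->
  forall n, 0 <= z n.
Proof.
move=> h0 zh zinf m; rewrite leNgt; apply/negP => zm.
have e0 : 0 < - z m / 2 by lra.
have [N NP] := zinf _ e0.
pose M := (maxn N m).+1.
have mM : (m < M)%N by rewrite ltnS leq_maxr.
pose i0 : 'I_M := Ordinal mM.
have [p pmin] : exists p : 'I_M, forall i : 'I_M, z p <= z i.
  have [p _ pmin] := @arg_minP _ _ _ i0 predT (fun i : 'I_M => z i) isT.
  by exists p => i; exact: pmin.
have zp n : z p <= z n.
  have [nM|Mn] := ltnP n M; first exact: (pmin (Ordinal nM)).
  have Nn : (N <= n)%N by apply: leq_trans (ltnW Mn); rewrite leq_maxl.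
  by have := NP n Nn; have := pmin i0; rewrite /=; lra.
have gp : gen z p <= 0.
  rewrite /gen pmulr_lle0 ?invr_gt0// subr_le0.
  apply: (@le_trans _ _ 0); last first.
    by rewrite mulr_ge0 ?(ltW (b_gt0 _))// subr_ge0.
  rewrite /flux_in; case: (p : nat) zp => // k zp.
  by rewrite pmulr_rle0 ?b_gt0// subr_le0.
have := zh p; have := pmin i0; have := mulr_ge0_le0 h0 gp; rewrite /=; lra.
Qed.

Lemma cvg0_eventually_ge z : z @ \oo --> (0 : R) ->
  forall e, 0 < e -> exists N, forall n, (N <= n)%N -> - e <= z n.
Proof.
move=> /cvgrPdist_le z0 e e0; have [N _ NP] := z0 e e0; exists N => n Nn.
by have := NP n Nn; rewrite sub0r normrN ler_norml => /andP[].
Qed.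

Lemma resolvent_unique h f g : 0 <= h -> f @ \oo --> (0 : R) -> g @ \oo --> (0 : R) ->
  f + h *: gen f = g + h *: gen g -> f = g.
Proof.
move=> h0 f0 g0 E.
have half f1 g1 : f1 @ \oo --> (0 : R) -> g1 @ \oo --> (0 : R) ->
    f1 + h *: gen f1 = g1 + h *: gen g1 -> forall n, 0 <= (f1 - g1) n.
  move=> c1 c2 E1; apply: (maximum_principle h0).
    move=> n; rewrite genB; have := congr1 (@^~ n) E1.
    rewrite !fctE /GRing.scale/=; lra.
  apply: cvg0_eventually_ge; rewrite -(subrr (0 : R)); exact: cvgB.
apply/funext => n; apply/eqP; rewrite eq_le.
by rewrite -subr_ge0 (half _ _ g0 f0 (esym E))/= -subr_ge0 (half _ _ f0 g0 E).
Qed.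

End Generator.

(** * The resolvent *)

Section Resolvent.
Context {R : realType} (a : nat -> R) (a_gt0 : forall n, 0 < a n).
Implicit Types (f g v z : nat -> R) (c h e s t : R).

Local Notation b := (@conductance R).
Local Notation trace_dom := (trace_dom a).
Local Notation gen := (gen a).
Let b_gt0 := @conductance_gt0 R.
Let a_neq0 n : a n != 0. Proof. by rewrite gt_eqF. Qed.
Let b_neq0 n : b n != 0. Proof. by rewrite gt_eqF// b_gt0. Qed.

(** * Existence by shooting *)

(** The equation [f + h *: gen f = g] is a three-term recursion; the state is
    the value of [f] together with the incoming flux. *)
Fixpoint shoot h g x0 n : R * R :=
  if n is m.+1 then
    let s := shoot h g x0 m in
    let F := s.2 + a m * (s.1 - g m) / h in (s.1 + F / b m, F)
  else (x0, 0).

Definition shot h g x0 n := (shoot h g x0 n).1.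

Lemma flux_shot h g x0 n : flux (shot h g x0) n = (shoot h g x0 n.+1).2.
Proof. by rewrite /flux /increment /shot/= addrAC subrr add0r mulrC divfK. Qed.

Lemma flux_in_shot h g x0 n : flux_in (shot h g x0) n = (shoot h g x0 n).2.
Proof. by case: n => [//|n]; rewrite /flux_in flux_shot. Qed.

Lemma shotE h g x0 : 0 < h -> shot h g x0 + h *: gen (shot h g x0) = g.
Proof.
move=> h0; apply/funext => n.
rewrite [LHS](_ : _ = shot h g x0 n + h * gen (shot h g x0) n)//.
rewrite /gen flux_in_shot flux_shot /shot /=.
have hn : h != 0 by rewrite gt_eqF.
by have an := a_neq0 n; field; rewrite ?an ?hn.
Qed.

Lemma shot_ge1 h n : 0 < h -> 1 <= shot h 0 1 n.
Proof.
move=> h0; suff : 1 <= (shoot h 0 1 n).1 /\ 0 <= (shoot h 0 1 n).2 by case.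
elim: n => [//|n /= [x1 F0]].
set F := (X in 0 <= X).
have FF : 0 <= F.
  apply: addr_ge0 => //; apply: divr_ge0; last exact: ltW.
  by apply: mulr_ge0; [exact: ltW|rewrite subr_ge0; exact: le_trans ler01 x1].
by split=> //; apply: le_trans x1 _; rewrite lerDl divr_ge0 ?(ltW (b_gt0 n)).
Qed.

(** The contraction property of the resolvent, in the form that applies to the
    finite sections below as well. *)
Lemma resolvent_energy h f u N : 0 <= h -> l2 a u -> (forall n, (N <= n)%N -> f n = 0) ->
  (forall n, (n < N)%N -> f n + h * gen f n = u n) ->
  l2_norm a f <= l2_norm a u /\ h * energy f f <= l2_norm a u ^+ 2.
Proof.
move=> h0 lu fN E.
have lf : l2 a f := l2_fin a_gt0 fN.
have lg : l2 a (gen f) := l2_fin a_gt0 (gen_fin a fN).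
have en : l2_norm a f ^+ 2 + h * energy f f = l2_inner a u f.
  rewrite (l2_normK a_gt0 lf) -(green_fin a_gt0 f fN).
  rewrite !(l2_inner_fin _ _ fN) mulr_sumr -big_split/=.
  rewrite !big_nat; apply: eq_bigr => n /andP[_ nN].
  by rewrite -(E n nN); ring.
have := l2_CauchySchwarz a_gt0 lu lf; have e0 : 0 <= energy f f.
  by have [_ lb _] := trace_dom_fin a_gt0 fN; exact: (l2_inner_ge0 b_gt0 lb).
have := l2_norm_ge0 a f; have := l2_norm_ge0 a u.
rewrite -en => x y; have := mulr_ge0 h0 e0.
move: (energy f f) (l2_norm a f) (l2_norm a u) x y => E0 x y y0 x0 hE.
move=> /(le_trans (ler_norm _)) cs.
have xy : x <= y by nra.
by split=> //; nra.
Qed.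

Lemma increasing_seq_ge (phi : nat -> nat) : increasing_seq phi -> forall n, (n <= phi n)%N.
Proof.
move=> /increasing_seqP inc; elim=> [//|n IH].
by apply: leq_ltn_trans IH _; exact: inc.
Qed.

(** The section at [N] solves the equation below [N] with a Dirichlet condition
    at [N]. It is a combination of two fixed solutions, so one coefficient
    carries all the compactness that the limit needs. *)
Lemma resolvent_exists h u : 0 < h -> l2 a u -> exists2 f, trace_dom f & f + h *: gen f = u.
Proof.
move=> h0 lu.
pose p := shot h u 0; pose w := shot h 0 1.
have w1 n : 1 <= w n by exact: shot_ge1.
pose c N := - p N / w N.
pose F N n : R := if (n < N)%N then c N * w n + p n else 0.
have FN N n : (N <= n)%N -> F N n = 0 by move=> Nn; rewrite /F ltnNge Nn.
have Fle N n : (n <= N)%N -> F N n = (c N *: w + p) n.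
  rewrite leq_eqVlt => /predU1P[->|nN].
    rewrite FN// [RHS](_ : _ = c N * w N + p N)// /c divfK ?addNr//.
    by rewrite gt_eqF// (lt_le_trans ltr01 (w1 N)).
  by rewrite /F nN.
have solE k : (k *: w + p) + h *: gen (k *: w + p) = u.
  rewrite gen_lin// scalerDr addrACA shotE// scalerA mulrC -scalerA -scalerDr shotE//.
  by rewrite scaler0 add0r.
have FE N n : (n < N)%N -> F N n + h * gen (F N) n = u n.
  move=> nN; rewrite (gen_local a (g := c N *: w + p)) ?Fle//; try exact: ltnW.
    by rewrite -[in RHS](solE (c N)).
  by apply: leq_trans (ltnW nN); exact: leq_pred.
have bd N := resolvent_energy (ltW h0) lu (FN N) (@FE N).
have lF N : l2 a (F N) := l2_fin a_gt0 (FN N).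
have [phi inc cphi] : exists2 phi : nat -> nat, increasing_seq phi & cvgn ((c \o S) \o phi).
  apply: bolzano_weierstrass.
  pose M := l2_norm a u ^+ 2 / a 0%N + 1.
  exists M; split; first exact: num_real.
  move=> x Mx N _; apply: le_trans (ltW Mx); rewrite /=.
  have F0 : F N.+1 0%N = c N.+1 by rewrite /F/= /w /p /shot/= mulr1 addr0.
  have := l2_point_le a_gt0 0%N (lF N.+1); rewrite F0 -(l2_normK a_gt0 (lF _)).
  have [le1 _] := bd N.+1.
  have : l2_norm a (F N.+1) ^+ 2 <= l2_norm a u ^+ 2.
    by rewrite ler_sqr ?nnegrE ?l2_norm_ge0.
  move=> uu cu; have {cu}uu : c N.+1 ^+ 2 <= l2_norm a u ^+ 2 / a 0%N.
    by rewrite ler_pdivlMr// mulrC; exact: le_trans cu uu.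
  have := sqr_ge0 (`|c N.+1| - 1); rewrite /M; move: uu.
  rewrite -(real_normK (num_real (c N.+1))) !expr2.
  by have := normr_ge0 (c N.+1); move: `|_| (_ / _) => y z; nra.
have phin := increasing_seq_ge inc.
set k := limn ((c \o S) \o phi) in cphi.
exists (k *: w + p); last exact: solE.
have Fcvg n : F (phi j).+1 n @[j --> \oo] --> (k *: w + p) n.
  have cc : (k *: w + p) n = k * w n + p n by [].
  rewrite cc; have cv : c (phi j).+1 * w n + p n @[j --> \oo] --> k * w n + p n.
    by apply: cvgD; [apply: cvgMl; exact: cphi|exact: cvg_cst].
  apply: cvg_trans cv; apply: near_eq_cvg; exists n => // j /= nj.
  by rewrite /F ltnS (leq_trans nj).
have le2 j : l2_inner a (F j) (F j) <= l2_norm a u ^+ 2.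
  by rewrite -(l2_normK a_gt0 (lF _)) ler_sqr ?nnegrE ?l2_norm_ge0; case: (bd j).
have [lf _] : l2 a (k *: w + p) /\ l2_inner a (k *: w + p) (k *: w + p) <= l2_norm a u ^+ 2.
  by apply: (l2_fatou a_gt0 Fcvg); apply: nearW => j; split.
have F0 j : F (phi j).+1 @ \oo --> (0 : R).
  by apply: cvg_near_cst; exists (phi j).+1 => // n; exact: FN.
have FC j M : \sum_(i < M) edge_energy (F (phi j).+1) i <= l2_norm a u ^+ 2 / h.
  apply: le_trans (energy_partial_le _ _) _.
    by case: (trace_dom_fin a_gt0 (FN (phi j).+1)).
  by rewrite ler_pdivlMr// mulrC; case: (bd (phi j).+1).
by have [] := trace_dom_fatou lf Fcvg F0 FC.
Qed.

(** * Algebraic properties *)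

(** [resolvent h] inverts the identity plus [h] times the generator. For the
    other [h] it is the identity, the limit at 0, so that the algebraic
    identities below hold for every real [h]. *)
Definition resolvent h g : nat -> R :=
  if 0 < h then xget 0 [set f | trace_dom f /\ f + h *: gen f = g] else g.

Local Notation J := resolvent.

Lemma resolvent_id h g : h <= 0 -> J h g = g.
Proof. by rewrite /resolvent leNgt => /negbTE ->. Qed.

Lemma resolventP h g : 0 < h -> l2 a g ->
  trace_dom (J h g) /\ J h g + h *: gen (J h g) = g.
Proof.
move=> h0 lg; rewrite /resolvent h0.
have [f df fE] := resolvent_exists h0 lg.
exact: (@xgetPex _ 0 [set f | trace_dom f /\ f + h *: gen f = g] (ex_intro _ f (conj df fE))).
Qed.

Lemma resolvent_dom h g : 0 < h -> l2 a g -> trace_dom (J h g).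
Proof. by move=> h0 lg; case: (resolventP h0 lg). Qed.

Lemma resolvent_eq h f : 0 < h -> trace_dom f -> l2 a (gen f) -> J h (f + h *: gen f) = f.
Proof.
move=> h0 df lg; have [lf _ f0] := df.
have [[_ _ j0] jE] := resolventP h0 (l2D a_gt0 lf (l2Z a_gt0 h lg)).
exact: (resolvent_unique a_gt0 (ltW h0) j0 f0 jE).
Qed.

Lemma l2_resolvent h g : l2 a g -> l2 a (J h g).
Proof.
move=> lg; have [h0|h0] := ltP 0 h; last by rewrite resolvent_id.
by case: (resolvent_dom h0 lg).
Qed.

Lemma gen_resolvent h g : 0 < h -> l2 a g -> gen (J h g) = h^-1 *: (g - J h g).
Proof.
move=> h0 lg; have [_ E] := resolventP h0 lg.
rewrite -{2}E addrAC subrr add0r scalerA mulVf ?scale1r// gt_eqF//.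
Qed.

Lemma l2_gen_resolvent h g : 0 < h -> l2 a g -> l2 a (gen (J h g)).
Proof.
move=> h0 lg; rewrite gen_resolvent//; apply: (l2Z a_gt0).
by apply: (l2B a_gt0) => //; exact: l2_resolvent.
Qed.

Lemma resolvent_lin h c f g : l2 a f -> l2 a g -> J h (c *: f + g) = c *: J h f + J h g.
Proof.
move=> lf lg; have [h0|h0] := ltP 0 h; last by rewrite !resolvent_id.
have [df fE] := resolventP h0 lf; have [dg gE] := resolventP h0 lg.
rewrite -{1}fE -{1}gE.
have -> : c *: (J h f + h *: gen (J h f)) + (J h g + h *: gen (J h g)) =
    (c *: J h f + J h g) + h *: gen (c *: J h f + J h g).
  by rewrite (gen_lin a_gt0) !scalerDr !scalerA [c * h]mulrC addrACA.
apply: resolvent_eq => //; first exact: (trace_dom_lin a_gt0).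
by rewrite (gen_lin a_gt0); apply: (l2_lin a_gt0); exact: l2_gen_resolvent.
Qed.

Lemma resolvent_contraction h f : l2 a f -> l2_norm a (J h f) <= l2_norm a f.
Proof.
move=> lf; have [h0|h0] := ltP 0 h; last by rewrite resolvent_id.
have [df fE] := resolventP h0 lf; have lj := l2_resolvent h lf.
have lg := l2_gen_resolvent h0 lf.
have := l2_CauchySchwarz a_gt0 lf lj.
rewrite -{1}fE (l2_innerDl a_gt0 lj (l2Z a_gt0 h lg) lj) (l2_innerZl a_gt0 h lg lj).
rewrite -(green a_gt0 df lg df) -(l2_normK a_gt0 lj).
have e0 : 0 <= energy (J h f) (J h f) by case: df => _ lb _; exact: (l2_inner_ge0 b_gt0 lb).
have := l2_norm_ge0 a f; have := l2_norm_ge0 a (J h f).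
have := mulr_ge0 (ltW h0) e0.
move: (energy _ _) (l2_norm a (J h f)) (l2_norm a f) => E x y hE x0 y0.
by move=> /(le_trans (ler_norm _)) cs; nra.
Qed.

Lemma resolvent_sym h f g : l2 a f -> l2 a g -> l2_inner a (J h f) g = l2_inner a f (J h g).
Proof.
move=> lf lg; have [h0|h0] := ltP 0 h; last by rewrite !resolvent_id.
have [df fE] := resolventP h0 lf; have [dg gE] := resolventP h0 lg.
have lu := l2_resolvent h lf; have lv := l2_resolvent h lg.
have gu := l2_gen_resolvent h0 lf; have gv := l2_gen_resolvent h0 lg.
rewrite -{1}gE -{2}fE.
rewrite (l2_innerDr a_gt0 lv (l2Z a_gt0 h gv) lu) (l2_innerZr a_gt0 h gv lu).
rewrite (l2_innerDl a_gt0 lu (l2Z a_gt0 h gu) lv) (l2_innerZl a_gt0 h gu lv).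
rewrite (l2_innerC a (J h f) (gen _)) -(green a_gt0 df gu dg) -(green a_gt0 dg gv df).
by rewrite energyC.
Qed.

Lemma resolvent_gen h f : trace_dom f -> l2 a (gen f) -> J h (gen f) = gen (J h f).
Proof.
move=> df lg; have [h0|h0] := ltP 0 h; last by rewrite !resolvent_id.
have [lf _ _] := df; have [dj jE] := resolventP h0 lf.
have dz : trace_dom (gen (J h f)).
  by rewrite gen_resolvent//; apply: (trace_domZ a_gt0); exact: (trace_domB a_gt0).
have E : gen (J h f) + h *: gen (gen (J h f)) = gen f.
  by rewrite -(genZ a_gt0) -(genD a_gt0) jE.
rewrite -{1}E; apply: resolvent_eq => //.
have -> : gen (gen (J h f)) = h^-1 *: (gen f - gen (J h f)).
  by rewrite {1}gen_resolvent// (genZ a_gt0) (genB a_gt0).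
by apply: (l2Z a_gt0); apply: (l2B a_gt0) => //; exact: l2_gen_resolvent.
Qed.

(** Each resolvent commutes with [gen], hence with the operator that the other
    one inverts. *)
Lemma resolventC s t f : l2 a f -> J s (J t f) = J t (J s f).
Proof.
move=> lf; have [s0|s0] := ltP 0 s; last by rewrite !(resolvent_id _ s0).
have [ds sE] := resolventP s0 lf; have ls := l2_resolvent s lf.
rewrite -{1}sE -[X in J s (J t X)]addrC (resolvent_lin _ _ (l2_gen_resolvent s0 lf) ls).
rewrite (resolvent_gen _ ds (l2_gen_resolvent s0 lf)) addrC.
have [t0|t0] := ltP 0 t.
  by apply: resolvent_eq => //; [exact: resolvent_dom|exact: l2_gen_resolvent].
by rewrite !(resolvent_id _ t0); apply: resolvent_eq => //; exact: l2_gen_resolvent.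
Qed.

Lemma resolvent_sub h f : 0 <= h -> trace_dom f -> l2 a (gen f) ->
  J h f - f = - (h *: J h (gen f)).
Proof.
rewrite le_eqVlt => /predU1P[<- df lg|h0 df lg].
  by rewrite !resolvent_id// subrr scale0r oppr0.
have [lf _ _] := df; have [_ E] := resolventP h0 lf.
by rewrite (resolvent_gen _ df lg) -{2}E opprD addrA subrr add0r.
Qed.

Lemma resolvent_id_dist h f : 0 <= h -> trace_dom f -> l2 a (gen f) ->
  l2_norm a (J h f - f) <= h * l2_norm a (gen f).
Proof.
move=> h0 df lg; rewrite resolvent_sub//.
rewrite (l2_normN a_gt0 (l2Z a_gt0 _ (l2_resolvent _ lg))).
rewrite (l2_normZ a_gt0 _ (l2_resolvent _ lg)) ger0_norm// ler_wpM2l//.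
exact: resolvent_contraction.
Qed.

(** The difference is [h] times the displacement of [gen f] by the resolvent, which
    is itself of order [h]. *)
Lemma resolvent_expansion h f : 0 <= h -> trace_dom f -> trace_dom (gen f) ->
  l2 a (gen (gen f)) ->
  l2_norm a (J h f - f + h *: gen f) <= h ^+ 2 * l2_norm a (gen (gen f)).
Proof.
move=> h0 df dg lgg; have [lg _ _] := dg.
rewrite resolvent_sub// addrC -scalerBr.
have lj := l2_resolvent h lg.
rewrite (l2_normZ a_gt0 _ (l2B a_gt0 lg lj)) ger0_norm// expr2 -mulrA ler_wpM2l//.
by rewrite (l2_distC a_gt0 lg lj); exact: resolvent_id_dist.
Qed.

(** The product of the two inverted operators differs from the inverted operator
    of the sum by [s * t] times the square of [gen]. *)
Lemma resolvent_add s t f : 0 <= s -> 0 <= t -> trace_dom f -> trace_dom (gen f) ->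
  l2 a (gen (gen f)) ->
  l2_norm a (J (s + t) f - J s (J t f)) <= s * t * l2_norm a (gen (gen f)).
Proof.
rewrite le_eqVlt => /predU1P[<- t0 df dg lgg|s0].
  by rewrite add0r (resolvent_id _ (lexx 0)) subrr l2_norm0 mul0r mul0r.
rewrite le_eqVlt => /predU1P[<- df dg lgg|t0 df dg lgg].
  by rewrite addr0 (resolvent_id f (lexx 0)) subrr l2_norm0 mulr0 mul0r.
have [lf _ _] := df; have [lg _ _] := dg.
have lt := l2_resolvent t lf; have dt := resolvent_dom t0 lf.
have [dy yE] := resolventP s0 lt; have ly := l2_resolvent s lt.
set y := J s (J t f) in dy yE ly *.
have gyE : gen y = J s (J t (gen f)).
  by rewrite (resolvent_gen t df lg) (resolvent_gen s dt (l2_gen_resolvent t0 lf)).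
have dtg : trace_dom (J t (gen f)) by exact: resolvent_dom.
have ltg : l2 a (gen (J t (gen f))) by exact: l2_gen_resolvent.
have ggyE : gen (gen y) = J s (J t (gen (gen f))).
  by rewrite gyE (resolvent_gen t dg lgg) (resolvent_gen s dtg ltg).
have lgy : l2 a (gen y) by exact: l2_gen_resolvent.
have lggy : l2 a (gen (gen y)) by rewrite ggyE; do 2 apply: l2_resolvent.
have [_ tE] := resolventP t0 lf.
have fE : f = (y + (s + t) *: gen y) + (s * t) *: gen (gen y).
  rewrite -tE -yE (genD a_gt0) (genZ a_gt0) scalerDr scalerA [t * s]mulrC scalerDl.
  by rewrite !addrA.
have st0 : 0 < s + t by exact: addr_gt0.
have yl : l2 a (y + (s + t) *: gen y) by apply: (l2D a_gt0) => //; exact: (l2Z a_gt0).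
rewrite {1}fE addrC [_ + _ *: gen (gen y)]addrC (resolvent_lin _ _ lggy yl).
rewrite (resolvent_eq st0 dy lgy) addrC addrK.
have st : 0 <= s * t by apply: mulr_ge0; exact: ltW.
rewrite (l2_normZ a_gt0 _ (l2_resolvent _ lggy)) ger0_norm// ler_wpM2l//.
apply: le_trans (resolvent_contraction _ lggy) _; rewrite ggyE.
apply: le_trans (resolvent_contraction _ (l2_resolvent _ lgg)) _.
exact: resolvent_contraction.
Qed.

(** Comparison with supersolutions, which need not be square-summable. *)
Lemma resolvent_le h g z : 0 < h -> l2 a g -> (forall n, g n <= z n + h * gen z n) ->
  (forall e, 0 < e -> exists N, forall n, (N <= n)%N -> - e <= z n) ->
  forall n, J h g n <= z n.
Proof.
move=> h0 lg gz zinf n; have [[_ _ j0] jE] := resolventP h0 lg.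
rewrite -subr_ge0 -[_ - _]/((z - J h g) n).
apply: (maximum_principle a_gt0 (ltW h0)).
  move=> m; rewrite (genB a_gt0); have := gz m; rewrite -[in g m]jE.
  rewrite -[(J h g + _) m]/(J h g m + h * gen (J h g) m).
  rewrite -[(z - _) m]/(z m - J h g m) -[(gen z - _) m]/(gen z m - gen (J h g) m).
  by move: (gen z m) (gen _ m) (J h g m) => x y w; lra.
move=> e e0; have e2 : 0 < e / 2 by rewrite divr_gt0.
have jn : (- J h g) @ \oo --> (0 : R) by rewrite -oppr0; exact: cvgN.
have [N1 H1] := zinf _ e2; have [N2 H2] := cvg0_eventually_ge jn e2.
exists (maxn N1 N2) => m; rewrite geq_max => /andP[m1 m2].
have := H1 _ m1; have := H2 _ m2.
rewrite -[(- J h g) m]/(- J h g m) -[(z - _) m]/(z m - J h g m); lra.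
Qed.

End Resolvent.

(** * Convergence in the sequence space *)

Section Convergence.
Context {R : realType} (a : nat -> R) (a_gt0 : forall n, 0 < a n).
Implicit Types (f g v z : nat -> R) (c h e s t : R) (F : nat -> nat -> R).

Local Notation l2 := (l2 a).
Local Notation "'N[ f ]" := (l2_norm a f) (format "''N[' f ]").

Lemma cvg_seq0P (x : nat -> R) : (forall j, 0 <= x j) ->
  x @ \oo --> (0 : R) <-> forall e, 0 < e -> exists N, forall j, (N <= j)%N -> x j <= e.
Proof.
move=> x0; split=> [/cvgrPdist_le H e /H[N _ NP]|H].
  by exists N => j /NP; rewrite sub0r normrN ger0_norm.
apply/cvgrPdist_le => e /H[N NP]; exists N => // j /NP.
by rewrite sub0r normrN ger0_norm.
Qed.

Lemma cvg_right0P (x : R -> R) : (forall t, 0 <= x t) ->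
  x t @[t --> 0^'+] --> (0 : R) <->
  forall e, 0 < e -> exists2 d, 0 < d & forall t, 0 < t -> t < d -> x t <= e.
Proof.
move=> x0; split=> [/cvgrPdist_le H e /H[d /= d0 dP]|H].
  exists d => // t t0 td; have := dP t; rewrite sub0r normrN ger0_norm//; apply=> //.
  by rewrite /= sub0r normrN gtr0_norm.
apply/cvgrPdist_le => e /H[d d0 dP]; near=> t.
rewrite sub0r normrN ger0_norm//; apply: dP.
  by near: t; exact: nbhs_right_gt.
by near: t; exact: nbhs_right_lt.
Unshelve. all: by end_near. Qed.

Lemma l2_norm_le f C : 0 <= C -> l2_inner a f f <= C ^+ 2 -> 'N[f] <= C.
Proof. by move=> C0 fC; rewrite /l2_norm -[C]ger0_norm// -sqrtr_sqr ler_wsqrtr. Qed.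

Lemma le_eps (x y : R) : (forall e, 0 < e -> x <= y + e) -> x <= y.
Proof. by move=> H; apply/ler_addgt0Pr. Qed.

Lemma l2_eq_eps f g : l2 f -> l2 g -> (forall e, 0 < e -> 'N[f - g] <= e) -> f = g.
Proof.
move=> lf lg H; apply/eqP; rewrite -subr_eq0; apply/eqP.
apply: (l2_norm_eq0 a_gt0); first exact: (l2B a_gt0).
apply/eqP; rewrite eq_le l2_norm_ge0 andbT; apply: le_eps => e e0.
by rewrite add0r; exact: H.
Qed.

Lemma l2_norm_lim F f C : (forall j, l2 (F j)) -> l2 f ->
  'N[F j - f] @[j --> \oo] --> (0 : R) -> (forall j, 'N[F j] <= C) -> 'N[f] <= C.
Proof.
move=> lF lf /(cvg_seq0P (fun=> l2_norm_ge0 _ _)) H FC; apply: le_eps => e /H[N /(_ N (leqnn N)) NP].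
have := l2_norm_triangle a_gt0 lf (l2_0 a_gt0) (lF N).
rewrite (l2_distC a_gt0 lf (lF _)) !subr0; have := FC N; move: NP.
move: 'N[f] 'N[F N] 'N[F N - f] => x y z; lra.
Qed.

Lemma l2_point_norm f n : l2 f -> `|f n| <= 'N[f] / Num.sqrt (a n).
Proof.
move=> lf; rewrite ler_pdivlMr ?sqrtr_gt0// -ler_sqr ?nnegrE ?mulr_ge0 ?sqrtr_ge0 ?l2_norm_ge0//.
rewrite exprMn real_normK ?num_real// sqr_sqrtr ?(ltW (a_gt0 n))// mulrC (l2_normK a_gt0 lf).
exact: l2_point_le.
Qed.

Lemma l2_strong_pointwise F f n : (forall j, l2 (F j)) -> l2 f ->
  'N[F j - f] @[j --> \oo] --> (0 : R) -> F j n @[j --> \oo] --> f n.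
Proof.
by move=> lF lf sF; apply: (l2_weak_pointwise a_gt0); exact: (l2_strong_weak a_gt0 lF lf).
Qed.

(** The pointwise limit is the limit in norm, by Fatou's lemma. *)
Lemma l2_complete F : (forall j, l2 (F j)) ->
  (forall e, 0 < e -> exists N, forall j k, (N <= j)%N -> (N <= k)%N -> 'N[F j - F k] <= e) ->
  l2 (fun n => limn (F ^~ n)) /\
  'N[F j - (fun n => limn (F ^~ n))] @[j --> \oo] --> (0 : R).
Proof.
move=> lF FC.
have Fn n : F j n @[j --> \oo] --> limn (F ^~ n).
  apply/cauchy_cvgP; apply: cauchy_exP => e e0.
  have s0 : 0 < Num.sqrt (a n) by rewrite sqrtr_gt0.
  have [N NP] := FC (e / 2 * Num.sqrt (a n)) (mulr_gt0 (divr_gt0 e0 (ltr0Sn R 1)) s0).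
  exists (F N n); exists N => // j /= Nj; rewrite /ball/=.
  have := l2_point_norm n (l2B a_gt0 (lF N) (lF j)).
  rewrite -[(F N - F j) n]/(F N n - F j n) => /le_lt_trans; apply.
  rewrite ltr_pdivrMr//; apply: le_lt_trans (NP _ _ (leqnn N) Nj) _.
  by rewrite ltr_pM2r//; lra.
set f := fun n => limn _.
have H e : 0 < e -> exists N, forall j, (N <= j)%N -> l2 (F j - f) /\ 'N[F j - f] <= e.
  move=> e0; have [N NP] := FC e e0; exists N => j Nj.
  have c n : (F j - F k) n @[k --> \oo] --> (F j - f) n.
    by apply: cvgB; [exact: cvg_cst|exact: Fn].
  have [lf fe] : l2 (F j - f) /\ l2_inner a (F j - f) (F j - f) <= e ^+ 2.
    apply: (l2_fatou a_gt0 c); exists N => // k /= Nk; split; first exact: (l2B a_gt0).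
    rewrite -(l2_normK a_gt0 (l2B a_gt0 (lF j) (lF k))) ler_sqr ?nnegrE ?l2_norm_ge0 ?(ltW e0)//.
    exact: NP.
  by split=> //; apply: l2_norm_le => //; exact: ltW.
split.
  have [N /(_ N (leqnn N)) [lf _]] := H 1 ltr01.
  by rewrite -[f](subKr (F N)); exact: (l2B a_gt0).
apply/(cvg_seq0P (fun=> l2_norm_ge0 _ _)) => e /H[N NP]; exists N => j /NP[]//.
Qed.

Definition finsupp f := exists N, forall n, (N <= n)%N -> f n = 0.

Lemma finsupp_l2 f : finsupp f -> l2 f.
Proof. by move=> [N fN]; exact: (l2_fin a_gt0 fN). Qed.

Lemma finsupp_dom f : finsupp f -> trace_dom a f.
Proof. by move=> [N fN]; exact: (trace_dom_fin a_gt0 fN). Qed.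

Lemma finsupp_gen f : finsupp f -> finsupp (gen a f).
Proof. by move=> [N fN]; exists N.+1; exact: gen_fin fN. Qed.

Lemma finsupp_cutoff f N : finsupp (fun k => if (k < N)%N then f k else 0).
Proof. by exists N => n; rewrite leqNgt => /negbTE ->. Qed.

Lemma finsupp_dense f e : l2 f -> 0 < e -> exists2 g, finsupp g & 'N[g - f] <= e.
Proof.
move=> lf e0; pose F N : nat -> R := fun k => if (k < N)%N then f k else 0.
have : 'N[F N - f] @[N --> \oo] --> (0 : R).
  apply: (l2_dominated a_gt0) lf => [n|N n].
    by apply: cvg_near_cst; exists n.+1 => // N /= nN; rewrite /F nN.
  by rewrite /F; case: ifP => //; rewrite normr0.
move=> /(cvg_seq0P (fun=> l2_norm_ge0 _ _)) /(_ e e0)[N /(_ N (leqnn N)) NP].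
by exists (F N) => //; exact: finsupp_cutoff.
Qed.

(** * Contractions *)

Definition contraction (X : (nat -> R) -> nat -> R) :=
  [/\ forall f, l2 f -> l2 (X f),
      forall c f g, l2 f -> l2 g -> X (c *: f + g) = c *: X f + X g &
      forall f, l2 f -> 'N[X f] <= 'N[f]].

Implicit Types X Y : (nat -> R) -> nat -> R.

Lemma contractionB X f g : contraction X -> l2 f -> l2 g -> X (f - g) = X f - X g.
Proof. by move=> [_ Xlin _] lf lg; rewrite addrC -scaleN1r Xlin// scaleN1r addrC. Qed.

Lemma contraction_comp X Y : contraction X -> contraction Y -> contraction (X \o Y).
Proof.
move=> [X1 X2 X3] [Y1 Y2 Y3]; split=> [f lf|c f g lf lg|f lf] /=.
- exact/X1/Y1.
- by rewrite Y2// X2//; exact: Y1.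
- by apply: le_trans (X3 _ (Y1 _ lf)) _; exact: Y3.
Qed.

Lemma contraction_iter X n : contraction X -> contraction (iter n X).
Proof.
move=> cX; elim: n => [|n IH]; last exact: (contraction_comp cX IH).
by split.
Qed.

Lemma contraction_eq X Y : contraction X -> contraction Y ->
  (forall f, finsupp f -> X f = Y f) -> forall f, l2 f -> X f = Y f.
Proof.
move=> cX cY XY f lf; have [X1 _ X3] := cX; have [Y1 _ Y3] := cY.
apply: l2_eq_eps; [exact: X1|exact: Y1|move=> e e0].
have [g fg ge] := finsupp_dense lf (divr_gt0 e0 (ltr0Sn R 1)).
have lg := finsupp_l2 fg; have lgf := l2B a_gt0 lg lf.
have hX := X3 _ lgf; have hY := Y3 _ lgf.
rewrite (contractionB cX lg lf) in hX; rewrite (contractionB cY lg lf) -(XY _ fg) in hY.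
have := l2_norm_triangle a_gt0 (X1 _ lf) (Y1 _ lf) (X1 _ lg).
rewrite (l2_distC a_gt0 (X1 _ lf) (X1 _ lg)) => *; lra.
Qed.

Lemma iterC X Y n f : contraction Y -> (forall g, l2 g -> X (Y g) = Y (X g)) -> l2 f ->
  X (iter n Y f) = iter n Y (X f).
Proof.
move=> cY XY lf; elim: n => [//|n IH] /=; rewrite XY ?IH//.
by have [Y1 _ _] := contraction_iter n cY; exact: Y1.
Qed.

(** Telescoping: commuting contractions drift apart at most linearly. *)
Lemma iter_dist X Y n f : contraction X -> contraction Y ->
  (forall g, l2 g -> X (Y g) = Y (X g)) -> l2 f ->
  'N[iter n X f - iter n Y f] <= n%:R * 'N[X f - Y f].
Proof.
move=> cX cY XY lf; have [X1 _ X3] := cX; have [Y1 _ Y3] := cY.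
elim: n => [|n IH]; first by rewrite subrr l2_norm0 mul0r.
have [Xn1 _ _] := contraction_iter n cX; have cYn := contraction_iter n cY.
have [Yn1 _ Yn3] := cYn; rewrite iterS [iter n.+1 Y f]iterSr.
have := l2_norm_triangle a_gt0 (X1 _ (Xn1 _ lf)) (Yn1 _ (Y1 _ lf)) (X1 _ (Yn1 _ lf)).
rewrite -(contractionB cX (Xn1 _ lf) (Yn1 _ lf)) (iterC _ cY XY lf).
rewrite -(contractionB cYn (X1 _ lf) (Y1 _ lf)).
move=> tri; apply: (le_trans tri); rewrite -natr1 mulrDl mul1r.
apply: lerD; last by apply: Yn3; apply: (l2B a_gt0); [exact: X1|exact: Y1].
by apply: le_trans IH; apply: X3; apply: (l2B a_gt0); [exact: Xn1|exact: Yn1].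
Qed.

(** Telescoping again: each step changes the sequence by [h] times an iterate of
    [g], which is close to [g]. *)
Lemma iter_expansion X f g h D n : contraction X -> 0 <= h -> l2 f -> l2 g ->
  X f - f = - (h *: X g) ->
  (forall i, (i <= n)%N -> 'N[g - iter i X g] <= D) ->
  'N[iter n X f - f + (n%:R * h) *: g] <= n%:R * h * D.
Proof.
move=> cX h0 lf lg Xf gD; elim: n gD => [|n IH] gD.
  by rewrite subrr !mul0r scale0r add0r l2_norm0.
have [Xn1 Xn2 _] := contraction_iter n cX; have [X1 _ _] := cX.
have {}IH := IH (fun i hi => gD i (leqW hi)).
have E : iter n.+1 X f - f + (n.+1%:R * h) *: g =
    (iter n X f - f + (n%:R * h) *: g) + h *: (g - iter n.+1 X g).
  have Xe : X f = (- h) *: X g + f by rewrite scaleNr -Xf subrK.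
  rewrite !iterSr Xe Xn2//; last exact: X1.
  rewrite -natr1 mulrDl mul1r scalerDl scaleNr scalerBr.
  move: (iter n X f) (h *: iter n X (X g)) (h *: g) ((n%:R * h) *: g) => x y z w.
  by apply/funext => m; rewrite !fctE; ring.
rewrite E; have ln : l2 (iter n.+1 X g) by have [+ _ _] := contraction_iter n.+1 cX; exact.
have lgi := l2B a_gt0 lg ln.
apply: le_trans (l2_normD a_gt0 _ (l2Z a_gt0 h lgi)) _.
  apply: (l2D a_gt0) (l2Z a_gt0 _ lg); apply: (l2B a_gt0) => //; exact: Xn1.
rewrite (l2_normZ a_gt0 h lgi) ger0_norm// -natr1 !mulrDl mul1r lerD//.
by rewrite ler_wpM2l// gD.
Qed.

End Convergence.

(** * The semigroup as a limit of implicit Euler schemes *)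

Section EulerSemigroup.
Context {R : realType} (a : nat -> R) (a_gt0 : forall n, 0 < a n).
Implicit Types (f g v z : nat -> R) (c h e s t : R) (F : nat -> nat -> R).

Local Notation l2 := (l2 a).
Local Notation "'N[ f ]" := (l2_norm a f) (format "''N[' f ]").
Local Notation J := (resolvent a).
Local Notation gen := (gen a).
Local Notation finsupp := (@finsupp R).
Local Notation contraction := (contraction a).

Lemma contraction_resolvent h : contraction (J h).
Proof.
split=> [f|c f g|f]; [exact: l2_resolvent|exact: resolvent_lin|].
exact: resolvent_contraction.
Qed.

(** The scheme with [2 ^ k] implicit Euler steps: along powers of 2, one step at
    level [k] is compared with exactly two steps at level [k.+1]. *)
Definition euler k t : (nat -> R) -> nat -> R := iter (2 ^ k) (J (t / 2 ^+ k)).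

Definition semigroup t f : nat -> R := fun n => limn (fun k => euler k t f n).

Local Notation T := semigroup.

Lemma contraction_euler k t : contraction (euler k t).
Proof. exact: contraction_iter (contraction_resolvent _). Qed.

Lemma l2_euler k t f : l2 f -> l2 (euler k t f).
Proof. by move=> lf; have [+ _ _] := contraction_euler k t; exact. Qed.

Lemma pow2_inv_le k : (2 ^+ k)^-1 <= k.+1%:R^-1 :> R.
Proof. by rewrite lef_pV2 ?posrE ?exprn_gt0// -natrX ler_nat ltn_expl. Qed.

Lemma step_ge0 k t : 0 <= t -> 0 <= t / 2 ^+ k.
Proof. by move=> t0; rewrite divr_ge0// exprn_ge0. Qed.

(** Both schemes are powers of commuting contractions, and one step of the
    coarse scheme differs from two steps of the fine one at second order. *)
Lemma euler_succ_dist k t f : 0 <= t -> finsupp f ->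
  'N[euler k.+1 t f - euler k t f] <= t ^+ 2 * 'N[gen (gen f)] * (2 ^+ k.+2)^-1.
Proof.
move=> t0 ff; have lf := finsupp_l2 a_gt0 ff.
have fg := finsupp_gen a ff; have fgg := finsupp_gen a fg.
have lgg := finsupp_l2 a_gt0 fgg.
pose s := t / 2 ^+ k.+1; have s0 : 0 <= s by exact: step_ge0.
have ss : s + s = t / 2 ^+ k by rewrite /s exprS; field; rewrite expf_neq0.
have cs := contraction_resolvent s; have css := contraction_comp cs cs.
have -> : euler k.+1 t f = iter (2 ^ k) (J s \o J s) f.
  rewrite /euler -/s expnS mulnC; elim: (2 ^ k)%N => [//|n IH].
  by rewrite mulSn !iterS IH.
rewrite /euler -ss.
apply: le_trans (iter_dist a_gt0 _ css (contraction_resolvent _) _ lf) _.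
  move=> g lg /=; rewrite (resolventC a_gt0 _ (s + s) lg).
  by rewrite (resolventC a_gt0 _ (s + s))//; exact: (l2_resolvent a_gt0).
rewrite natrX.
rewrite (l2_distC a_gt0); [|exact: (l2_resolvent a_gt0 _ (l2_resolvent a_gt0 _ lf))|exact: (l2_resolvent a_gt0)].
have := resolvent_add a_gt0 s0 s0 (finsupp_dom a_gt0 ff) (finsupp_dom a_gt0 fg) lgg.
move=> D; apply: (@le_trans _ _ (2 ^+ k * (s * s * 'N[gen (gen f)]))).
  by rewrite ler_wpM2l ?exprn_ge0.
rewrite /s !exprS le_eqVlt; apply/orP; left; apply/eqP; field.
by rewrite expf_neq0.
Qed.

Lemma euler_dist k m t f : 0 <= t -> finsupp f -> (k <= m)%N ->
  'N[euler m t f - euler k t f] <=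
  t ^+ 2 * 'N[gen (gen f)] * ((2 ^+ k)^-1 - (2 ^+ m)^-1).
Proof.
move=> t0 ff; have lf := finsupp_l2 a_gt0 ff.
elim: m => [|m IH]; first by rewrite leqn0 => /eqP ->; rewrite !subrr l2_norm0 mulr0.
rewrite leq_eqVlt => /predU1P[->|]; first by rewrite !subrr l2_norm0 mulr0.
rewrite ltnS => /IH {}IH.
have tri := l2_norm_triangle a_gt0 (l2_euler m.+1 t lf) (l2_euler k t lf) (l2_euler m t lf).
apply: (le_trans tri); have := euler_succ_dist m t0 ff.
have q0 : 0 <= t ^+ 2 * 'N[gen (gen f)] by rewrite mulr_ge0 ?sqr_ge0 ?l2_norm_ge0.
have p0 : 0 <= (2 ^+ m)^-1 :> R by rewrite invr_ge0 exprn_ge0.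
rewrite !(exprS 2) !invfM; move: IH q0 p0.
move: (2 ^+ m)^-1 (2 ^+ k)^-1 (t ^+ 2 * _) 'N[_ - _] 'N[_ - _] => p q w x y.
move=> h1 w0 p0 h2; have := mulr_ge0 w0 p0. nra.
Qed.

Lemma euler_cvg t f : 0 <= t -> l2 f ->
  l2 (T t f) /\ 'N[euler k t f - T t f] @[k --> \oo] --> (0 : R).
Proof.
move=> t0 lf; apply: (l2_complete a_gt0 (F := fun k => euler k t f)).
  by move=> k; exact: l2_euler.
move=> e e0; have e4 : 0 < e / 4 by rewrite divr_gt0.
have [g fg gf] := finsupp_dense a_gt0 lf e4; have lg := finsupp_l2 a_gt0 fg.
set C := t ^+ 2 * 'N[gen (gen g)].
have C0 : 0 <= C by rewrite mulr_ge0 ?sqr_ge0 ?l2_norm_ge0.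
have C1 : 0 < C + 1 by lra.
have [N NP] := exists_inv_succ_lt (divr_gt0 e4 C1).
have H j : (N <= j)%N -> 'N[euler j t g - euler N t g] <= e / 4.
  move=> Nj; apply: (le_trans (euler_dist t0 fg Nj)); rewrite -/C.
  apply: (@le_trans _ _ (C * (2 ^+ N)^-1)).
    by rewrite ler_wpM2l// lerBlDr lerDl invr_ge0 exprn_ge0.
  apply: (@le_trans _ _ ((C + 1) * (e / 4 / (C + 1)))); last first.
    by rewrite mulrC divfK// gt_eqF.
  apply: ler_pM; [exact: C0|by rewrite invr_ge0 exprn_ge0|by rewrite lerDl|].
  by apply: le_trans (pow2_inv_le N) _; exact: ltW.
have G j : 'N[euler j t f - euler j t g] <= e / 4.
  have [_ _ c3] := contraction_euler j t.
  rewrite -(contractionB (contraction_euler j t) lf lg).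
  apply: (le_trans (c3 _ (l2B a_gt0 lf lg))).
  by rewrite (l2_distC a_gt0 lf lg).
exists N => j k Nj Nk.
have l1 i := l2_euler i t lf; have l3 i := l2_euler i t lg.
have := l2_norm_triangle a_gt0 (l1 j) (l1 k) (l3 j).
have := l2_norm_triangle a_gt0 (l3 j) (l1 k) (l3 N).
have := l2_norm_triangle a_gt0 (l3 N) (l1 k) (l3 k).
have := H _ Nj; have := H _ Nk; have := G j; have := G k.
rewrite (l2_distC a_gt0 (l1 k) (l3 k)) (l2_distC a_gt0 (l3 k) (l3 N)) => *; lra.
Qed.

Lemma l2_semigroup t f : 0 <= t -> l2 f -> l2 (T t f).
Proof. by move=> t0 lf; case: (euler_cvg t0 lf). Qed.

Lemma euler_pointwise t f n : 0 <= t -> l2 f -> euler k t f n @[k --> \oo] --> T t f n.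
Proof.
move=> t0 lf; have [lT eT] := euler_cvg t0 lf.
exact: (l2_strong_pointwise a_gt0 (n := n) (fun k => l2_euler k t lf) lT eT).
Qed.

Lemma contraction_semigroup t : 0 <= t -> contraction (T t).
Proof.
move=> t0; split=> [f lf|c f g lf lg|f lf]; first exact: l2_semigroup.
  apply/funext => n; have cv := euler_pointwise (n := n) t0 (l2_lin a_gt0 c lf lg).
  apply: (cvg_unique (@Rhausdorff R) cv).
  have -> : (fun k => euler k t (c *: f + g) n) = (fun k => c * euler k t f n + euler k t g n).
    by apply/funext => k; have [_ el _] := contraction_euler k t; rewrite el.
  by apply: cvgD; [apply: cvgMr|]; exact: euler_pointwise.
have [lT eT] := euler_cvg t0 lf.
apply: (l2_norm_lim a_gt0 _ lT eT) => k; first exact: l2_euler.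
by have [_ _ c3] := contraction_euler k t; exact: c3.
Qed.

Lemma semigroup_sym t f g : 0 <= t -> l2 f -> l2 g -> l2_inner a (T t f) g = l2_inner a f (T t g).
Proof.
move=> t0 lf lg; have [lTf eTf] := euler_cvg t0 lf; have [lTg eTg] := euler_cvg t0 lg.
have c1 := l2_strong_weak a_gt0 (fun k => l2_euler k t lf) lTf eTf lg.
have c2 := l2_strong_weak a_gt0 (fun k => l2_euler k t lg) lTg eTg lf.
rewrite [RHS]l2_innerC; apply: (cvg_unique (@Rhausdorff R) c1).
rewrite (_ : (fun k => _) = (fun k => l2_inner a (euler k t g) f))//.
apply/funext => k; rewrite [RHS]l2_innerC /euler; elim: (2 ^ k)%N f lf {lTf eTf c1 c2} => [//|n IH] f lf.
rewrite iterSr IH; last exact: (l2_resolvent a_gt0).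
rewrite iterS (resolvent_sym a_gt0) //.
have [+ _ _] := contraction_iter n (contraction_resolvent (t / 2 ^+ k)); exact.
Qed.

Lemma semigroup0 f : T 0 f = f.
Proof.
apply/funext => n; apply: cvg_lim; first exact: Rhausdorff.
rewrite (_ : (fun k => _) = (fun=> f n)); first exact: cvg_cst.
apply/funext => k; congr (_ n); rewrite /euler mul0r.
by elim: (2 ^ k)%N => [//|m /= ->]; rewrite resolvent_id.
Qed.

Lemma l2_norm_chain f1 f2 f3 f4 f5 : l2 f1 -> l2 f2 -> l2 f3 -> l2 f4 -> l2 f5 ->
  'N[f1 - f5] <= 'N[f2 - f1] + 'N[f2 - f3] + 'N[f3 - f4] + 'N[f4 - f5].
Proof.
move=> l1 l2 l3 l4 l5; rewrite (l2_distC a_gt0 l2 l1).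
have := l2_norm_triangle a_gt0 l1 l5 l2; have := l2_norm_triangle a_gt0 l2 l5 l3.
have := l2_norm_triangle a_gt0 l3 l5 l4; lra.
Qed.

(** At each level the schemes for the two times can be interleaved; a step of the
    interleaved scheme agrees with one for the total time at second order. *)
Lemma semigroupD s t f : 0 <= s -> 0 <= t -> l2 f -> T (s + t) f = T s (T t f).
Proof.
move=> s0 t0; move: f; have st0 : 0 <= s + t by exact: addr_ge0.
apply: (contraction_eq a_gt0 (contraction_semigroup st0)
  (contraction_comp (contraction_semigroup s0) (contraction_semigroup t0))) => f ff /=.
have lf := finsupp_l2 a_gt0 ff; have fg := finsupp_gen a ff.
have lgg := finsupp_l2 a_gt0 (finsupp_gen a fg).
have [l1 /(cvg_seq0P (fun=> l2_norm_ge0 _ _)) e1] := euler_cvg st0 lf.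
have [l2' /(cvg_seq0P (fun=> l2_norm_ge0 _ _)) e2] := euler_cvg t0 lf.
have [l3 /(cvg_seq0P (fun=> l2_norm_ge0 _ _)) e3] := euler_cvg s0 l2'.
set C := s * t * 'N[gen (gen f)].
have C0 : 0 <= C by rewrite mulr_ge0 ?l2_norm_ge0// mulr_ge0.
have D k : 'N[euler k (s + t) f - euler k s (euler k t f)] <= C / 2 ^+ k.
  have cs h := contraction_resolvent h.
  have -> : euler k s (euler k t f) = iter (2 ^ k) (J (s / 2 ^+ k) \o J (t / 2 ^+ k)) f.
    rewrite /euler; elim: (2 ^ k)%N => [//|n IH]; rewrite iterS [in RHS]iterS -IH /=.
    congr (J _ _); rewrite -(iterC _ (cs _))//; first by move=> g; exact: resolventC.
    have [+ _ _] := contraction_iter n (cs (t / 2 ^+ k)); exact.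
  rewrite {1}/euler.
  apply: le_trans (iter_dist a_gt0 _ (cs _) (contraction_comp (cs _) (cs _)) _ lf) _.
    move=> g lg /=; rewrite (resolventC a_gt0 _ _ (l2_resolvent a_gt0 _ lg)).
    by congr (J _ _); exact: (resolventC a_gt0).
  rewrite natrX mulrDl.
  have := resolvent_add a_gt0 (step_ge0 k s0) (step_ge0 k t0) (finsupp_dom a_gt0 ff) (finsupp_dom a_gt0 fg) lgg.
  move=> H; apply: (@le_trans _ _ (2 ^+ k * (s / 2 ^+ k * (t / 2 ^+ k) * 'N[gen (gen f)]))).
    by rewrite ler_wpM2l ?exprn_ge0.
  rewrite /C le_eqVlt; apply/orP; left; apply/eqP; field.
  by rewrite expf_neq0.
apply: (l2_eq_eps a_gt0 l1 l3) => e e0; have e4 : 0 < e / 4 by rewrite divr_gt0.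
have [N1 {}e1] := e1 _ e4; have [N2 {}e2] := e2 _ e4; have [N3 {}e3] := e3 _ e4.
have C1 : 0 < C + 1 by lra.
have [N4 e5] := exists_inv_succ_lt (divr_gt0 e4 C1).
pose k := maxn (maxn N1 N2) (maxn N3 N4).
have k1 : (N1 <= k)%N by rewrite !leq_max leqnn.
have k2 : (N2 <= k)%N by rewrite !leq_max leqnn !orbT.
have k3 : (N3 <= k)%N by rewrite !leq_max leqnn !orbT.
have k4 : (N4 <= k)%N by rewrite !leq_max leqnn !orbT.
have {}D : 'N[euler k (s + t) f - euler k s (euler k t f)] <= e / 4.
  apply: (le_trans (D k)); apply: (@le_trans _ _ ((C + 1) * (e / 4 / (C + 1)))); last first.
    by rewrite mulrC divfK// gt_eqF.
  apply: ler_pM; [exact: C0|by rewrite invr_ge0 exprn_ge0|by rewrite lerDl|].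
  apply: le_trans (pow2_inv_le k) _; apply: ltW; apply: le_lt_trans e5.
  by rewrite lef_pV2 ?posrE// ler_nat ltnS.
have lk1 := l2_euler k (s + t) lf; have lk2 := l2_euler k t lf.
have lk3 := l2_euler k s lk2; have lk4 := l2_euler k s l2'.
have [_ _ c3] := contraction_euler k s.
have c4 := le_trans (c3 _ (l2B a_gt0 lk2 l2')) (e2 _ k2).
rewrite (contractionB (contraction_euler k s) lk2 l2') in c4.
apply: le_trans (l2_norm_chain l1 lk1 lk3 lk4 l3) _.
have -> : e = e / 4 + e / 4 + e / 4 + e / 4 by field.
exact: (lerD (lerD (lerD (e1 _ k1) D) c4) (e3 _ k3)).
Qed.

End EulerSemigroup.

(** * The semigroup associated with the trace form *)

Section SemigroupOfTheForm.
Context {R : realType} (a : nat -> R) (a_gt0 : forall n, 0 < a n).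
Implicit Types (f g u v z : nat -> R) (c h e s t : R) (F : nat -> nat -> R).

Local Notation l2 := (l2 a).
Local Notation "'N[ f ]" := (l2_norm a f) (format "''N[' f ]").
Local Notation J := (resolvent a).
Local Notation gen := (gen a).
Local Notation finsupp := (@finsupp R).
Local Notation contraction := (contraction a).
Local Notation trace_dom := (trace_dom a).
Local Notation T := (semigroup a).
Local Notation euler := (euler a).

Lemma iter_id_dist X n f : contraction X -> l2 f ->
  'N[iter n X f - f] <= n%:R * 'N[X f - f].
Proof.
move=> cX lf; have cid : contraction id by split.
have -> : iter n X f - f = iter n X f - iter n id f by congr (_ - _); elim: n.
exact: (iter_dist a_gt0 n cX cid).
Qed.

Lemma resolvent_iter_dist h i u : 0 <= h -> finsupp u ->
  'N[iter i (J h) u - u] <= i%:R * h * 'N[gen u].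
Proof.
move=> h0 fu; have lu := finsupp_l2 a_gt0 fu.
apply: le_trans (iter_id_dist _ (contraction_resolvent a_gt0 h) lu) _.
rewrite -mulrA ler_wpM2l//; apply: (resolvent_id_dist a_gt0) => //.
  exact: (finsupp_dom a_gt0).
exact: (finsupp_l2 a_gt0) (finsupp_gen a fu).
Qed.

Lemma semigroup_id_dist t f : 0 <= t -> finsupp f -> 'N[T t f - f] <= t * 'N[gen f].
Proof.
move=> t0 ff; have lf := finsupp_l2 a_gt0 ff; have [lT eT] := euler_cvg a_gt0 t0 lf.
apply: (@l2_norm_lim _ _ a_gt0 (fun k => euler k t f - f) (T t f - f)).
- by move=> k; apply: (l2B a_gt0) => //; exact: l2_euler.
- exact: (l2B a_gt0).
- rewrite (_ : (fun k => _) = (fun k => 'N[euler k t f - T t f]))//.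
  by apply/funext => k; rewrite opprB addrA subrK.
- move=> k; apply: le_trans (resolvent_iter_dist _ (step_ge0 k t0) ff) _.
  by rewrite natrX mulrCA mulfV ?mulr1// expf_neq0.
Qed.

(** The error is first order in [t] when [gen f] is itself regular; the finitely
    supported [u] stands in for it otherwise. *)
Lemma semigroup_expansion t f u : 0 <= t -> trace_dom f -> l2 (gen f) -> finsupp u ->
  'N[T t f - f + t *: gen f] <= t * (2 * 'N[u - gen f] + t * 'N[gen u]).
Proof.
move=> t0 df lg fu; have [lf _ _] := df; have lu := finsupp_l2 a_gt0 fu.
have [lT eT] := euler_cvg a_gt0 t0 lf; have ltg := l2Z a_gt0 t lg.
apply: (@l2_norm_lim _ _ a_gt0 (fun k => euler k t f - f + t *: gen f) (T t f - f + t *: gen f)).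
- move=> k; apply: (l2D a_gt0) => //; apply: (l2B a_gt0) => //; exact: l2_euler.
- by apply: (l2D a_gt0) => //; exact: (l2B a_gt0).
- rewrite (_ : (fun k => _) = (fun k => 'N[euler k t f - T t f]))//.
  apply/funext => k; congr 'N[_]; move: (euler k t f) (T t f) (t *: gen f) => x y w.
  by apply/funext => m; rewrite !fctE; ring.
- move=> k; set h := t / 2 ^+ k; have h0 : 0 <= h by exact: step_ge0.
  have hk : (2 ^ k)%:R * h = t by rewrite natrX mulrCA mulfV ?mulr1// expf_neq0.
  have cJ := contraction_resolvent a_gt0 h.
  suff D i : (i <= 2 ^ k)%N -> 'N[gen f - iter i (J h) (gen f)] <= 2 * 'N[u - gen f] + t * 'N[gen u].
    have := iter_expansion a_gt0 cJ h0 lf lg (resolvent_sub a_gt0 h0 df lg) D.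
    by rewrite hk.
  move=> ik; have cJi := contraction_iter i cJ; have [c1 _ c3] := cJi.
  have lgi := c1 _ lg; have lui := c1 _ lu.
  have b1 := l2_norm_triangle a_gt0 lg lgi lu; have b2 := l2_norm_triangle a_gt0 lu lgi lui.
  have b3 := c3 _ (l2B a_gt0 lu lg); rewrite (contractionB cJi lu lg) in b3.
  have b4 := resolvent_iter_dist i h0 fu.
  have b5 : i%:R * h * 'N[gen u] <= t * 'N[gen u].
    by rewrite ler_wpM2r ?l2_norm_ge0// -hk ler_wpM2r// ler_nat.
  rewrite (l2_distC a_gt0 lg lu) in b1; rewrite (l2_distC a_gt0 lu lui) in b2.
  apply: (le_trans b1); rewrite mulr2n mulrDl mul1r -addrA lerD2l.
  by apply: (le_trans b2); rewrite addrC; apply: lerD => //; exact: (le_trans b4).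
Qed.

Lemma quotientE h u g : 0 < h -> l2 u -> l2 g ->
  'N[h^-1 *: u + g] = h^-1 * 'N[u + h *: g].
Proof.
move=> h0 lu lg; have E : h^-1 *: u + g = h^-1 *: (u + h *: g).
  by rewrite scalerDr scalerA mulVf ?scale1r// gt_eqF.
rewrite E (l2_normZ a_gt0 _ (l2D a_gt0 lu (l2Z a_gt0 h lg))) ger0_norm//.
by rewrite invr_ge0 ltW.
Qed.

Lemma l2_quotient t f g : 0 <= t -> l2 f -> l2 g -> l2 (t^-1 *: (T t f - f) + g).
Proof.
move=> t0 lf lg; apply: (l2_lin a_gt0) => //; apply: (l2B a_gt0) => //.
exact: (l2_semigroup a_gt0).
Qed.

Lemma semigroup_generator f : trace_dom f -> l2 (gen f) ->
  'N[t^-1 *: (T t f - f) + gen f] @[t --> 0^'+] --> (0 : R).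
Proof.
move=> df lg; have [lf _ _] := df.
apply/(cvg_right0P (fun=> l2_norm_ge0 _ _)) => e e0.
have e4 : 0 < e / 4 by rewrite divr_gt0.
have e2 : 0 < e / 2 by rewrite divr_gt0.
have [u fu ug] := finsupp_dense a_gt0 lg e4.
have C1 : 0 < 'N[gen u] + 1 by have := l2_norm_ge0 a (gen u); lra.
exists (e / 2 / ('N[gen u] + 1)); first by rewrite divr_gt0.
move=> t t0 td; have lT := l2_semigroup a_gt0 (ltW t0) lf.
rewrite quotientE//; last exact: (l2B a_gt0).
rewrite ler_pdivrMl//; apply: le_trans (semigroup_expansion (ltW t0) df lg fu) _.
rewrite ler_wpM2l// ?(ltW t0)//.
have h1 : t * 'N[gen u] <= e / 2.
  move: td; rewrite ltr_pdivlMr// => /ltW; apply: le_trans.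
  by rewrite ler_wpM2l ?(ltW t0)// lerDl.
by move: ug h1; move: 'N[_] ('N[_]) => x y; lra.
Qed.

(** By symmetry, [g] pairs with [v] as [f] pairs with [gen v]. The resolvents of
    the unit sequences are enough such [v] to identify [f] with the resolvent
    of [f + g]. *)
Lemma semigroup_generator_inv f g : l2 f -> l2 g ->
  'N[t^-1 *: (T t f - f) + g] @[t --> 0^'+] --> (0 : R) ->
  trace_dom f /\ g = gen f.
Proof.
move=> lf lg /(cvg_right0P (fun=> l2_norm_ge0 _ _)) H.
have dual v : trace_dom v -> l2 (gen v) -> l2_inner a g v = l2_inner a f (gen v).
  move=> dv lgv; have [lv _ _] := dv.
  have := semigroup_generator dv lgv => /(cvg_right0P (fun=> l2_norm_ge0 _ _)) H'.
  have small e : 0 < e -> `|l2_inner a g v - l2_inner a f (gen v)| <= e * 'N[v] + 'N[f] * e.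
    move=> e0; have [d1 d10 {}H] := H e e0; have [d2 d20 {}H'] := H' e e0.
    pose t := Num.min d1 d2 / 2.
    have m0 : 0 < Num.min d1 d2 by rewrite lt_min d10.
    have t0 : 0 < t by rewrite divr_gt0.
    have tm : t < Num.min d1 d2 by rewrite /t; lra.
    have := tm; rewrite lt_min => /andP[td1 td2].
    have {}H := H t t0 td1; have {}H' := H' t t0 td2.
    have lTf := l2B a_gt0 (l2_semigroup a_gt0 (ltW t0) lf) lf.
    have lTv := l2B a_gt0 (l2_semigroup a_gt0 (ltW t0) lv) lv.
    have lq1 := l2_quotient (ltW t0) lf lg; have lq2 := l2_quotient (ltW t0) lv lgv.
    have -> : l2_inner a g v - l2_inner a f (gen v) =
        l2_inner a (t^-1 *: (T t f - f) + g) v - l2_inner a f (t^-1 *: (T t v - v) + gen v).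
      rewrite (l2_inner_linl a_gt0 _ lTf lg lv).
      rewrite (l2_innerDr a_gt0 (l2Z a_gt0 _ lTv) lgv lf) (l2_innerZr a_gt0 _ lTv lf).
      rewrite (l2_innerBl a_gt0 (l2_semigroup a_gt0 (ltW t0) lf) lf lv).
      rewrite (l2_innerBr a_gt0 (l2_semigroup a_gt0 (ltW t0) lv) lv lf).
      rewrite (semigroup_sym a_gt0 (ltW t0) lf lv).
      by move: (l2_inner a f (T t v)) (l2_inner a f v) (l2_inner a g v) (l2_inner a f _) => x y w r; ring.
    apply: le_trans (ler_normB _ _) _; apply: lerD.
      apply: le_trans (l2_CauchySchwarz a_gt0 lq1 lv) _.
      by rewrite ler_wpM2r ?l2_norm_ge0.
    apply: le_trans (l2_CauchySchwarz a_gt0 lf lq2) _.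
    by rewrite ler_wpM2l ?l2_norm_ge0.
  apply/eqP; rewrite -subr_eq0 -normr_le0; apply: le_eps => e e0; rewrite add0r.
  have C1 : 0 < 'N[v] + 'N[f] + 1.
    by have := l2_norm_ge0 a v; have := l2_norm_ge0 a f; lra.
  apply: (le_trans (small _ (divr_gt0 e0 C1))).
  rewrite [X in _ + X]mulrC -mulrDr mulrAC ler_pdivrMr// ler_wpM2l ?(ltW e0)//.
  by rewrite lerDl.
have fE : f = J 1 (f + g).
  apply/funext => n; have lu := l2_unit a_gt0 n.
  have [dv vE] := resolventP a_gt0 ltr01 lu; have lgv := l2_gen_resolvent a_gt0 ltr01 lu.
  have [lv _ _] := dv; have lfg := l2D a_gt0 lf lg.
  apply: (@mulfI _ (a n)); first by rewrite gt_eqF.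
  rewrite -!l2_inner_unit (resolvent_sym a_gt0 1 lfg lu) -{1}vE scale1r.
  rewrite (l2_innerDr a_gt0 lv lgv lf) (l2_innerDl a_gt0 lf lg lv).
  by rewrite (dual _ dv lgv).
have lfg := l2D a_gt0 lf lg; split; first by rewrite fE; exact: (resolvent_dom a_gt0 ltr01).
by rewrite {1}fE (gen_resolvent a_gt0 ltr01 lfg) -fE invr1 scale1r addrAC subrr add0r.
Qed.

Lemma semigroup_strong_cvg f : l2 f -> 'N[T t f - f] @[t --> 0^'+] --> (0 : R).
Proof.
move=> lf; apply/(cvg_right0P (fun=> l2_norm_ge0 _ _)) => e e0.
have e4 : 0 < e / 4 by rewrite divr_gt0.
have e2 : 0 < e / 2 by rewrite divr_gt0.
have [u fu uf] := finsupp_dense a_gt0 lf e4; have lu := finsupp_l2 a_gt0 fu.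
have C1 : 0 < 'N[gen u] + 1 by have := l2_norm_ge0 a (gen u); lra.
exists (e / 2 / ('N[gen u] + 1)); first by rewrite divr_gt0.
move=> t t0 td; have [c1 _ c3] := contraction_semigroup a_gt0 (ltW t0).
have h1 : 'N[T t u - u] <= e / 2.
  apply: le_trans (semigroup_id_dist (ltW t0) fu) _.
  move: td; rewrite ltr_pdivlMr// => /ltW; apply: le_trans.
  by rewrite ler_wpM2l ?(ltW t0)// lerDl.
have h2 := le_trans (c3 _ (l2B a_gt0 lu lf)) uf.
rewrite (contractionB (contraction_semigroup a_gt0 (ltW t0)) lu lf) in h2.
have lTu := c1 _ lu; have lTf := c1 _ lf.
rewrite (l2_distC a_gt0 lTu lTf) in h2.
apply: le_trans (l2_norm_triangle a_gt0 lTf lf lTu) _.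
apply: (le_trans (lerD h2 (l2_norm_triangle a_gt0 lTu lf lu))).
by move: h1 uf; move: 'N[_] 'N[_] => x y; lra.
Qed.

Theorem semigroup_form : form_semigroup a (discrete_form a) T.
Proof.
split.
- split=> [t f t0 lf|t c f g t0 lf lg|t f t0 lf|t f g t0 lf lg].
  + exact: (l2_semigroup a_gt0).
  + by have [_ c2 _] := contraction_semigroup a_gt0 t0; exact: c2.
  + by have [_ _ c3] := contraction_semigroup a_gt0 t0; exact: c3.
  + exact: (semigroup_sym a_gt0).
- by move=> f _; exact: semigroup0.
- by move=> s t f s0 t0 lf; exact: (semigroupD a_gt0).
- exact: semigroup_strong_cvg.
- move=> f g lf lg; rewrite (form_operatorE a_gt0); split=> [|[df _ gE]].
    by move=> /(semigroup_generator_inv lf lg)[].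
  by rewrite gE; apply: semigroup_generator => //; rewrite -gE.
Qed.

(** * Uniqueness of the semigroup *)

Section Uniqueness.
Variable U : R -> (nat -> R) -> nat -> R.
Hypothesis UP : form_semigroup a (discrete_form a) U.

Let contraction_U h : 0 <= h -> contraction (U h).
Proof. by case: UP => [[U1 U2 U3 _] _ _ _ _] h0; split=> *; [exact: U1|exact: U2|exact: U3]. Qed.

Let iter_U n h f : 0 <= h -> l2 f -> iter n (U h) f = U (n%:R * h) f.
Proof.
case: UP => [[U1 _ _ _] U0 UD _ _] h0 lf; elim: n => [|n IH]; first by rewrite mul0r U0.
rewrite iterS IH -UD//; last by rewrite mulr_ge0.
by rewrite -natr1 mulrDl mul1r addrC.
Qed.

Let U_generator f : trace_dom f -> l2 (gen f) ->
  'N[t^-1 *: (U t f - f) + gen f] @[t --> 0^'+] --> (0 : R).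
Proof.
case: UP => [_ _ _ _ UG] df lg; have [lf _ _] := df.
by apply/(UG _ _ lf lg)/(form_operatorE a_gt0).
Qed.

Let U_gen h f : 0 <= h -> trace_dom f -> l2 (gen f) ->
  trace_dom (U h f) /\ U h (gen f) = gen (U h f).
Proof.
move=> h0 df lg; have [lf _ _] := df; have [U1 U2 U3] := contraction_U h0.
case: UP => [[_ _ _ _] _ UD _ UG].
have : form_operator a (discrete_form a) (U h f) (U h (gen f)).
  apply/(UG _ _ (U1 _ lf) (U1 _ lg))/(cvg_right0P (fun=> l2_norm_ge0 _ _)) => e.
  have /(cvg_right0P (fun=> l2_norm_ge0 _ _)) H := U_generator df lg.
  move=> /H[d d0 dP]; exists d => // t t0 td.
  have [V1 _ _] := contraction_U (ltW t0); have lUf := V1 _ lf.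
  have lB := l2B a_gt0 lUf lf.
  have -> : t^-1 *: (U t (U h f) - U h f) + U h (gen f) = U h (t^-1 *: (U t f - f) + gen f).
    rewrite U2// (contractionB (contraction_U h0) lUf lf) -!UD//; try exact: ltW.
    by rewrite [t + h]addrC.
  by apply: le_trans (dP _ t0 td); apply: U3; exact: (l2_lin a_gt0).
by rewrite (form_operatorE a_gt0) => -[].
Qed.

Let U_resolvent h s g : 0 <= h -> l2 g -> U h (J s g) = J s (U h g).
Proof.
move=> h0 lg; have [s0|s0] := ltP 0 s; last by rewrite !(resolvent_id _ _ s0).
have [dy yE] := resolventP a_gt0 s0 lg; have lgy := l2_gen_resolvent a_gt0 s0 lg.
have [ly _ _] := dy; have [U1 U2 _] := contraction_U h0.
have [dU UE] := U_gen h0 dy lgy.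
rewrite -{2}yE [X in J s (U h X)]addrC U2// UE addrC (resolvent_eq a_gt0)//.
by rewrite -UE; exact: U1.
Qed.

(** Both the given semigroup and the implicit Euler scheme agree with the
    first-order expansion of a finitely supported sequence up to [o(h)]. *)
Lemma semigroup_unique t f : 0 <= t -> finsupp f -> U t f = T t f.
Proof.
move=> t0 ff; have lf := finsupp_l2 a_gt0 ff; have [Ut1 _ _] := contraction_U t0.
have df := finsupp_dom a_gt0 ff; have fg := finsupp_gen a ff.
have lg := finsupp_l2 a_gt0 fg; have lgg := finsupp_l2 a_gt0 (finsupp_gen a fg).
have [lT /(cvg_seq0P (fun=> l2_norm_ge0 _ _)) eT] := euler_cvg a_gt0 t0 lf.
have := t0; rewrite le_eqVlt => /predU1P[<-|tp].
  by rewrite semigroup0; case: UP => [_ U0 _ _ _]; rewrite U0.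
have /(cvg_right0P (fun=> l2_norm_ge0 _ _)) UG := U_generator df lg.
apply: (l2_eq_eps a_gt0 (Ut1 _ lf) lT) => e e0.
have e3 : 0 < e / 3 by rewrite divr_gt0.
have [d d0 {}UG] := UG _ (divr_gt0 e3 tp).
have [N1 {}eT] := eT _ e3.
pose C := 'N[gen (gen f)]; have C0 : 0 <= C by exact: l2_norm_ge0.
have C1 : 0 < t * (t * C + 1) by rewrite mulr_gt0// ltr_wpDl// mulr_ge0.
have [N2 H2] := exists_inv_succ_lt (divr_gt0 d0 tp).
have [N3 H3] := exists_inv_succ_lt (divr_gt0 e3 C1).
pose k := maxn N1 (maxn N2 N3); pose h := t / 2 ^+ k.
have p0 : 0 < 2 ^+ k :> R by rewrite exprn_gt0.
have hp : 0 < h by rewrite divr_gt0.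
have hk : (2 ^ k)%:R * h = t by rewrite natrX mulrCA mulfV ?mulr1// expf_neq0.
have pk N : (N <= k)%N -> (2 ^+ k)^-1 <= N.+1%:R^-1 :> R.
  by move=> Nk; apply: le_trans (@pow2_inv_le R k) _; rewrite lef_pV2 ?posrE// ler_nat ltnS.
have hd : h < d.
  rewrite /h mulrC -ltr_pdivlMr//; apply: le_lt_trans H2; apply: pk.
  by rewrite !leq_max leqnn orbT.
have thC : t * h * C <= e / 3.
  have : (2 ^+ k)^-1 <= e / 3 / (t * (t * C + 1)).
    by apply: le_trans (ltW H3); apply: pk; rewrite !leq_max leqnn !orbT.
  rewrite ler_pdivlMr//; apply: le_trans.
  rewrite /h [t / _]mulrC mulrCA -!mulrA ler_wpM2l ?invr_ge0 ?(ltW p0)//.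
  by rewrite ler_wpM2l// lerDl.
have {}eT := eT k (leq_maxl _ _).
have [Uh1 _ _] := contraction_U (ltW hp).
have lUh := Uh1 _ lf; have lJh := l2_resolvent a_gt0 h lf.
have step : 'N[U h f - J h f] <= h * (e / 3 / t) + h ^+ 2 * C.
  have -> : U h f - J h f = (U h f - f + h *: gen f) - (J h f - f + h *: gen f).
    move: (U h f) (J h f) (h *: gen f) => x y w.
    by apply/funext => m; rewrite !fctE; ring.
  have lhg := l2Z a_gt0 h lg.
  have lA := l2D a_gt0 (l2B a_gt0 lUh lf) lhg; have lB := l2D a_gt0 (l2B a_gt0 lJh lf) lhg.
  apply: le_trans (l2_normB a_gt0 lA lB) _; apply: lerD.
    have := UG h hp hd; rewrite (quotientE hp (l2B a_gt0 lUh lf) lg).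
    by rewrite ler_pdivrMl.
  by apply: (resolvent_expansion a_gt0 (ltW hp) df) => //; exact: (finsupp_dom a_gt0).
have main : 'N[U t f - euler k t f] <= e / 3 + e / 3.
  rewrite -{1}hk -iter_U//; last exact: ltW.
  apply: le_trans (iter_dist a_gt0 _ (contraction_U (ltW hp)) (contraction_resolvent a_gt0 _) _ lf) _.
    by move=> g lg'; apply: U_resolvent => //; exact: ltW.
  apply: (le_trans (ler_wpM2l (ler0n _ _) step)).
  have expand (n x y z : R) : n * (x * y + x ^+ 2 * z) = n * x * y + n * x * x * z by ring.
  rewrite expand hk; apply: lerD => //.
  by rewrite mulrC divfK// gt_eqF.
apply: le_trans (l2_norm_triangle a_gt0 (Ut1 _ lf) lT (l2_euler a_gt0 k t lf)) _.
have -> : e = e / 3 + e / 3 + e / 3 by field.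
exact: lerD.
Qed.

End Uniqueness.

End SemigroupOfTheForm.

(** * Conservativeness *)

Section Conservativeness.
Context {R : realType} (a : nat -> R) (a_gt0 : forall n, 0 < a n).
Implicit Types (f g v z : nat -> R) (c h e s t : R).

Local Notation b := (@conductance R).
Local Notation l2 := (l2 a).
Local Notation J := (resolvent a).
Local Notation gen := (gen a).
Local Notation finsupp := (@finsupp R).
Local Notation T := (semigroup a).
Local Notation euler := (euler a).
Let b_gt0 := @conductance_gt0 R.
Let a_neq0 n : a n != 0. Proof. by rewrite gt_eqF. Qed.
Let b_neq0 n : b n != 0. Proof. by rewrite gt_eqF// b_gt0. Qed.

(** The solution of [gen V = -1] that starts from 0: the flux through an edge is
    the mass to its left. It is bounded exactly in the non-conservative case. *)
Definition potential n : R := \sum_(0 <= i < n) (\sum_(0 <= k < i.+1) a k) / b i.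

Local Notation V := potential.

Lemma flux_potential n : flux V n = \sum_(0 <= k < n.+1) a k.
Proof.
rewrite /flux /increment /potential (big_nat_recr n)//= addrAC subrr add0r.
by rewrite mulrC divfK.
Qed.

Lemma gen_potential n : gen V n = -1.
Proof.
rewrite /gen; have -> : flux_in V n - flux V n = - a n.
  case: n => [|n]; rewrite /flux_in !flux_potential.
    by rewrite big_nat1 sub0r.
  by rewrite [X in _ - X]big_nat_recr//= opprD addrA subrr add0r.
by rewrite mulNr divff.
Qed.

Lemma gen_affine c e n : gen (fun m => c + e * V m) n = - e.
Proof.
rewrite -[RHS]mulrN1 -(gen_potential n) /gen mulrA; congr (_ / _).
have fl m : flux (fun m => c + e * V m) m = e * flux V m.
  by rewrite /flux /increment; ring.
by rewrite mulrBr -fl; case: n => [|n]; rewrite /flux_in ?mulr0// fl.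
Qed.

Lemma potential_ge0 n : 0 <= V n.
Proof.
apply: sumr_ge0 => i _; apply: divr_ge0; last exact: ltW.
by apply: sumr_ge0 => k _; exact: ltW.
Qed.

Lemma potential_nondecreasing : nondecreasing_seq V.
Proof.
apply/nondecreasing_seqP => n; rewrite /potential big_nat_recr//= lerDl.
apply: divr_ge0; last exact: ltW.
by apply: sumr_ge0 => k _; exact: ltW.
Qed.

Let inv_b n : (b n)^-1 = n.+1%:R^-1 - n.+2%:R^-1.
Proof. by rewrite /conductance -[n.+2%:R]natr1 inv_sub_succ// natr1. Qed.

(** Exchange of summation, with the telescoping of the inverse conductances. *)
Lemma potentialE N : V N = \sum_(0 <= k < N) a k * (k.+1%:R^-1 - N.+1%:R^-1).
Proof.
elim: N => [|N IH]; first by rewrite /potential !big_geq.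
rewrite /potential big_nat_recr//= -/(V N) IH mulr_suml big_nat_recr//= [RHS]big_nat_recr//=.
rewrite addrA -big_split/=; congr (_ + _); last first.
  by rewrite inv_b.
apply: eq_bigr => k _; rewrite -mulrDr; congr (_ * _).
by rewrite inv_b addrA subrK.
Qed.

Lemma potential_le N : V N <= \sum_(0 <= k < N) a k / k.+1%:R.
Proof.
rewrite potentialE; apply: ler_sum => k _; rewrite ler_wpM2l ?(ltW (a_gt0 k))//.
by rewrite gerBl invr_ge0.
Qed.

(** The first half of the terms loses at most the factor 2. *)
Lemma potential_ge M : (\sum_(0 <= k < M) a k / k.+1%:R) / 2 <= V (M + M).
Proof.
rewrite potentialE (big_cat_nat (leq0n M) (leq_addr M M))/= mulr_suml.
have nn : 0 <= \sum_(M <= k < M + M) a k * (k.+1%:R^-1 - (M + M).+1%:R^-1).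
  rewrite big_nat; apply: sumr_ge0 => k /andP[_ kM]; apply: mulr_ge0; first exact: ltW.
  by rewrite subr_ge0 lef_pV2 ?posrE// ler_nat ltnS ltnW.
apply: ler_wpDr => //; rewrite !big_nat; apply: ler_sum => k /andP[_ kM].
rewrite -mulrA ler_wpM2l ?(ltW (a_gt0 k))// lerBrDr -lerBrDl.
have -> : k.+1%:R^-1 - k.+1%:R^-1 / 2 = (k.+1 + k.+1)%:R^-1 :> R.
  have -> : (k.+1 + k.+1)%:R = k.+1%:R * 2 :> R by rewrite natrD; ring.
  by rewrite invfM; move: _^-1 => x; lra.
by rewrite lef_pV2 ?posrE// ler_nat addSn ltnS addnS -addSn leq_add// ltnW.
Qed.

(** * Comparison for the implicit Euler scheme *)

Lemma iter_resolvent_l2 k h f : l2 f -> l2 (iter k (J h) f).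
Proof. by move=> lf; elim: k => [//|k IH]; exact: (l2_resolvent a_gt0). Qed.

Lemma iter_resolvent_le1 k h f n : 0 < h -> l2 f -> (forall n, f n <= 1) ->
  iter k (J h) f n <= 1.
Proof.
move=> h0 lf f1; elim: k n => [//|k IH] n /=.
have one m : gen (fun=> 1) m = 0.
  by rewrite /gen /flux_in /flux /increment; case: m => [|m]; rewrite !subrr !mulr0 subrr mul0r.
apply: (resolvent_le a_gt0 (z := fun=> 1) h0 (iter_resolvent_l2 k h lf)) => [m|e e0].
  by rewrite one mulr0 addr0.
by exists 0%N => m _; lra.
Qed.

(** The function [1 - e (V + t)] solves the heat equation and is negative far
    out, so it stays below the scheme. *)
Lemma iter_resolvent_ge k h f e n : 0 < h -> 0 < e -> l2 f ->
  (forall C, exists N, forall n, (N <= n)%N -> C <= V n) ->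
  (forall n, 1 - e * V n <= f n) -> 1 - e * (V n + k%:R * h) <= iter k (J h) f n.
Proof.
move=> h0 e0 lf Voo fV; elim: k n => [|k IH] n; first by rewrite mul0r addr0.
have lk := iter_resolvent_l2 k h lf.
pose z m : R := (- 1 + e * (k.+1%:R * h)) + e * V m.
have H : J h (- iter k (J h) f) n <= z n.
  apply: (resolvent_le a_gt0 h0 (l2N a_gt0 lk)) => [m|r r0].
    rewrite gen_affine -[(- _) m]/(- iter k (J h) f m); have := IH m.
    rewrite /z -natr1; move: (V m) (iter _ _ _ _) => x y; nra.
  have [N NP] := Voo e^-1; exists N => m /NP; rewrite -[e^-1]mulr1 ler_pdivrMl// /z => Vm.
  have : 0 <= e * (k.+1%:R * h) by rewrite !mulr_ge0// ltW.
  lra.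
move: H; rewrite -scaleN1r -[_ *: _]addr0 (resolvent_lin a_gt0 _ _ lk (l2_0 a_gt0)).
have -> : J h 0 = 0.
  by have := resolvent_lin a_gt0 h (-1) (l2_0 a_gt0) (l2_0 a_gt0); rewrite !scaleN1r !addNr.
rewrite addr0 scaleN1r -[(- _) n]/(- J h (iter k (J h) f) n) /z iterS.
by move: (J h _ n) (V n) => x y; lra.
Qed.

(** For data bounded by 1, time multiplied by the scheme is a subsolution of the
    heat equation with source 1, of which [v] is a stationary solution. *)
Lemma iter_resolvent_lifetime k h f v n : 0 < h -> l2 f -> (forall n, f n <= 1) ->
  (forall n, 0 <= v n) -> (forall n, gen v n = 1) ->
  k%:R * h * iter k (J h) f n <= v n.
Proof.
move=> h0 lf f1 v0 v1; elim: k n => [|k IH] n; first by rewrite !mul0r.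
have lk := iter_resolvent_l2 k h lf.
have -> : k.+1%:R * h * iter k.+1 (J h) f n = J h ((k.+1%:R * h) *: iter k (J h) f) n.
  rewrite -[_ *: _]addr0 (resolvent_lin a_gt0 _ _ lk (l2_0 a_gt0)).
  have -> : J h 0 = 0.
    by have := resolvent_lin a_gt0 h (-1) (l2_0 a_gt0) (l2_0 a_gt0); rewrite !scaleN1r !addNr.
  by rewrite addr0.
apply: (resolvent_le a_gt0 h0 (l2Z a_gt0 _ lk)) => [m|e e0].
  rewrite v1 -[(_ *: _) m]/(k.+1%:R * h * iter k (J h) f m) -natr1 mulrDl mul1r mulrDl.
  by apply: lerD => //; rewrite ler_pM2l//; exact: iter_resolvent_le1.
by exists 0%N => m _; apply: le_trans (v0 m); lra.
Qed.

Lemma semigroup_le t f n C : 0 < t -> l2 f -> (forall k, euler k t f n <= C) -> T t f n <= C.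
Proof.
move=> t0 lf H; have c := euler_pointwise a_gt0 (n := n) (ltW t0) lf.
by apply: (cvg_le_bound c); exact: nearW.
Qed.

Lemma semigroup_ge t f n C : 0 < t -> l2 f -> (forall k, C <= euler k t f n) -> C <= T t f n.
Proof.
move=> t0 lf H; have c : - euler k t f n @[k --> \oo] --> - T t f n.
  by apply: cvgN; exact: (euler_pointwise a_gt0 (n := n) (ltW t0) lf).
by rewrite -lerN2; apply: (cvg_le_bound c); apply: nearW => k; rewrite lerN2.
Qed.

Lemma euler_time k t : (2 ^ k)%:R * (t / 2 ^+ k) = t :> R.
Proof. by rewrite natrX mulrCA mulfV ?mulr1// expf_neq0. Qed.

Lemma step_gt0 k t : 0 < t -> 0 < t / 2 ^+ k.
Proof. by move=> t0; rewrite divr_gt0// exprn_gt0. Qed.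

Local Notation cutoff N := (fun k => if (k < N)%N then 1 else 0 : R).

Lemma l2_cutoff N : l2 (cutoff N).
Proof. exact: (finsupp_l2 a_gt0 (finsupp_cutoff (fun=> 1) N)). Qed.

Lemma cutoff_le1 N n : cutoff N n <= 1.
Proof. by rewrite /=; case: ifP => _ //; exact: ler01. Qed.

Lemma conservative_of_divergent :
  (forall C, exists M, C <= \sum_(0 <= k < M) a k / k.+1%:R) ->
  conservative a (discrete_form a).
Proof.
move=> Soo; exists T; split; first exact: semigroup_form.
exists 1; split=> //; apply/funext => n.
have Voo C : exists N, forall n, (N <= n)%N -> C <= V n.
  have [M CM] := Soo (2 * C); exists (M + M)%N => m Mm.
  apply: le_trans (potential_nondecreasing Mm); apply: le_trans (potential_ge M).
  by rewrite ler_pdivlMr// mulrC.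
apply: cvg_lim; first exact: Rhausdorff.
apply/cvgrPdist_le => r r0; have V1 : 0 < V n + 1 by have := potential_ge0 n; lra.
pose e := r / (V n + 1); have e0 : 0 < e by rewrite divr_gt0.
have [N NP] := Voo e^-1; exists N => // M /= NM.
have le1 : T 1 (cutoff M) n <= 1.
  apply: (semigroup_le ltr01 (l2_cutoff M)) => k.
  exact: iter_resolvent_le1 (step_gt0 k ltr01) (l2_cutoff M) (cutoff_le1 M).
have ge1 : 1 - r <= T 1 (cutoff M) n.
  apply: (semigroup_ge ltr01 (l2_cutoff M)) => k.
  have H m : 1 - e * V m <= cutoff M m.
    rewrite /=; case: ltnP => [_|Mm]; first by rewrite gerBl mulr_ge0 ?potential_ge0// ltW.
    by rewrite subr_le0 -ler_pdivrMl// mulr1 NP// (leq_trans NM).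
  have := iter_resolvent_ge (2 ^ k) n (step_gt0 k ltr01) e0 (l2_cutoff M) Voo H.
  by rewrite euler_time /e divfK// gt_eqF.
by rewrite ger0_norm ?subr_ge0// lerBlDr -lerBlDl.
Qed.

Lemma not_conservative_of_bounded C :
  (forall M, \sum_(0 <= k < M) a k / k.+1%:R <= C) -> ~ conservative a (discrete_form a).
Proof.
move=> SC [U [UP [t [t0 Ut]]]].
have cV : cvgn V.
  apply: nondecreasing_is_cvgn; first exact: potential_nondecreasing.
  by exists C => _ [N _ <-]; exact: le_trans (potential_le N) (SC N).
pose v m : R := limn V + (-1) * V m.
have v0 m : 0 <= v m.
  rewrite /v mulN1r subr_ge0; apply: (nondecreasing_cvgn_le _ cV m).
  exact: potential_nondecreasing.
have v1 m : gen v m = 1 by rewrite gen_affine opprK.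
have [n vn] : exists n, v n <= t / 2.
  have /cvgrPdist_le /(_ (t / 2)) := cV; rewrite divr_gt0// => /(_ isT)[n _ /(_ n (leqnn n))].
  move=> /(le_trans (ler_norm _)) H; exists n; rewrite /v mulN1r; exact: H.
have Uv N : U t (cutoff N) n <= 1 / 2.
  rewrite (semigroup_unique a_gt0 UP (ltW t0) (finsupp_cutoff (fun=> 1) N)).
  apply: (semigroup_le t0 (l2_cutoff N)) => k.
  have := iter_resolvent_lifetime (2 ^ k) n (step_gt0 k t0) (l2_cutoff N) (cutoff_le1 N) v0 v1.
  rewrite euler_time => H; rewrite -(ler_pM2l t0) mul1r.
  exact: le_trans H vn.
have lim1 : limn (fun N => U t (cutoff N) n) = 1 by exact: (congr1 (fun F : nat -> R => F n) Ut).
have [cU|/dvgP dU] := pselect (cvgn (fun N => U t (cutoff N) n)).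
  have : limn (fun N => U t (cutoff N) n) <= 1 / 2.
    by apply: (cvg_le_bound cU); exact: nearW.
  by rewrite lim1; lra.
by move: lim1; rewrite dU => /esym/eqP; rewrite oner_eq0.
Qed.

End Conservativeness.

(** * The criterion *)

Lemma nneseries_bounded (R : realType) (u : nat -> R) : (forall n, 0 < u n) ->
  (\sum_(0 <= n <oo) (u n)%:E < +oo)%E <-> exists C, forall N, \sum_(0 <= n < N) u n <= C.
Proof.
move=> u0; have := l2P u0 (fun=> 1); rewrite /l2 => lP.
have e n : u n * 1 ^+ 2 = u n by rewrite expr1n mulr1.
have -> : (\sum_(0 <= n <oo) (u n)%:E)%E = (\sum_(0 <= n <oo) (u n * 1 ^+ 2)%:E)%E.
  by apply: eq_eseriesr => n _; rewrite e.
rewrite lP; split=> -[C CP]; exists C => N; have := CP N.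
  by under eq_bigr do rewrite e.
by under [X in _ -> X <= _]eq_bigr do rewrite e.
Qed.


Theorem theorem3p7 (R : realType) (a : nat -> R)
    (a_gt0 : forall n : nat, 0 < a n) :
  ((pt_measure a [set: nat] < +oo)%E -> ~ conservative a (trace_form a)) /\
  (pt_measure a [set: nat] = +oo%E ->
    (conservative a (trace_form a) <->
     (\sum_(0 <= n <oo) (a n / n.+1%:R)%:E = +oo)%E)).
Proof.
rewrite (trace_formE a_gt0).
have w_gt0 n : 0 < a n / n.+1%:R by rewrite divr_gt0.
split=> [|_].
  have -> : pt_measure a [set: nat] = (\sum_(0 <= n <oo) (a n)%:E)%E.
    by apply: eq_eseriesr => n _; rewrite diracT mule1.
  move=> /(nneseries_bounded a_gt0)[C aC]; apply: (not_conservative_of_bounded a_gt0 (C := C)) => M.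
  apply: le_trans (aC M); apply: ler_sum => n _.
  by rewrite ler_pdivrMr// ler_peMr ?(ltW (a_gt0 n))// ler1n.
split=> [cons|Soo].
  have [fin|] := ltP (\sum_(0 <= n <oo) (a n / n.+1%:R)%:E)%E +oo%E; last by rewrite leye_eq => /eqP.
  have /(nneseries_bounded w_gt0)[C wC] := fin.
  by case: (not_conservative_of_bounded a_gt0 wC cons).
apply: (conservative_of_divergent a_gt0) => C.
apply: contrapT => noM.
have : (\sum_(0 <= n <oo) (a n / n.+1%:R)%:E < +oo)%E.
  apply/(nneseries_bounded w_gt0); exists C => M; rewrite leNgt; apply/negP => CM.
  by apply: noM; exists M; exact: ltW.
by rewrite Soo.
Qed.
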